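(* Let $\Gamma\colon\mathbb{R}\to\mathbb{R}$ be a continuous function such that the limits $\gamma_\pm:=\lim_{t\to\pm\infty}\Gamma(t)$ exist and are finite, let $\gamma_0:=\Gamma(0)$, and let $p\colon\mathbb{R}\to\mathbb{R}$ be a BPUC function. Consider, for $c\in\mathbb{R}\cup\{\pm\infty\}$ and $h\ge0$, $$y'=-\big(y-\Gamma_c^h(t)\big)^2+p(t),\qquad(\ast)_{c,h}$$ and let $\lambda_*(c,h):=\lambda^*(2\Gamma_c^h,p-(\Gamma_c^h)^2)$. Let $x(t,s,x_0)$ denote the solution of $x'=-x^2+p(t)$ with value $x_0$ at $t=s$. Assume that $x'=-x^2+p(t)$ has an attractor-repeller pair $(\tilde a,\tilde r)$, and let $(\tilde a_\lambda,\tilde r_\lambda)$ be the attractor-repeller pair for $x'=-x^2+p(t)+\lambda$ for $\lambda>\lambda^*(0,p)$. Fix $h\ge0$. Then: (i) there exists $c_{0,h}>0$ such that $(\ast)_{c,h}$ is in Case A for $c\in(-c_{0,h},c_{0,h})$. (ii) If $x(h,0,\tilde a(0)+\gamma_--\gamma_0)$ exists and $x(h,0,\tilde a(0)+\gamma_--\gamma_0)>\tilde r(h)+\gamma_+-\gamma_0$, then the equation $(\ast)_{\infty,h}$ has an attractor-repeller pair. In this case, there exists a minimum $c_{M,h}\ge0$ such that $(\ast)_{c,h}$ is in Case A for $c>c_{M,h}$. (iii) If $x(h,0,\tilde a(0)+\gamma_--\gamma_0)$ does not exist, or if $x(h,0,\tilde a(0)+\gamma_--\gamma_0)<\tilde r(h)+\gamma_+-\gamma_0$,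 then the equation $(\ast)_{\infty,h}$ has no bounded solutions. In this case, there is a minimum $c^*_{M,h}>0$ such that $(\ast)_{c,h}$ is in Case C for $c>c^*_{M,h}$. In addition, if $\tilde a(0)+\gamma_-<\tilde r(0)+\gamma_+$, then $\lambda_*(\infty,0)=\lambda_\infty$, where $\lambda_\infty>0$ is the unique value of the parameter such that $\tilde a_{\lambda_\infty}(0)-\tilde r_{\lambda_\infty}(0)=\gamma_+-\gamma_-$. (iv) If $x(h,0,\tilde a(0)+\gamma_+-\gamma_0)$ exists and $x(h,0,\tilde a(0)+\gamma_+-\gamma_0)>\tilde r(h)+\gamma_--\gamma_0$, then the equation $(\ast)_{-\infty,h}$ has an attractor-repeller pair. In this case, there exists a maximum $c_{m,h}\le0$ such that $(\ast)_{c,h}$ is in Case A for $c<c_{m,h}$. (v) If $x(h,0,\tilde a(0)+\gamma_+-\gamma_0)$ does not exist, or if $x(h,0,\tilde a(0)+\gamma_+-\gamma_0)<\tilde r(h)+\gamma_--\gamma_0$, then the equation $(\ast)_{-\infty,h}$ has no bounded solutions. In this case, there is a maximum $c^*_{m,h}<0$ such that $(\ast)_{c,h}$ is in Case C for $c<c^*_{m,h}$. In addition, if $\tilde a(0)+\gamma_+<\tilde r(0)+\gamma_-$, then $\lambda_*(-\infty,0)=\lambda_{-\infty}>0$, where $\lambda_{-\infty}$ is the unique value of the parameter such that $\tilde a_{\lambda_{-\infty}}(0)-\tilde r_{\lambda_{-\infty}}(0)=\gamma_--\gamma_+$. Here ''$c$'' in the ranges in (i)-(v) is real.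
   Context: BPUC functions: a set $\Delta=\{a_j\mid j\in\mathbb{Z}\}\subset\mathbb{R}$ is disperse if $\inf_{j\in\mathbb{Z}}(a_{j+1}-a_j)>0$. $BPUC_\Delta(\mathbb{R},\mathbb{R})$ is the set of bounded right-continuous functions $q\colon\mathbb{R}\to\mathbb{R}$ such that for all $\varepsilon>0$ there is $\delta>0$ such that, if $t_1,t_2\in(a_j,a_{j+1})$ for some $j\in\mathbb{Z}$ and $|t_2-t_1|<\delta$, then $|q(t_2)-q(t_1)|<\varepsilon$. A function $q$ is BPUC if $q=q_1+\cdots+q_n$ with $q_i\in BPUC_{\Delta_i}(\mathbb{R},\mathbb{R})$ for finitely many disperse sets $\Delta_1,\dots,\Delta_n$. Transition functions: for $c\in\mathbb{R}$, $\Gamma_c^0(t):=\Gamma(c\,t)$, and for $h>0$, $\Gamma_c^h(t):=\Gamma(c\,j\,h)$ if $t\in[jh,(j+1)h)$, $j\in\mathbb{Z}$. $\Gamma_\infty^0(t):=\gamma_-$ if $t<0$ and $\gamma_+$ if $t\ge0$; for $h>0$, $\Gamma_\infty^h(t):=\gamma_-$ if $t<0$, $\gamma_0$ if $0\le t<h$, $\gamma_+$ if $t\ge h$. $\Gamma_{-\infty}^0(t):=\gamma_+$ if $t<0$ and $\gamma_-$ if $t\ge0$; for $h>0$, $\Gamma_{-\infty}^h(t):=\gamma_+$ if $t<0$, $\gamma_0$ if $0\le t<h$, $\gamma_-$ if $t\ge h$. All these functions are BPUC. Solutions are in the Carathéodory sense (absolutely continuous on compact intervals, satisfying the equation a.e.),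 maximally extended; ''$x(h,0,x_0)$ exists'' means that the maximal solution is defined at time $h$. ''Bounded solution'' means globally defined and bounded on $\mathbb{R}$. Bifurcation value: for BPUC functions $q,p$, $\lambda^*(q,p)$ is the unique real number such that $x'=-x^2+q(t)x+p(t)+\lambda$ has a bounded solution if and only if $\lambda\ge\lambda^*(q,p)$ (such a number exists); an attractor-repeller pair exists if and only if $\lambda>\lambda^*(q,p)$. A bounded solution $\tilde b$ of $x'=-x^2+Q(t)x+P(t)$ is hyperbolic if there exist $k\ge1$, $\beta>0$ with either $\exp\int_s^t(-2\tilde b(l)+Q(l))\,dl\le k e^{-\beta(t-s)}$ whenever $t\ge s$ (attractive), or $\exp\int_s^t(-2\tilde b(l)+Q(l))\,dl\le k e^{\beta(t-s)}$ whenever $t\le s$ (repulsive). An attractor-repeller pair $(a,r)$ consists of the maximal bounded solution $a$ and the minimal bounded solution $r$ when they are hyperbolic, with $a$ attractive and $r$ repulsive. Case A: the equation has two different hyperbolic solutions (equivalently, an attractor-repeller pair). Case C: the equation has no bounded solutions. *)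

(* Defs.v *)
From HB Require Import structures.
From mathcomp Require Import all_boot all_order all_algebra.
From mathcomp Require Import all_classical all_reals all_analysis.

Set Implicit Arguments.
Unset Strict Implicit.
Unset Printing Implicit Defensive.

Import Order.TTheory GRing.Theory Num.Theory.
Import numFieldNormedType.Exports.

Local Open Scope classical_set_scope.
Local Open Scope ring_scope.

Section BPUC.
Context {R : realType}.
Implicit Types (q : R -> R) (d : int -> R).

(* The disperse set is given through its enumeration d by the integers.
   [inf] is 0 on sets that are not bounded below, so 0 < inf is not satisfied
   by junk. *)
Definition disperse d := 0 < inf (range (fun j : int => d (j + 1) - d j)).

Definition BPUC_on d q :=
  [/\ bounded_fun q,
      forall t, q u @[u --> t^'+] --> q t &
      forall e, 0 < e -> exists2 delta, 0 < delta &
        forall (j : int) t1 t2, d j < t1 < d (j + 1) -> d j < t2 < d (j + 1) ->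
          `|t2 - t1| < delta -> `|q t2 - q t1| < e].

Definition BPUC q := exists (n : nat) (qs : 'I_n -> R -> R),
  (forall i, exists2 d, disperse d & BPUC_on d (qs i)) /\
  (forall t, q t = \sum_(i < n) qs i t).

End BPUC.

Section QuadraticEquation.
Context {R : realType}.
Implicit Types (Q P x a r b : R -> R) (I : set R).

Definition absolutely_continuous_on (u v : R) x :=
  forall e, 0 < e -> exists2 delta, 0 < delta &
    forall (n : nat) (s t : 'I_n -> R),
      (forall i, u <= s i /\ s i <= t i /\ t i <= v) ->
      trivIset setT (fun i => `]s i, t i[%classic) ->
      \sum_(i < n) (t i - s i) < delta ->
      \sum_(i < n) `|x (t i) - x (s i)| < e.

(* Caratheodory solution on I; only the values of x on I matter, since the
   end points of an interval are negligible. *)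
Definition solution Q P I x :=
  (forall u v, `[u, v] `<=` I -> absolutely_continuous_on u v x) /\
  {ae (@lebesgue_measure R), forall t, I t ->
     is_derive t (1 : R) x (- x t ^+ 2 + Q t * x t + P t)}.

Definition maximal_solution Q P (s x0 : R) I x :=
  [/\ is_interval I, I s, x s = x0, solution Q P I x &
      forall J y, is_interval J -> I `<=` J -> solution Q P J y ->
        (forall t, I t -> y t = x t) -> J `<=` I].

(* The maximal solution with value x0 at s is defined at t, with value z. *)
Definition flow_value Q P (s x0 t z : R) :=
  exists I x, [/\ maximal_solution Q P s x0 I x, I t & x t = z].

Definition bounded_solution Q P b := solution Q P setT b /\ bounded_fun b.

Definition attractive Q b := exists k beta : R, [/\ 1 <= k, 0 < beta &
  forall s t, s <= t ->
    expR (\int[lebesgue_measure]_(l in `[s, t]) (- 2 * b l + Q l))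
      <= k * expR (- beta * (t - s))].

(* For t <= s the integral from s to t is minus the integral over [t, s]. *)
Definition repulsive Q b := exists k beta : R, [/\ 1 <= k, 0 < beta &
  forall s t, t <= s ->
    expR (- \int[lebesgue_measure]_(l in `[t, s]) (- 2 * b l + Q l))
      <= k * expR (beta * (t - s))].

Definition hyperbolic Q P b :=
  bounded_solution Q P b /\ (attractive Q b \/ repulsive Q b).

Definition attractor_repeller_pair Q P a r :=
  [/\ bounded_solution Q P a /\ bounded_solution Q P r,
      forall b, bounded_solution Q P b -> forall t, r t <= b t /\ b t <= a t,
      attractive Q a & repulsive Q r].

Definition case_A Q P :=
  exists b1 b2, [/\ hyperbolic Q P b1, hyperbolic Q P b2 & b1 <> b2].

Definition case_C Q P := ~ exists b, bounded_solution Q P b.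

Definition is_bifurcation_value Q P (l0 : R) :=
  forall l, (exists b, bounded_solution Q (fun t => P t + l) b) <-> l0 <= l.

Definition lambda_star Q P : R := get (is_bifurcation_value Q P).

(* The parameters l > lambda_star 0 P for which the attractor-repeller pair
   (a, r) of x' = - x^2 + P(t) + l satisfies a(0) - r(0) = d. *)
Definition gap_parameters P (d : R) : set R := [set l |
  lambda_star (cst 0) P < l /\
  exists a r, attractor_repeller_pair (cst 0) (fun t => P t + l) a r /\
              a 0 - r 0 = d].

End QuadraticEquation.

Section Transition.
Context {R : realType}.
Implicit Types (Gam p : R -> R) (gm gp h : R) (c : \bar R).

(* For infinite c and h = 0 the middle branch is empty.  For real c and h > 0,
   t lies in [jh, (j+1)h) with j = floor (t / h). *)
Definition transition Gam gm gp c h : R -> R := fun t =>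
  match c with
  | EFin c => if h == 0 then Gam (c * t)
              else Gam (c * (Num.floor (t / h))%:~R * h)
  | EPInf => if t < 0 then gm else if t < h then Gam 0 else gp
  | ENInf => if t < 0 then gp else if t < h then Gam 0 else gm
  end.

(* Coefficients of y' = - (y - Gam_c^h(t))^2 + p(t), expanded as
   y' = - y^2 + transQ(t) y + transP(t). *)
Definition transQ Gam gm gp c h : R -> R :=
  fun t => 2 * transition Gam gm gp c h t.

Definition transP Gam gm gp p c h : R -> R :=
  fun t => p t - transition Gam gm gp c h t ^+ 2.

End Transition.

Definition is_minimum {R : realType} (E : set R) (m : R) := E m /\ lbound E m.
Definition is_maximum {R : realType} (E : set R) (m : R) := E m /\ ubound E m.

(* Main.v *)
Require Import Defs.
From HB Require Import structures.
From mathcomp Require Import all_boot all_order all_algebra.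
From mathcomp Require Import all_classical all_reals all_analysis.
From mathcomp Require Import measurable_realfun ring lra.
Import Order.TTheory GRing.Theory Num.Theory.
Import numFieldNormedType.Exports.
Set Implicit Arguments.
Unset Strict Implicit.
Unset Printing Implicit Defensive.
Local Open Scope classical_set_scope.
Local Open Scope ring_scope.

(** For a shift [G] the equation is [y' = - (y - G) ^+ 2 + p], whose right-hand side
    is concave in [y]. The argument rests on one criterion: there is an
    attractor-repeller pair if and only if there is a bounded strict lower
    solution, a bounded function [al], possibly with downward jumps, with
    [al' <= - (al - G) ^+ 2 + p - m] for a constant [m > 0]. Given [al], the extreme
    initial values of solutions that stay bounded in the past, respectively in the
    future, define bounded solutions [r < al < a] ([lower_pair]), and the margin
    [m] keeps [a - r] away from zero. Uniform separation yields hyperbolicity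
    because [a - r] satisfies a linear equation with coefficient
    [- (a + r) + 2 G], and extremality because three ordered solutions have an
    exponentially evolving ratio of distances ([pair_of_separated],
    [past_solution_le], [future_solution_ge]). Conversely the two solutions of a
    pair are uniformly separated ([pair_separated]), and by concavity their mean
    is a strict lower solution ([pair_strict_lower]).

    Every assertion then amounts to exhibiting a strict lower solution.
    - A bounded solution is a strict lower solution for each larger parameter; with
      a compactness argument this gives the existence of the bifurcation value
      ([bifurcation_exists]).
    - A strict lower solution survives a perturbation of the shift that is small
      outside a short interval ([strict_lower_persist]). Hence an
      attractor-repeller pair at infinite rate persists for large finite rates
      ([persist_AR]), and so does the absence of bounded solutions
      ([persist_no_bounded]).
    - For small rates the moving average of the shift, added to the mean of the
      base pair, is a strict lower solution ([slow_shift_AR]).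
    - At infinite rate a strict lower solution is glued from convex combinations
      of the base pair and from the solution on [0, h], when the latter ends above
      the translated repeller ([jump_AR]). A bounded solution cannot exist when it
      ends below, because a bounded solution lies below the translated attractor
      up to [0] and above the translated repeller from [h] on ([jump_no_bounded]).
      For [h = 0] the two facts identify the bifurcation value with the parameter
      at which the gap of the pair equals the height of the jump ([jump_gap]).
    Negative rates reduce to positive ones by reflecting the shift.

    Solutions are handled through right derivatives. The coefficients are
    right-continuous, so a solution in the sense of Caratheodory is a left-continuous
    function whose right derivative obeys the equation everywhere
    ([solution_isol], [isol_solution]), and comparison becomes an elementary
    barrier principle proved by real induction ([barrier]). *)

(** * Right derivatives and real induction *)

Section RightDerivative.
Context {R : realType}.
Implicit Types (x y W D : R -> R) (P : R -> Prop) (s t u l m e : R).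

Lemma near_rightP P t :
  (\forall u \near t^'+, P u) <->
  exists2 e, 0 < e & forall u, t < u < t + e -> P u.
Proof.
split=> [[e /= e0 he]|[e e0 he]].
  exists e => // u /andP[tu ut]; apply: he => //=.
  by rewrite /ball_ /= distrC gtr0_norm; lra.
near=> u; apply: he; apply/andP; split; first by near: u; exact: nbhs_right_gt.
by near: u; apply: nbhs_right_lt; lra.
Unshelve. all: by end_near. Qed.

Lemma near_leftP P t :
  (\forall u \near t^'-, P u) <->
  exists2 e, 0 < e & forall u, t - e < u < t -> P u.
Proof.
split=> [[e /= e0 he]|[e e0 he]].
  exists e => // u /andP[tu ut]; apply: he => //=.
  by rewrite /ball_ /= gtr0_norm; lra.
near=> u; apply: he; apply/andP; split; last by near: u; exact: nbhs_left_lt.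
by near: u; apply: nbhs_left_gt; lra.
Unshelve. all: by end_near. Qed.

Lemma gt_subr_neq0 t u : t < u -> u - t != 0.
Proof. by rewrite -subr_gt0 => /gt_eqF ->. Qed.

(** The coefficients are right-continuous, so solutions are differentiable from
    the right everywhere, while two-sided derivatives fail to exist at the
    jumps. *)
Definition rder x t l := (x u - x t) / (u - t) @[u --> t^'+] --> l.

Definition leftc x t := x u @[u --> t^'-] --> x t.

Definition rightc x t := x u @[u --> t^'+] --> x t.

(** Left upper semicontinuity: what remains of left-continuity when upward
    jumps are tolerated. *)
Definition lusc x t := forall e, 0 < e -> \forall u \near t^'-, x u < x t + e.

Lemma rder_expand x t l : rder x t l <-> forall e, 0 < e ->
  \forall u \near t^'+, `|x u - x t - l * (u - t)| <= e * (u - t).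
Proof.
have key u e : t < u -> (`|l - (x u - x t) / (u - t)| <= e) =
    (`|x u - x t - l * (u - t)| <= e * (u - t)).
  move=> tu; have ut : 0 < u - t by lra.
  rewrite distrC -(ler_pM2r ut) -[X in _ * X <= _](gtr0_norm ut) -normrM.
  by rewrite mulrBl divfK// gt_eqF.
split=> [/cvgrPdist_le h e e0|h].
  near=> u; rewrite -key; last by near: u; exact: nbhs_right_gt.
  by near: u; exact: h.
apply/cvgrPdist_le => e e0; near=> u.
rewrite key; first by near: u; exact: h.
by near: u; exact: nbhs_right_gt.
Unshelve. all: by end_near. Qed.

Lemma rder_rightc x t l : rder x t l -> rightc x t.
Proof.
move=> h; rewrite /rightc.
have h1 : (x u - x t) / (u - t) * (u - t) @[u --> t^'+] --> l * (t - t).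
  apply: cvgM => //; apply: cvgB; last exact: cvg_cst.
  by apply: cvg_at_right_filter; exact: cvg_id.
rewrite subrr mulr0 in h1.
have h2 : (x u - x t) / (u - t) * (u - t) + x t @[u --> t^'+] --> 0 + x t.
  by apply: cvgD => //; exact: cvg_cst.
rewrite add0r in h2; apply: cvg_trans h2; apply: near_eq_cvg; near=> u.
have tu : t < u by near: u; exact: nbhs_right_gt.
by rewrite divfK ?subrK// gt_subr_neq0.
Unshelve. all: by end_near. Qed.

Lemma rder_near x y t l : (\forall u \near t^'+, x u = y u) -> x t = y t ->
  rder x t l -> rder y t l.
Proof.
move=> h e hx; apply: cvg_trans hx; apply: near_eq_cvg.
by apply: filterS h => u /= ->; rewrite e.
Qed.

Lemma rder_cst (c : R) t : rder (fun=> c) t 0.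
Proof.
rewrite /rder (_ : (fun _ => _) = fun=> 0); first exact: cvg_cst.
by apply/funext => u; rewrite subrr mul0r.
Qed.

Lemma rder_id t : rder (fun u => u) t 1.
Proof.
have h : (fun=> 1 : R) u @[u --> t^'+] --> (1 : R) by exact: cvg_cst.
apply: cvg_trans h; apply: near_eq_cvg.
near=> u; have tu : t < u by near: u; exact: nbhs_right_gt.
by rewrite divff// gt_subr_neq0.
Unshelve. all: by end_near. Qed.

Lemma rderD x y t l m : rder x t l -> rder y t m ->
  rder (fun u => x u + y u) t (l + m).
Proof.
move=> hx hy; have h := cvgD hx hy; rewrite /rder.
rewrite (_ : (fun _ => _) =
  ((fun u => (x u - x t) / (u - t)) \+ (fun u => (y u - y t) / (u - t)))); first exact: h.
by apply/funext => u /=; rewrite -mulrDl; congr (_ / _); ring.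
Qed.

Lemma rderM x y t l m : rder x t l -> rder y t m ->
  rder (fun u => x u * y u) t (l * y t + x t * m).
Proof.
move=> hx hy.
have h : (x u - x t) / (u - t) * y u + x t * ((y u - y t) / (u - t))
    @[u --> t^'+] --> l * y t + x t * m.
  apply: cvgD; first by apply: cvgM => //; exact: rder_rightc hy.
  by apply: cvgM => //; exact: cvg_cst.
apply: cvg_trans h; apply: near_eq_cvg; near=> u => /=.
have tu : t < u by near: u; exact: nbhs_right_gt.
by field; exact: gt_subr_neq0.
Unshelve. all: by end_near. Qed.

Lemma rderZ (c : R) x t l : rder x t l -> rder (fun u => c * x u) t (c * l).
Proof.
by move=> h; have := rderM (rder_cst c t) h; rewrite mul0r add0r.
Qed.

Lemma rderN x t l : rder x t l -> rder (fun u => - x u) t (- l).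
Proof.
move=> /(@rderZ (-1) _ _ _); rewrite mulN1r.
by congr rder; apply/funext => u; rewrite mulN1r.
Qed.

Lemma rderB x y t l m : rder x t l -> rder y t m ->
  rder (fun u => x u - y u) t (l - m).
Proof. by move=> hx /rderN; exact: rderD. Qed.

(** The difference quotient of the outer function extends continuously to the
    base point, where [x] may come back arbitrarily often. *)
Lemma rder_comp (phi : R -> R) x t l m :
  is_derive (x t) (1 : R) phi m -> rder x t l ->
  rder (fun u => phi (x u)) t (m * l).
Proof.
move=> [dphi phim] hx.
pose psi z := if z == x t then m else (phi z - phi (x t)) / (z - x t).
have psic : psi z @[z --> x t] --> psi (x t).
  rewrite {2}/psi eqxx; apply/cvgrPdist_le => e e0.
  have : (fun k => k^-1 *: (phi (k *: 1 + x t) - phi (x t))) @ 0^' --> m.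
    by rewrite -phim; exact: dphi.
  move=> /cvgrPdist_le /(_ _ e0) [d /= d0 hd].
  exists d => //= z /= zd; rewrite /psi; case: eqP => [_|/eqP zt].
    by rewrite subrr normr0 ltW.
  have := hd (z - x t); rewrite /= sub0r normrN distrC => /(_ zd).
  by rewrite subr_eq0 => /(_ zt); rewrite /GRing.scale/= mulr1 subrK mulrC.
have h1 : psi (x u) @[u --> t^'+] --> psi (x t).
  by apply: cvg_comp psic; exact: rder_rightc hx.
have h : psi (x u) * ((x u - x t) / (u - t)) @[u --> t^'+] --> m * l.
  have <- : psi (x t) = m by rewrite /psi eqxx.
  exact: cvgM h1 hx.
apply: cvg_trans h; apply: near_eq_cvg; near=> u => /=; rewrite /psi; case: eqP => [->|/eqP ut].
  by rewrite !subrr mul0r mulr0.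
have tu : t < u by near: u; exact: nbhs_right_gt.
by field; rewrite gt_subr_neq0// subr_eq0 ut.
Unshelve. all: by end_near. Qed.

Lemma rder_exp x t l : rder x t l ->
  rder (fun u => expR (x u)) t (expR (x t) * l).
Proof. by apply: rder_comp; exact: is_derive_expR. Qed.

Lemma rder_sqr x t l : rder x t l -> rder (fun u => x u ^+ 2) t (2 * x t * l).
Proof.
move=> h; have := rderM h h.
have -> : l * x t + x t * l = 2 * x t * l by ring.
by congr rder; apply/funext => u; rewrite expr2.
Qed.

Lemma rder_inv x t l : x t != 0 -> rder x t l ->
  rder (fun u => (x u)^-1) t (- (x t) ^- 2 * l).
Proof.
move=> x0 h; have hx := rder_rightc h.
have hV : - ((x u)^-1 * (x t)^-1) * ((x u - x t) / (u - t)) @[u --> t^'+] -->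
    - ((x t)^-1 * (x t)^-1) * l.
  apply: cvgM => //; apply: cvgN; apply: cvgM; last exact: cvg_cst.
  exact: cvgV.
rewrite (_ : - (x t) ^- 2 = - ((x t)^-1 * (x t)^-1)); last first.
  by rewrite -exprVn expr2.
apply: cvg_trans hV; apply: near_eq_cvg; near=> u.
have tu : t < u by near: u; exact: nbhs_right_gt.
have xu0 : x u != 0 by near: u; exact: cvgr_neq0 hx x0.
by field; rewrite gt_subr_neq0// x0.
Unshelve. all: by end_near. Qed.

Lemma leftc_lusc x t : leftc x t -> lusc x t.
Proof.
move=> /cvgrPdist_lt h e e0; near=> u.
have : `|x t - x u| < e by near: u; exact: h.
by rewrite ltr_norml => /andP[]; lra.
Unshelve. all: by end_near. Qed.

Lemma luscD x y t : lusc x t -> lusc y t -> lusc (fun u => x u + y u) t.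
Proof.
move=> hx hy e e0; have e2 : 0 < e / 2 by lra.
by apply: filterS2 (hx _ e2) (hy _ e2) => u; lra.
Qed.

(** Real induction: a property that starts at [s], spreads to the right and
    passes to left limits holds on the whole interval. *)
Lemma real_induction P s t : s <= t -> P s ->
  (forall u, s <= u < t -> P u -> \forall v \near u^'+, P v) ->
  (forall u, s < u <= t -> (forall v, s <= v < u -> P v) -> P u) ->
  forall u, s <= u <= t -> P u.
Proof.
move=> st Ps Pr Pl.
pose A := [set v | s <= v <= t /\ forall u, s <= u <= v -> P u].
have As : A s.
  split=> [|u us]; first by rewrite lexx.
  by have -> : u = s by apply/eqP; rewrite eq_le andbC.
have supA : has_sup A.
  by split; [exists s|exists t => v [/andP[]]].
pose c := sup A.
have sc : s <= c by exact: (ub_le_sup supA.2 As).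
have ct : c <= t by apply: ge_sup => [|v [/andP[]]//]; exists s.
have lec v : s <= v < c -> P v.
  move=> /andP[sv vc]; have [w [_ Pw] vw] := sup_gt supA.1 vc.
  by apply: Pw; lra.
have Pc : P c.
  have [->//|cs] := eqVneq c s; apply: Pl => //.
  by rewrite ct andbT lt_neqAle eq_sym cs.
have Pc' u : s <= u <= c -> P u.
  by move=> /andP[su]; rewrite le_eqVlt => /predU1P[->//|uc]; apply: lec; lra.
have [ect|nct] := eqVneq c t; first by rewrite -ect.
have clt : c < t by rewrite lt_neqAle nct.
have /near_rightP[e e0 he] : \forall v \near c^'+, P v by apply: Pr => //; lra.
pose d := Num.min (c + e / 2) t.
have dc : c < d by rewrite lt_min clt andbT; lra.
have Ad : A d.
  split=> [|u /andP[su ud]]; first by rewrite ge_min lexx orbT andbT; lra.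
  have [uc|cu] := leP u c; first by apply: Pc'; lra.
  apply: he; rewrite cu /=; move: ud; rewrite le_min => /andP[]; lra.
by have := ub_le_sup supA.2 Ad; rewrite -/c; lra.
Qed.

(** At a zero of [W] the right derivative is positive, so [W] cannot cross
    zero downwards; jumps of [W] are upwards. *)
Lemma barrier W s t : s <= t -> 0 <= W s ->
  (forall u, s < u <= t -> lusc W u) ->
  (forall u, s <= u < t -> exists2 l, rder W u l & W u = 0 -> 0 < l) ->
  0 <= W t.
Proof.
move=> st Ws Wl Wr.
apply: (@real_induction (fun u => 0 <= W u) s t) => //; last by lra.
- move=> u sut Wu; have [l hl l0] := Wr _ sut.
  have [Wu0|Wu0] := eqVneq (W u) 0; last first.
    have {Wu Wu0} : 0 < W u by rewrite lt_neqAle eq_sym Wu0.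
    move=> /(cvgr_gt _ (rder_rightc hl)); apply: filterS => v; exact: ltW.
  have {l0}/(l0) l0 := Wu0.
  have l20 : 0 < l / 2 by lra.
  have /rder_expand/(_ _ l20)/near_rightP[e e0 he] := hl.
  apply/near_rightP; exists e => // v uv; have := he v uv.
  rewrite Wu0 subr0 ler_norml => /andP[h _].
  have hp : 0 <= l / 2 * (v - u) by apply: mulr_ge0; lra.
  lra.
- move=> u sut Wu; rewrite leNgt; apply/negP => Wu0.
  have Wu2 : 0 < - W u / 2 by lra.
  have /near_leftP[e e0 he] := Wl u sut _ Wu2.
  pose v := Num.max s (u - e / 2).
  have vu : v < u by rewrite gt_max; lra.
  have sv : s <= v by rewrite le_max lexx.
  have ev : u - e < v by rewrite lt_max; apply/orP; right; lra.
  by have := he v; rewrite ev vu => /(_ isT); have := Wu v; rewrite sv vu => /(_ isT); lra.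
Qed.

End RightDerivative.

(** * Differential inequalities *)

Section DifferentialInequalities.
Context {R : realType}.
Implicit Types (x y W D : R -> R) (s t u l m e K C : R).

Lemma leftc_cst (c : R) t : leftc (fun=> c) t. Proof. exact: cvg_cst. Qed.

Lemma leftc_cont x t : {for t, continuous x} -> leftc x t.
Proof. by move=> h; apply: cvg_at_left_filter. Qed.

Lemma leftc_id t : leftc (fun u => u) t.
Proof. exact: (@leftc_cont id). Qed.

Lemma leftcD x y t : leftc x t -> leftc y t -> leftc (fun u => x u + y u) t.
Proof. exact: cvgD. Qed.

Lemma leftcN x t : leftc x t -> leftc (fun u => - x u) t.
Proof. exact: cvgN. Qed.

Lemma leftcB x y t : leftc x t -> leftc y t -> leftc (fun u => x u - y u) t.
Proof. exact: cvgB. Qed.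

Lemma leftcM x y t : leftc x t -> leftc y t -> leftc (fun u => x u * y u) t.
Proof. exact: cvgM. Qed.

Lemma leftc_sqr x t : leftc x t -> leftc (fun u => x u ^+ 2) t.
Proof.
by move=> h; under eq_fun do rewrite expr2; exact: leftcM.
Qed.

Lemma leftc_comp (phi : R -> R) x t : {for x t, continuous phi} ->
  leftc x t -> leftc (fun u => phi (x u)) t.
Proof. by move=> hphi hx; apply: (cvg_comp _ _ hx hphi). Qed.

Lemma leftc_exp x t : leftc x t -> leftc (fun u => expR (x u)) t.
Proof. by apply: leftc_comp; exact: continuous_expR. Qed.

Lemma leftc_inv x t : x t != 0 -> leftc x t -> leftc (fun u => (x u)^-1) t.
Proof. by move=> x0 h; exact: cvgV. Qed.

Lemma leftc_eq x y t : (\forall u \near t^'-, x u = y u) -> x t = y t ->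
  leftc x t -> leftc y t.
Proof.
by move=> h e; rewrite /leftc -e; apply: cvg_trans; exact: near_eq_cvg.
Qed.

Lemma leftc_rightc_continuous x t : leftc x t -> rightc x t ->
  {for t, continuous x}.
Proof. by move=> h1 h2; apply/left_right_continuousP. Qed.

Lemma ler_rder W s t : s <= t -> (forall u, s < u <= t -> lusc W u) ->
  (forall u, s <= u < t -> exists2 l, rder W u l & 0 <= l) -> W s <= W t.
Proof.
move=> st Wl Wr; apply/ler_addgt0Pr => e e0.
pose d := e / (t - s + 1); have d0 : 0 < d by apply: divr_gt0; lra.
have : 0 <= (W t - W s) + (d * t - d * s).
  apply: (@barrier _ (fun u => (W u + - W s) + (d * u + - (d * s))) s t) => //=.
  - by lra.
  - move=> u sut; apply: luscD; first apply: luscD; first exact: Wl.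
      by apply: leftc_lusc; exact: leftc_cst.
    apply: leftc_lusc; apply: leftcD; last exact: leftc_cst.
    by apply: leftcM; [exact: leftc_cst|exact: leftc_id].
  - move=> u sut; have [l hl l0] := Wr _ sut.
    exists (l + 0 + (d * 1 + 0)); last by move=> _; lra.
    apply: rderD; first by apply: rderD => //; exact: rder_cst.
    by apply: rderD; [apply: rderZ; exact: rder_id|exact: rder_cst].
suff : d * (t - s) <= e by lra.
rewrite /d -mulrA -[leRHS]mulr1 ler_pM2l// mulrC ler_pdivrMr; lra.
Qed.

Lemma ger_rder W s t : s <= t -> (forall u, s < u <= t -> leftc W u) ->
  (forall u, s <= u < t -> exists2 l, rder W u l & l <= 0) -> W t <= W s.
Proof.
move=> st Wl Wr; rewrite -lerN2.
apply: (@ler_rder (fun u => - W u)) => // u sut.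
  by apply: leftc_lusc; apply: leftcN; exact: Wl.
by have [l hl l0] := Wr _ sut; exists (- l); [exact: rderN|lra].
Qed.

Lemma rder_expZ (c : R) s u : rder (fun v => expR (c * (v - s))) u
  (expR (c * (u - s)) * c).
Proof.
apply: rder_exp; rewrite -[X in rder _ _ X]mulr1; apply: rderZ.
by rewrite -[1]subr0; apply: rderB; [exact: rder_id|exact: rder_cst].
Qed.

Lemma leftc_expZ (c : R) s u : leftc (fun v => expR (c * (v - s))) u.
Proof.
apply: leftc_exp; apply: leftcM; first exact: leftc_cst.
by apply: leftcB; [exact: leftc_id|exact: leftc_cst].
Qed.

(** A weak barrier is obtained from strict ones: [W + d expR ((K + 1) (u - s))]
    cannot reach zero, for every [d > 0]. *)
Lemma nonneg_of_rder W K s t : 0 <= K -> s <= t -> 0 <= W s ->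
  (forall u, s < u <= t -> lusc W u) ->
  (forall u, s <= u < t -> exists2 l, rder W u l & - K * `|W u| <= l) ->
  0 <= W t.
Proof.
move=> K0 st Ws Wl Wr; apply/ler_addgt0Pr => e e0.
pose E := fun u => expR ((K + 1) * (u - s)).
have E0 u : 0 < E u by exact: expR_gt0.
pose d := e / E t; have d0 : 0 < d by exact: divr_gt0.
have <- : d * E t = e by rewrite divfK// gt_eqF.
apply: (@barrier _ (fun u => W u + d * E u) s t) => //=.
- by apply: addr_ge0 => //; apply: mulr_ge0; exact: ltW.
- move=> u sut; apply: luscD; first exact: Wl.
  apply: leftc_lusc; apply: leftcM; [exact: leftc_cst|exact: leftc_expZ].
- move=> u sut; have [l hl l0] := Wr _ sut.
  exists (l + d * (E u * (K + 1))).
    by apply: rderD => //; apply: rderZ; exact: rder_expZ.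
  move=> h; have dE : 0 < d * E u by exact: mulr_gt0.
  have Wu : W u = - (d * E u) by lra.
  move: l0; rewrite Wu normrN gtr0_norm//.
  have -> : d * (E u * (K + 1)) = K * (d * E u) + d * E u by ring.
  lra.
Qed.

(** Once a function with [W' >= m - K |W|] is above [- m / (2 K)], it is above
    [m / (2 K)] after the time [3 / K]: the line of slope [m / 3] joining these
    two values is a strict lower barrier. *)
Lemma gap_of_rder W K m s : 0 < K -> 0 < m -> - (m / (2 * K)) <= W s ->
  (forall u, s < u <= s + 3 / K -> lusc W u) ->
  (forall u, s <= u < s + 3 / K ->
    exists2 l, rder W u l & m - K * `|W u| <= l) ->
  m / (2 * K) <= W (s + 3 / K).
Proof.
move=> K0 m0 Ws Wl Wr; set t := s + 3 / K.
pose w := m / (2 * K); have w0 : 0 < w by apply: divr_gt0; lra.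
have mw : m = 2 * K * w by rewrite /w mulrC divfK// gt_eqF//; lra.
pose B u := - w + m / 3 * (u - s).
have st : s < t by rewrite ltrDl divr_gt0.
have Bt : B t = w.
  rewrite /B /t /w; field; rewrite gt_eqF//; lra.
rewrite -/w -Bt -subr_ge0.
apply: (@barrier _ (fun u => W u + - B u) s t); first exact: ltW.
- by rewrite /B subrr mulr0 addr0; move: Ws; rewrite -/w; lra.
- move=> u sut; apply: luscD; first exact: Wl.
  apply: leftc_lusc; apply: leftcN; apply: leftcD; first exact: leftc_cst.
  apply: leftcM; first exact: leftc_cst.
  by apply: leftcB; [exact: leftc_id|exact: leftc_cst].
- move=> u sut; have [l hl l0] := Wr _ sut.
  exists (l + - (0 + m / 3 * (1 - 0))).
    apply: rderD => //; apply: rderN; apply: rderD; first exact: rder_cst.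
    by apply: rderZ; apply: rderB; [exact: rder_id|exact: rder_cst].
  move=> h; have Wu : W u = B u by lra.
  have Bu : `|B u| <= w.
    rewrite ler_norml /B; have m3 : 0 < m / 3 by lra.
    have h1 : 0 <= m / 3 * (u - s) by apply: mulr_ge0; lra.
    have h2 : m / 3 * (u - s) <= m / 3 * (t - s) by rewrite ler_pM2l//; lra.
    by move: Bt; rewrite /B; lra.
  have : K * `|B u| <= K * w by rewrite ler_pM2l.
  rewrite -Wu; lra.
Qed.

Lemma exp_bound Z C s t : 0 <= C ->
  (forall u, leftc Z u) ->
  (forall u, exists2 l, rder Z u l & `|l| <= C * Z u) ->
  Z t <= Z s * expR (C * `|t - s|).
Proof.
move=> C0 Zl Zr; have [st|/ltW ts] := leP s t.
  rewrite ger0_norm; last by lra.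
  have : Z t * expR (- C * (t - s)) <= Z s * expR (- C * (s - s)).
    apply: (@ger_rder (fun u => Z u * expR (- C * (u - s)))) => // u _.
      by apply: leftcM; [exact: Zl|exact: leftc_expZ].
    have [l hl lC] := Zr u; eexists.
      by apply: rderM; [exact: hl|exact: rder_expZ].
    set E := expR _; have E0 : 0 < E by exact: expR_gt0.
    have -> : l * E + Z u * (E * - C) = E * (l - C * Z u) by ring.
    rewrite pmulr_rle0//.
    by move: lC; rewrite ler_norml => /andP[]; lra.
  rewrite subrr mulr0 expR0 mulr1 mulNr expRN.
  by rewrite ler_pdivrMr ?expR_gt0.
rewrite distrC ger0_norm; last by lra.
have : Z t * expR (C * (t - s)) <= Z s * expR (C * (s - s)).
  apply: (@ler_rder (fun u => Z u * expR (C * (u - s)))) => // u _.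
    by apply: leftc_lusc; apply: leftcM; [exact: Zl|exact: leftc_expZ].
  have [l hl lC] := Zr u; eexists.
    by apply: rderM; [exact: hl|exact: rder_expZ].
  set E := expR _; have E0 : 0 < E by exact: expR_gt0.
  have -> : l * E + Z u * (E * C) = E * (l + C * Z u) by ring.
  rewrite pmulr_rge0//.
  by move: lC; rewrite ler_norml => /andP[]; lra.
rewrite subrr mulr0 expR0 mulr1.
rewrite -[C * (s - t)]opprK expRN -mulrN opprB => h.
by rewrite ler_pdivlMr ?expR_gt0.
Qed.

(** The square of [W], shifted by [e ^+ 2], satisfies a linear differential
    inequality in both time directions. *)
Lemma gronwall W K e s t : 0 <= K ->
  (forall u, leftc W u) ->
  (forall u, exists2 l, rder W u l & `|l| <= K * `|W u| + e) ->
  W t ^+ 2 + e ^+ 2 <=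
    (W s ^+ 2 + e ^+ 2) * expR ((2 * K + 1) * `|t - s|).
Proof.
move=> K0 Wl Wr.
apply: (@exp_bound (fun u => W u ^+ 2 + e ^+ 2)) => [|u|u].
- lra.
- by apply: leftcD; [exact: leftc_sqr|exact: leftc_cst].
- have [l hl lK] := Wr u; exists (2 * W u * l + 0).
    by apply: rderD; [exact: rder_sqr|exact: rder_cst].
  rewrite addr0 !normrM (ger0_norm (ler0n _ 2)) -(real_normK (num_real (W u))).
  have h := ler_wpM2l (normr_ge0 (W u)) lK.
  have := sqr_ge0 (`|W u| - e); rewrite sqrrB; nra.
Qed.

End DifferentialInequalities.

(** * Right-continuous functions and their primitives *)

Section RegularFunctions.
Context {R : realType}.
Implicit Types (g x y : R -> R) (s t u l m e K C : R).
Notation mu := (@lebesgue_measure R).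

Lemma countable_setU (A B : set R) : countable A -> countable B ->
  countable (A `|` B).
Proof.
move=> cA cB; have -> : A `|` B = \bigcup_(b in [set: bool]) if b then A else B.
  apply/seteqP; split=> [u [Au|Bu]|u [[] _]]; [by exists true|by exists false|..].
    by left.
  by right.
by apply: bigcup_countable => // -[].
Qed.

(** A class of coefficients that contains the BPUC functions and all transition
    functions, and is closed under the algebraic operations; it retains what is
    needed to integrate them and to differentiate the integral from the right. *)
Definition reg g := [/\ exists M, forall t, `|g t| <= M,
  forall t, rightc g t &
  exists D : set R, countable D /\ forall t, ~ D t -> {for t, continuous g}].

Lemma reg_bound g : reg g -> exists2 M, 0 < M & forall t, `|g t| <= M.
Proof.
move=> [[M hM] _ _]; exists (M + 1) => [|t].
  by have := le_trans (normr_ge0 _) (hM 0); lra.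
by have := hM t; lra.
Qed.

Lemma reg_cont g M : continuous g -> (forall t, `|g t| <= M) -> reg g.
Proof.
move=> cg hM; split; first by exists M.
- by move=> t; apply: cvg_at_right_filter; exact: cg.
- by exists set0; split => // t _; exact: cg.
Qed.

Lemma reg_cst c : reg (fun=> c).
Proof. by apply: (@reg_cont _ `|c|) => // t; exact: cvg_cst. Qed.

Lemma regD g1 g2 : reg g1 -> reg g2 -> reg (fun t => g1 t + g2 t).
Proof.
move=> [[M1 b1] r1 [D1 [c1 k1]]] [[M2 b2] r2 [D2 [c2 k2]]]; split.
- exists (M1 + M2) => t; apply: le_trans (ler_normD _ _) _.
  exact: lerD.
- by move=> t; exact: cvgD (r1 t) (r2 t).
- exists (D1 `|` D2); split; first exact: countable_setU.
  move=> t /not_orP[/k1 h1 /k2 h2]; exact: cvgD h1 h2.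
Qed.

Lemma regM g1 g2 : reg g1 -> reg g2 -> reg (fun t => g1 t * g2 t).
Proof.
move=> [[M1 b1] r1 [D1 [c1 k1]]] [[M2 b2] r2 [D2 [c2 k2]]]; split.
- exists (M1 * M2) => t; rewrite normrM; exact: ler_pM.
- by move=> t; exact: cvgM (r1 t) (r2 t).
- exists (D1 `|` D2); split; first exact: countable_setU.
  move=> t /not_orP[/k1 h1 /k2 h2]; exact: cvgM h1 h2.
Qed.

Lemma regN g : reg g -> reg (fun t => - g t).
Proof.
move=> h; have := regM (reg_cst (-1)) h; congr reg.
by apply/funext => t; rewrite mulN1r.
Qed.

Lemma regB g1 g2 : reg g1 -> reg g2 -> reg (fun t => g1 t - g2 t).
Proof. by move=> h1 h2; apply: regD => //; exact: regN. Qed.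

Lemma reg_sqr g : reg g -> reg (fun t => g t ^+ 2).
Proof. by move=> h; under eq_fun do rewrite expr2; exact: regM. Qed.

(** Off a countable, hence measurable, set the function is continuous. *)
Lemma reg_measurable g : reg g -> measurable_fun setT g.
Proof.
move=> [_ _ [D [cD kD]]].
have mD : measurable D.
  by apply: countable_measurable => // t; exact: measurable_set1.
rewrite -(setUv D); apply/measurable_funU => //; first exact: measurableC.
split; last first.
  apply: subspace_continuous_measurable_fun; first exact: measurableC.
  apply: continuous_in_subspaceT => t; rewrite inE => Dt.
  exact: kD.
move=> _ Y mY; apply: countable_measurable => [t|]; first exact: measurable_set1.
apply: sub_countable cD; apply: subset_card_le; exact: subIsetl.
Qed.

Lemma reg_integrable g s t : reg g -> mu.-integrable `[s, t] (EFin \o g).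
Proof.
move=> rg; have mg := reg_measurable rg; have [M M0 hM] := reg_bound rg.
have fin : (mu `[s, t] < +oo)%E.
  by rewrite lebesgue_measure_itv/=; case: ifP => // _; rewrite ltry.
apply: measurable_bounded_integrable => //.
- exact: measurable_funS mg.
- exists M; split; first exact: num_real.
  by move=> M' MM' u _ /=; exact: le_trans (hM u) (ltW MM').
Qed.

Lemma Rintegral_chasles g s t u : reg g -> s <= t -> t <= u ->
  \int[mu]_(l in `[s, u]) g l =
  \int[mu]_(l in `[s, t]) g l + \int[mu]_(l in `[t, u]) g l.
Proof.
move=> rg st tu; rewrite -(Rintegral_itv_obnd_cbnd (r := t)); last first.
  apply: integrableS (reg_integrable t u rg) => //.
  by apply: subset_itvr; rewrite bnd_simp.
rewrite -(@Rintegral_itvB _ g (BLeft s) (BRight u) t) ?bnd_simp//.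
  by rewrite addrC subrK.
exact: reg_integrable.
Qed.

Definition prim g t := if 0 <= t then \int[mu]_(l in `[0, t]) g l
  else - \int[mu]_(l in `[t, 0]) g l.

Lemma prim_int g s t : reg g -> s <= t ->
  \int[mu]_(l in `[s, t]) g l = prim g t - prim g s.
Proof.
move=> rg st; rewrite /prim; case: (leP 0 t) => t0; case: (leP 0 s) => s0.
- by rewrite (@Rintegral_chasles g 0 s t)//; ring.
- by rewrite (@Rintegral_chasles g s 0 t)//; [ring|exact: ltW].
- lra.
- by rewrite (@Rintegral_chasles g s t 0)//; [ring|exact: ltW].
Qed.

Lemma Rintegral_near g s t c e : reg g -> s <= t ->
  (forall u, s <= u <= t -> `|g u - c| <= e) ->
  `|prim g t - prim g s - c * (t - s)| <= e * (t - s).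
Proof.
move=> rg st h; rewrite -prim_int//.
have mst : fine (mu `[s, t]) = t - s.
  rewrite lebesgue_measure_itv/= lte_fin; case: ltP => // ts.
  by rewrite /= (_ : t = s) ?subrr//; apply/eqP; rewrite eq_le ts.
have cst_int k : \int[mu]_(l in `[s, t]) k = k * (t - s).
  by rewrite Rintegral_cst// mst.
have cst_le k : mu.-integrable `[s, t] (EFin \o (fun=> k : R)).
  exact: reg_integrable (reg_cst k).
have mD : measurable `[s, t] by [].
have rs := reg_integrable s t rg.
have lo : (c - e) * (t - s) <= \int[mu]_(l in `[s, t]) g l.
  rewrite -cst_int; apply: le_Rintegral => // u; rewrite /= in_itv/= => /h.
  by rewrite ler_norml => /andP[]; lra.
have hi : \int[mu]_(l in `[s, t]) g l <= (c + e) * (t - s).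
  rewrite -cst_int; apply: le_Rintegral => // u; rewrite /= in_itv/= => /h.
  by rewrite ler_norml => /andP[]; lra.
move: lo hi; move: (Rintegral _ _ _) => I lo hi; clear -lo hi.
by rewrite ler_norml; lra.
Qed.

Lemma rder_prim g t : reg g -> rder (prim g) t (g t).
Proof.
move=> rg; apply/rder_expand => e e0; have [_ rcg _] := rg.
have /cvgrPdist_le/(_ _ e0)/near_rightP[d d0 hd] := rcg t.
apply/near_rightP; exists d => // u tud.
apply: Rintegral_near => //; first by lra.
move=> v /andP[]; rewrite le_eqVlt => /predU1P[<- _|tv vu].
  by rewrite subrr normr0 ltW.
by rewrite distrC; apply: hd; lra.
Qed.

Lemma prim_lipschitz g M s t : reg g -> (forall u, `|g u| <= M) ->
  `|prim g t - prim g s| <= M * `|t - s|.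
Proof.
move=> rg hM; wlog st : s t / s <= t => [hw|].
  have [/hw//|/ltW/hw] := leP s t.
  by rewrite distrC (distrC s).
rewrite (ger0_norm (_ : 0 <= t - s)); last by lra.
have := @Rintegral_near g s t 0 M rg st; rewrite mul0r subr0; apply.
by move=> u _; rewrite subr0.
Qed.

Lemma prim_continuous g : reg g -> continuous (prim g).
Proof.
move=> rg t; have [M M0 hM] := reg_bound rg.
apply/cvgrPdist_le => e e0; exists (e / M) => /=; first exact: divr_gt0.
move=> u /= tu; apply: le_trans (prim_lipschitz _ _ rg hM) _.
by rewrite mulrC -ler_pdivlMr// ltW.
Qed.

End RegularFunctions.

(** * Increments of absolutely continuous functions *)

Section AbsolutelyContinuous.
Context {R : realType}.
Implicit Types (x : R -> R) (s t u c e : R) (U : set R).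
Notation mu := (@lebesgue_measure R).

Lemma sum_itv_measure U (n : nat) (a b : 'I_n -> R) (d : R) : open U ->
  (forall i, a i <= b i) -> (forall i, `]a i, b i[%classic `<=` U) ->
  trivIset setT (fun i => `]a i, b i[%classic) -> (mu U < d%:E)%E ->
  \sum_(i < n) (b i - a i) < d.
Proof.
move=> oU ab abU tab Ud; rewrite -lte_fin; apply: le_lt_trans Ud.
rewrite -sumEFin (eq_bigr (fun i => mu `]a i, b i[%classic)); last first.
  move=> i _; rewrite lebesgue_measure_itv/= lte_fin; case: ltP => // ba.
  by rewrite (_ : a i = b i) ?subrr//; apply/eqP; rewrite eq_le ab ba.
rewrite -(@measure_bigsetU_ord _ _ _ mu n xpredT)//.
apply: le_measure; rewrite ?inE.
- by apply: bigsetU_measurable.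
- exact: open_measurable.
- by elim/big_ind: _ => // S T SU TU; rewrite subUset.
Qed.

(** Real induction on the right end point: a step where
    the derivative is at most [c] costs slope [c + e], a step near an exceptional
    point stays in an open set of small measure, on which absolute continuity
    controls the increments. *)
Lemma ac_le x s t c : s <= t -> absolutely_continuous_on s t x ->
  {ae mu, forall u, s <= u <= t -> exists2 l, is_derive u (1 : R) x l & l <= c} ->
  x t - x s <= c * (t - s).
Proof.
move=> st ac [N [mN N0 hN]].
suff H e : 0 < e -> x t - x s <= (c + e) * (t - s) + (e + e).
  apply/ler_addgt0Pr => e e0; pose d := e / (t - s + 2).
  have d0 : 0 < d by apply: divr_gt0; lra.
  have := H d d0; have : d * (t - s + 2) = e by rewrite divfK// gt_eqF//; lra.
  lra.
move=> e0; have [d1 d10 hd] := ac e e0.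
pose k := `|c + e|; have k0 : 0 <= k by exact: normr_ge0.
pose d := Num.min d1 (e / (k + 1)).
have d0 : 0 < d by rewrite lt_min d10 divr_gt0//; lra.
have [U [oU NU Ud]] : exists U, [/\ open U, N `<=` U & (mu U < d%:E)%E].
  have [||U [oU NU Ud]] := @lebesgue_regularity_outer _ N d mN.
  - exact: (eq_ind_r (fun z => (z < +oo)%E) (ltry 0) N0).
  - exact: d0.
  exists U; split=> //; apply: le_lt_trans Ud.
  rewrite -{1}(setDUK NU); apply: le_trans (measureU2 mu _ _) _ => //.
    by apply: measurableD => //; exact: open_measurable.
  by rewrite [X in (X + _)%E]N0 add0e.
(* Up to [tau] the increments near exceptional points are collected in finitely
   many consecutive intervals inside [U]. The slope on them is charged with [k],
   because [c + e] may be negative. *)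
pose A tau := exists (n : nat) (a b : nat -> R),
  [/\ forall i, (i < n)%N -> [/\ s <= a i, a i <= b i, b i <= tau &
        `]a i, b i[%classic `<=` U],
      forall i j, (i < j < n)%N -> b i <= a j &
      x tau - x s <= (c + e) * (tau - s) +
        \sum_(i < n) (`|x (b i) - x (a i)| + k * (b i - a i))].
have Agood sg tau : A sg -> sg <= tau -> x tau - x sg <= (c + e) * (tau - sg) ->
    A tau.
  move=> [n [a [b [h1 h2 h3]]]] sgt h; exists n, a, b; split=> //.
    by move=> i /h1[? ? ? ?]; split=> //; lra.
  lra.
have Abad sg tau : s <= sg -> A sg -> sg <= tau ->
    (forall u, sg <= u <= tau -> U u) -> A tau.
  move=> ssg [n [a [b [h1 h2 h3]]]] sgt h.
  exists n.+1, (fun i => if i == n then sg else a i),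
    (fun i => if i == n then tau else b i); split=> [i|i j|].
  - rewrite ltnS leq_eqVlt; case: eqVneq => [_ _|_ /= /h1[? ? ? ?]].
      split=> // u; rewrite /= in_itv/= => ?; apply: h; lra.
    by split=> //; lra.
  - rewrite ltnS => /andP[ij jn]; have iltn := leq_trans ij jn.
    rewrite (ltn_eqF iltn); have [_|jn'] := eqVneq j n.
      by have [] := h1 i iltn.
    by apply: h2; rewrite ij ltn_neqAle jn' jn.
  - rewrite big_ord_recr/= eqxx.
    under eq_bigr do rewrite ltn_eqF//.
    have := ler_norm (x tau - x sg).
    have : - k * (tau - sg) <= (c + e) * (tau - sg).
      by apply: ler_wpM2r; [lra|rewrite lerNl /k -normrN; exact: ler_norm].
    lra.
have As : A s.
  exists 0%N, (fun=> s), (fun=> s); split=> //.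
  by rewrite big_ord0 !subrr mulr0 addr0.
have step u : s <= u <= t -> [\/ U u |
    exists2 r, 0 < r & forall v w, v <= u <= w -> v = u \/ w = u ->
      u - r < v -> w < u + r -> x w - x v <= (c + e) * (w - v)].
  move=> sut; have [Nu|Nu] := pselect (N u); [by left; exact: NU|right].
  have [l hl lc] : exists2 l, is_derive u (1 : R) x l & l <= c.
    by apply: contrapT => nh; apply: Nu; apply: hN => /(_ sut).
  have [dx dxl] := hl.
  have : (fun v => v^-1 *: (x (v *: 1 + u) - x u)) @ 0^' --> l.
    by rewrite -dxl; exact: dx.
  move=> /cvgrPdist_le /(_ _ e0) [r /= r0 hr].
  have key z : z != 0 -> `|z| < r -> `|x (u + z) - x u - l * z| <= e * `|z|.
    move=> z0 zr; have := hr z; rewrite /= sub0r normrN => /(_ zr z0).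
    rewrite /GRing.scale /= mulr1 [z + u]addrC -(ler_pM2r (_ : 0 < `|z|)) ?normr_gt0//.
    rewrite -normrM distrC mulrBl; congr (`|_ - _| <= _).
    by rewrite mulrAC mulVf// mul1r.
  exists r => // v w vuw [->|->] vr wr.
    have [->|wu] := eqVneq w u; first by rewrite !subrr mulr0.
    have z0 : w - u != 0 by rewrite subr_eq0.
    have zp : `|w - u| = w - u by rewrite ger0_norm; lra.
    have := key (w - u) z0; rewrite zp (_ : u + (w - u) = w); last by ring.
    have wur : w - u < r by lra.
    move=> /(_ wur); rewrite ler_norml => /andP[_].
    have : l * (w - u) <= c * (w - u) by apply: ler_wpM2r => //; lra.
    lra.
  have [->|vu] := eqVneq v u; first by rewrite !subrr mulr0.
  have z0 : v - u != 0 by rewrite subr_eq0.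
  have zp : `|v - u| = u - v by rewrite ler0_norm; lra.
  have := key (v - u) z0; rewrite zp (_ : u + (v - u) = v); last by ring.
  have vur : u - v < r by lra.
  move=> /(_ vur); rewrite ler_norml => /andP[+ _].
  have : l * (u - v) <= c * (u - v) by apply: ler_wpM2r => //; lra.
  lra.
have At : A t.
  apply: (@real_induction _ A s t) => //; last by lra.
  - move=> u sut Au; have [|Uu|[r r0 hr]] := step u; first by lra.
      have /nbhs_ballP[r /= r0 hr] : nbhs u U by exact: open_nbhs_nbhs.
      apply/near_rightP; exists r => // v uv; apply: (Abad u) => //; [lra|lra|].
      by move=> w uwv; apply: hr; rewrite /ball/= ltr_norml; lra.
    apply/near_rightP; exists r => // v uv; apply: (Agood u) => //; first lra.
    by apply: hr; [lra|left|lra|lra].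
  - move=> u sut Au.
    suff [v suv hv] : exists2 v, s <= v < u & A v -> A u by apply: hv; exact: Au.
    have [|Uu|[r r0 hr]] := step u; first by lra.
      have /nbhs_ballP[r /= r0 hr] : nbhs u U by exact: open_nbhs_nbhs.
      exists (Num.max s (u - r / 2)).
        by rewrite le_max lexx/= gt_max; lra.
      move=> Av; apply: (Abad _ _ _ Av); rewrite ?le_max ?lexx ?ge_max//; first lra.
      move=> w /andP[]; rewrite ge_max => /andP[sw uw] wu.
      by apply: hr; rewrite /ball/= ltr_norml; lra.
    exists (Num.max s (u - r / 2)).
      by rewrite le_max lexx/= gt_max; lra.
    move=> Av; apply: (Agood _ _ Av); first by rewrite ge_max; lra.
    apply: hr; [by rewrite ge_max; lra|by right| |lra].
    by rewrite lt_max; apply/orP; right; lra.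
have [n [a [b [h1 h2 h3]]]] := At.
have dk : k * d <= e.
  have : (k + 1) * d <= (k + 1) * (e / (k + 1)).
    by apply: ler_wpM2l; [lra|rewrite ge_min lexx orbT].
  rewrite mulrCA divff ?mulr1; last by rewrite gt_eqF//; lra.
  lra.
have ab (i : 'I_n) : [/\ s <= a i, a i <= b i, b i <= t &
  `]a i, b i[%classic `<=` U] by exact: h1.
have triv : trivIset setT (fun i : 'I_n => `]a i, b i[%classic).
  have lt_disj (i j : 'I_n) u : (i < j)%N -> ~ (a i < u < b i /\ a j < u < b j).
    by move=> ij [h4 h5]; have := h2 i j; rewrite ij ltn_ord => /(_ isT); lra.
  move=> i j _ _ [u []]; rewrite /= !in_itv/= => ui uj; apply/val_inj/eqP.
  by case: ltngtP => // /lt_disj h; case: (h u).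
have sumd : \sum_(i < n) (b i - a i) < d.
  apply: (sum_itv_measure oU) => // i; [by case: (ab i)|by case: (ab i)].
have : \sum_(i < n) `|x (b i) - x (a i)| < e.
  apply: (hd n (fun i => a i) (fun i => b i)) => [i||].
  - by case: (ab i).
  - exact: triv.
  - by apply: lt_le_trans sumd _; rewrite ge_min lexx.
move: h3; rewrite big_split/= -mulr_sumr.
have : k * \sum_(i < n) (b i - a i) <= k * d by apply: ler_wpM2l => //; exact: ltW.
lra.
Qed.

End AbsolutelyContinuous.

(** * Solutions in terms of right derivatives *)

Section CaratheodorySolutions.
Context {R : realType}.
Implicit Types (Q P x g : R -> R) (I : set R) (s t u v c e : R).
Notation mu := (@lebesgue_measure R).

Lemma ac_near s t x e : absolutely_continuous_on s t x -> 0 < e ->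
  exists2 d, 0 < d & forall u v, s <= u -> u <= v -> v <= t -> v - u < d ->
    `|x v - x u| < e.
Proof.
move=> ac e0; have [d d0 hd] := ac e e0; exists d => // u v su uv vt uvd.
have := hd 1%N (fun=> u) (fun=> v); rewrite !big_ord1; apply=> //.
by move=> i j _ _ _; rewrite !ord1.
Qed.

Lemma ae_mono (A B : R -> Prop) : (forall u, A u -> B u) ->
  {ae mu, forall u, A u} -> {ae mu, forall u, B u}.
Proof. by move=> AB; apply: negligibleS; exact: subsetC. Qed.

(** The mean value inequality, applied to [x] minus the lines of slopes [c - e]
    and [c + e]. *)
Lemma mean_rder x s t c e : s <= t -> (forall u, s < u <= t -> leftc x u) ->
  (forall u, s <= u < t -> exists2 l, rder x u l & `|l - c| <= e) ->
  `|x t - x s - c * (t - s)| <= e * (t - s).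
Proof.
move=> st xl xr; rewrite ler_norml.
have lin k u : rder (fun v => k * v) u k.
  by rewrite -[X in rder _ _ X]mulr1; apply: rderZ; exact: rder_id.
have leftlin k u : leftc (fun v => k * v) u.
  by apply: leftcM; [exact: leftc_cst|exact: leftc_id].
have h1 : x s - (c - e) * s <= x t - (c - e) * t.
  apply: (@ler_rder _ (fun u => x u - (c - e) * u)) => // u sut.
    by apply: leftc_lusc; apply: leftcB; [exact: xl|].
  have [l hl] := xr _ sut; rewrite ler_norml => /andP[h _].
  by exists (l - (c - e)); [exact: rderB|lra].
have h2 : x t - (c + e) * t <= x s - (c + e) * s.
  apply: (@ger_rder _ (fun u => x u - (c + e) * u)) => // u sut.
    by apply: leftcB; [exact: xl|].
  have [l hl] := xr _ sut; rewrite ler_norml => /andP[_ h].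
  by exists (l - (c + e)); [exact: rderB|lra].
lra.
Qed.

(** One-sided limits give local bounds, which real induction propagates. *)
Lemma bounded_segment x s t : s <= t -> (forall u, s < u <= t -> leftc x u) ->
  (forall u, s <= u < t -> rightc x u) ->
  exists2 M, 0 < M & forall u, s <= u <= t -> `|x u| <= M.
Proof.
move=> st xl xr.
have pos u M : (forall w, s <= w <= u -> `|x w| <= M) -> s <= u -> 0 <= M.
  by move=> h su; apply: le_trans (normr_ge0 (x s)) (h _ _); rewrite lexx.
have close a b : `|a - b| <= 1 -> `|b| <= 1 + `|a| :> R.
  move=> h; have := ler_normB a (a - b); rewrite subKr; lra.
suff [M hM] : exists M, forall u, s <= u <= t -> `|x u| <= M.
  by exists (M + 1) => [|u /hM]; [have := pos _ _ hM st; lra|lra].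
pose P u := exists M, forall w, s <= w <= u -> `|x w| <= M.
apply: (@real_induction _ P s t) => //; last by lra.
- exists `|x s| => w; rewrite -eq_le => /eqP <- //.
- move=> u sut [M hM]; have /cvgrPdist_le/(_ _ ltr01)/near_rightP[d d0 hd] := xr u sut.
  apply/near_rightP; exists d => // v uv.
  exists (M + 1 + `|x u|) => w /andP[sw wv]; have [wu|uw] := leP w u.
    by have := hM w; rewrite sw wu => /(_ isT); have := normr_ge0 (x u); lra.
  have := hd w; have -> : u < w < u + d by lra.
  have su : s <= u by lra.
  move=> /(_ isT)/close; have := pos _ _ hM su; lra.
- move=> u sut hu; have /cvgrPdist_le/(_ _ ltr01)/near_leftP[d d0 hd] := xl u sut.
  pose z := Num.max s (u - d / 2).
  have zu : z < u by rewrite gt_max; lra.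
  have sz : s <= z by rewrite le_max lexx.
  have dz : u - d < z by rewrite lt_max; apply/orP; right; lra.
  have [|M hM] := hu z; first by rewrite sz zu.
  exists (M + 1 + `|x u|) => w /andP[sw wu]; have [wz|zw] := leP w z.
    by have := hM w; rewrite sw wz => /(_ isT); have := normr_ge0 (x u); lra.
  have M0 := pos _ _ hM sz.
  move: wu; rewrite le_eqVlt => /predU1P[->|wu]; first lra.
  have := hd w; have -> : u - d < w < u by lra.
  move=> /(_ isT)/close; lra.
Qed.

Definition rhs Q P t y := - y ^+ 2 + Q t * y + P t.

(** Since the coefficients are right-continuous, a solution has the right
    derivative prescribed by the equation at every time, not only at almost
    every time; with left-continuity this characterizes solutions. *)
Definition isol Q P I x := forall t, I t ->
  (forall v, I v -> t < v -> rder x t (rhs Q P t (x t))) /\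
  (forall u, I u -> u < t -> leftc x t).

Lemma rhs_rightc Q P x t : reg Q -> reg P -> rightc x t ->
  rightc (fun u => rhs Q P u (x u)) t.
Proof.
move=> [_ rQ _] [_ rP _] rx; apply: cvgD; last exact: rP.
apply: cvgD; last by apply: cvgM => //; exact: rQ.
by apply: cvgN; under eq_fun do rewrite expr2; rewrite expr2; exact: cvgM.
Qed.

(** On a short interval to the right of [t] the right-hand side is close to its
    value at [t]; integrating the almost everywhere derivative there bounds the
    difference quotients. *)
Lemma solution_isol Q P I x : reg Q -> reg P -> is_interval I ->
  solution Q P I x -> isol Q P I x.
Proof.
move=> rQ rP iI [ac ae].
have sub s t : I s -> I t -> `[s, t] `<=` I.
  by move=> Is It u; rewrite /= in_itv/= => ?; exact: iI Is It _ _.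
move=> t It; split=> [v Iv tv|u Iu ut].
  have acv := ac _ _ (sub _ _ It Iv).
  have rx : rightc x t.
    apply/cvgrPdist_le => e e0; have [d d0 hd] := ac_near acv e0.
    apply/near_rightP; exists (Num.min d (v - t)) => [|u]; first by rewrite lt_min d0; lra.
    rewrite -ltrBlDl lt_min => /andP[tu /andP[h1 h2]].
    by rewrite distrC ltW//; apply: hd; lra.
  have rg := rhs_rightc rQ rP rx; apply/rder_expand => e e0.
  have /cvgrPdist_le/(_ _ e0)/near_rightP[d d0 hd] := rg.
  apply/near_rightP; exists (Num.min d (v - t)) => [|u]; first by rewrite lt_min d0; lra.
  rewrite -ltrBlDl lt_min => /andP[tu /andP[h1 h2]].
  have {}hd w : t <= w <= u -> `|rhs Q P w (x w) - rhs Q P t (x t)| <= e.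
    move=> /andP[]; rewrite le_eqVlt => /predU1P[<- _|tw wu].
      by rewrite subrr normr0 ltW.
    by rewrite distrC; apply: hd; lra.
  have acu : absolutely_continuous_on t u x.
    by apply: ac; apply: sub => //; apply: iI It Iv _ _; lra.
  have aeu : {ae mu, forall w, t <= w <= u ->
      is_derive w (1 : R) x (rhs Q P w (x w))}.
    by apply: ae_mono ae => w h tw; apply: h; apply: iI It Iv _ _; lra.
  rewrite ler_norml.
  have hup : x u - x t <= (rhs Q P t (x t) + e) * (u - t).
    apply: ac_le => //; first exact: ltW.
    apply: ae_mono aeu => w h tw; exists (rhs Q P w (x w)); first exact: h.
    by have := hd _ tw; rewrite ler_norml; lra.
  have hlo : (- x u) - (- x t) <= (- rhs Q P t (x t) + e) * (u - t).
    apply: (@ac_le _ (fun w => - x w)); first exact: ltW.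
      move=> e' e'0; have [d' d'0 hd'] := acu _ e'0; exists d' => // n a b h3 h4 h5.
      under eq_bigr do rewrite -opprD normrN; exact: hd'.
    apply: ae_mono aeu => w h tw; exists (- rhs Q P w (x w)).
      by apply: is_deriveN; exact: h.
    by have := hd _ tw; rewrite ler_norml; lra.
  lra.
apply/cvgrPdist_le => e e0; have [d d0 hd] := ac_near (ac _ _ (sub _ _ Iu It)) e0.
apply/near_leftP; exists (Num.min d (t - u)) => [|w]; first by rewrite lt_min d0; lra.
rewrite ltrBlDr -ltrBlDl lt_min => /andP[/andP[h1 h2] h3].
by rewrite ltW//; apply: hd; lra.
Qed.

Lemma subsingleton_countable (A : set R) :
  (forall u v, A u -> A v -> u = v) -> countable A.
Proof.
move=> h; have [[u Au]|/set0P] := pselect (A !=set0).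
  have -> : A = [set u] by apply/seteqP; split=> v; [move=> Av; exact: h|move=> ->].
  exact: countable1.
by move=> /negP; rewrite negbK => /eqP ->; exact: countable0.
Qed.

(** The right derivative is locally bounded, so the function is Lipschitz, and it
    is a two-sided derivative wherever the coefficients are continuous, that is,
    off a countable set. *)
Lemma isol_solution Q P I x : reg Q -> reg P -> is_interval I ->
  isol Q P I x -> solution Q P I x.
Proof.
move=> rQ rP iI sx.
have bnd u v : u <= v -> `[u, v] `<=` I -> exists2 C, 0 < C &
    forall w, u <= w <= v -> `|rhs Q P w (x w)| <= C.
  move=> uv uvI; have Iw w : u <= w <= v -> I w.
    by move=> h; apply: uvI; rewrite /= in_itv.
  have [MQ MQ0 hQ] := reg_bound rQ; have [MP MP0 hP] := reg_bound rP.
  have [w uwv|w uwv|M M0 hM] := @bounded_segment x u v uv.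
  - by apply: (sx w _).2 (Iw u _) _; [apply: Iw|..]; lra.
  - by apply: rder_rightc; apply: (sx w _).1 (Iw v _) _; [apply: Iw|..]; lra.
  exists (M ^+ 2 + MQ * M + MP).
    by have := mulr_gt0 MQ0 M0; have := mulr_gt0 M0 M0; rewrite expr2; lra.
  move=> w /hM h; apply: le_trans (ler_normD _ _) _; apply: lerD => //.
  apply: le_trans (ler_normD _ _) _; rewrite normrN normrX normrM.
  apply: lerD; last by apply: ler_pM.
  by rewrite ler_pXn2r// ?nnegrE// ltW.
split.
  move=> u v uvI e e0; have [uv|vu] := leP u v; last first.
    exists 1 => // n a b hab _ _; rewrite big1// => i _.
    by have := hab i; lra.
  have [C C0 hC] := bnd u v uv uvI; exists (e / C); first exact: divr_gt0.
  have Iw w : u <= w <= v -> I w by move=> h; apply: uvI; rewrite /= in_itv.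
  move=> n a b hab _ hs; apply: (@le_lt_trans _ _ (\sum_(i < n) C * (b i - a i))).
    apply: ler_sum => i _; have [ua [ab bv]] := hab i.
    have := @mean_rder x (a i) (b i) 0 C ab; rewrite mul0r subr0; apply=> w hw.
      by apply: (sx w _).2 (Iw u _) _; [apply: Iw|..]; lra.
    exists (rhs Q P w (x w)); last by rewrite subr0; apply: hC; lra.
    by apply: (sx w _).1 (Iw v _) _; [apply: Iw|..]; lra.
  by rewrite -mulr_sumr mulrC -ltr_pdivlMr.
have [_ _ [DQ [cDQ kQ]]] := rQ; have [_ _ [DP [cDP kP]]] := rP.
pose E1 := [set t | I t /\ forall v, I v -> v <= t].
pose E2 := [set t | I t /\ forall v, I v -> t <= v].
have cE : countable ((DQ `|` DP) `|` (E1 `|` E2)).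
  apply: countable_setU; first exact: countable_setU.
  apply: countable_setU.
  - by apply: subsingleton_countable => s t [Is hs] [It ht]; apply/le_anti; rewrite ht// hs.
  - by apply: subsingleton_countable => s t [Is hs] [It ht]; apply/le_anti; rewrite hs// ht.
have : mu.-negligible ((DQ `|` DP) `|` (E1 `|` E2)).
  apply/negligibleP; last exact: countable_lebesgue_measure0.
  by apply: countable_measurable => // t; exact: measurable_set1.
apply: negligibleS => t /= ht; apply: contrapT => nt; apply: ht => It.
have [/not_orP[nQ nP] /not_orP[nE1 nE2]] : ~ (DQ t \/ DP t) /\ ~ (E1 t \/ E2 t).
  exact/not_orP.
have [v Iv tv] : exists2 v, I v & t < v.
  apply: contrapT => h; apply: nE1; split=> // v Iv; rewrite leNgt; apply/negP => tv.
  by apply: h; exists v.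
have [u Iu ut] : exists2 v, I v & v < t.
  apply: contrapT => h; apply: nE2; split=> // w Iw; rewrite leNgt; apply/negP => tw.
  by apply: h; exists w.
have Iuv w : u <= w <= v -> I w by move=> h; apply: iI Iu Iv _ h.
have cx : {for t, continuous x}.
  apply: leftc_rightc_continuous; first exact: (sx t It).2 Iu ut.
  by apply: rder_rightc; exact: (sx t It).1 Iv tv.
have cg : {for t, continuous (fun w => rhs Q P w (x w))}.
  apply: cvgD; last exact: kP; apply: cvgD; last by apply: cvgM => //; exact: kQ.
  by apply: cvgN; under eq_fun do rewrite expr2; rewrite expr2; exact: cvgM.
have : (fun z => z^-1 *: (x (z *: 1 + t) - x t)) @ 0^' --> rhs Q P t (x t).
  apply/cvgrPdist_le => e e0.
  move/cvgrPdist_le : cg => /(_ _ e0) [d /= d0 hd].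
  pose r := Num.min d (Num.min (v - t) (t - u)).
  have r0 : 0 < r by rewrite !lt_min d0; lra.
  exists r => //= z; rewrite /ball_ /= sub0r normrN => zr z0.
  rewrite /GRing.scale/= mulr1.
  have : `|x (z + t) - x t - rhs Q P t (x t) * z| <= e * `|z|.
    move: zr; rewrite /r !lt_min => /andP[zd]; rewrite !ltr_norml => hz.
    have hd' w : t - `|z| <= w <= t + `|z| ->
        `|rhs Q P w (x w) - rhs Q P t (x t)| <= e.
      move=> hw; rewrite distrC; apply: hd => /=.
      by apply: le_lt_trans zd; rewrite distrC ler_norml; lra.
    have nz1 := ler_norm z; have nz2 := ler_norm (- z); rewrite normrN in nz2.
    have [zp|zn] := leP 0 z.
      have := @mean_rder x t (z + t) (rhs Q P t (x t)) e.
      rewrite (ger0_norm zp) addrK; apply; first lra.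
        move=> w hw; apply: (sx w _).2 Iu _; [apply: Iuv|]; lra.
      move=> w hw; exists (rhs Q P w (x w)); last by apply: hd'; lra.
      by apply: (sx w _).1 Iv _; [apply: Iuv|]; lra.
    have := @mean_rder x (z + t) t (rhs Q P t (x t)) e.
    rewrite (ltr0_norm zn) (_ : t - (z + t) = - z); last by ring.
    rewrite (_ : x (z + t) - x t - rhs Q P t (x t) * z =
      - (x t - x (z + t) - rhs Q P t (x t) * - z)); last by ring.
    rewrite normrN; apply; first lra.
      move=> w hw; apply: (sx w _).2 Iu _; [apply: Iuv|]; lra.
    move=> w hw; exists (rhs Q P w (x w)); last by apply: hd'; lra.
    by apply: (sx w _).1 Iv _; [apply: Iuv|]; lra.
  have z1 : 0 < `|z| by rewrite normr_gt0.
  rewrite -[leRHS]mulr1 => h; rewrite -(ler_pM2r z1) -normrM.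
  rewrite mulrBl mulrAC mulVf// mul1r distrC.
  by apply: le_trans h _; rewrite mulr1.
move=> cv; have dx : derivable x t 1 by apply/cvg_ex; exists (rhs Q P t (x t)).
by apply: DeriveDef => //; rewrite /derive; apply: cvg_lim.
Qed.

End CaratheodorySolutions.

(** * Global solutions of Lipschitz equations *)

Section Picard.
Context {R : realType}.
Implicit Types (x y D : R -> R) (s t u e K : R).

Lemma lipschitz_continuous (f : R -> R) K : (forall u v, `|f u - f v| <= K * `|u - v|) ->
  continuous f.
Proof.
move=> h t; apply/cvgrPdist_le => e e0; exists (e / (`|K| + 1)).
  by apply: divr_gt0 => //; have := normr_ge0 K; lra.
move=> u /= tu; apply: le_trans (h _ _) _.
have k1 : 0 < `|K| + 1 by have := normr_ge0 K; lra.
move: tu; rewrite ltr_pdivlMr// => /ltW; apply: le_trans.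
by rewrite mulrC ler_wpM2l//; have := ler_norm K; lra.
Qed.

(** The weight [expR (2 L |t - s|)] makes the integral operator a contraction
    on the whole line at once, forwards and backwards. *)
Lemma weighted_bound D (L k s t : R) : 0 < L -> 0 <= k -> D s = 0 -> continuous D ->
  (forall u, exists2 l, rder D u l & `|l| <= 2 * L * k * expR (2 * L * `|u - s|)) ->
  `|D t| <= k * expR (2 * L * `|t - s|).
Proof.
move=> L0 k0 Ds cD rD; have lD u : leftc D u by apply: leftc_cont; exact: cD.
have [st|/ltW ts] := leP s t.
  pose B u := k * expR (2 * L * (u - s)).
  have rB u : rder B u (k * (expR (2 * L * (u - s)) * (2 * L))).
    by apply: rderZ; exact: rder_expZ.
  have lB u : leftc B u by apply: leftcM; [exact: leftc_cst|exact: leftc_expZ].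
  have Bs : B s = k by rewrite /B subrr mulr0 expR0 mulr1.
  have Bt : k * expR (2 * L * `|t - s|) = B t by rewrite /B ger0_norm//; lra.
  have h1 : D t - B t <= D s - B s.
    apply: (@ger_rder _ (fun u => D u - B u)) => // u sut; first exact: leftcB.
    have [l hl lk] := rD u; eexists; first exact: rderB hl (rB u).
    move: lk; rewrite (ger0_norm (_ : 0 <= u - s)) ?ler_norml; last by lra.
    lra.
  have h2 : D s + B s <= D t + B t.
    apply: (@ler_rder _ (fun u => D u + B u)) => // u sut.
      by apply: leftc_lusc; exact: leftcD.
    have [l hl lk] := rD u; eexists; first exact: rderD hl (rB u).
    move: lk; rewrite (ger0_norm (_ : 0 <= u - s)) ?ler_norml; last by lra.
    lra.
  by rewrite Bt ler_norml; lra.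
pose B u := k * expR (- (2 * L) * (u - s)).
have rB u : rder B u (k * (expR (- (2 * L) * (u - s)) * - (2 * L))).
  by apply: rderZ; exact: rder_expZ.
have lB u : leftc B u by apply: leftcM; [exact: leftc_cst|exact: leftc_expZ].
have Bs : B s = k by rewrite /B subrr mulr0 expR0 mulr1.
have EB u : u <= s -> 2 * L * `|u - s| = - (2 * L) * (u - s).
  by move=> us; rewrite ler0_norm; [ring|lra].
have Bt : k * expR (2 * L * `|t - s|) = B t by rewrite EB.
have h1 : D t - B t <= D s - B s.
  apply: (@ler_rder _ (fun u => D u - B u)) => // u sut.
    by apply: leftc_lusc; exact: leftcB.
  have [l hl lk] := rD u; eexists; first exact: rderB hl (rB u).
  move: lk; rewrite EB ?ler_norml; last by lra.
  lra.
have h2 : D s + B s <= D t + B t.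
  apply: (@ger_rder _ (fun u => D u + B u)) => // u sut; first exact: leftcD.
  have [l hl lk] := rD u; eexists; first exact: rderD hl (rB u).
  move: lk; rewrite EB ?ler_norml; last by lra.
  lra.
by rewrite Bt ler_norml; lra.
Qed.

Variables (F : R -> R -> R) (L : R).
Hypotheses (L0 : 0 < L) (Freg : forall y, continuous y -> reg (fun t => F t (y t)))
  (Flip : forall (t y z : R), `|F t y - F t z| <= L * `|y - z|).

Lemma picard s (x0 : R) : exists y, [/\ continuous y, y s = x0 &
  forall t, rder y t (F t (y t))].
Proof.
have L_gt0 := L0.
pose T (y : R -> R) t := x0 + (prim (fun u => F u (y u)) t - prim (fun u => F u (y u)) s).
have Tc y : continuous y -> continuous (T y).
  move=> cy t; apply: cvgD; first exact: cvg_cst.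
  by apply: cvgB; [exact: (prim_continuous (Freg cy))|exact: cvg_cst].
have Ts y : T y s = x0 by rewrite /T subrr addr0.
have Tr y t : continuous y -> rder (T y) t (F t (y t)).
  move=> cy; rewrite -[X in rder _ _ X]add0r; apply: rderD; first exact: rder_cst.
  rewrite -[X in rder _ _ X]subr0; apply: rderB; last exact: rder_cst.
  exact: rder_prim (Freg cy).
pose E t := expR (2 * L * `|t - s|).
have E0 t : 0 < E t by exact: expR_gt0.
have TL y z k : continuous y -> continuous z -> 0 <= k ->
    (forall t, `|y t - z t| <= 2 * k * E t) ->
    forall t, `|T y t - T z t| <= k * E t.
  move=> cy cz k0 yz t.
  apply: (@weighted_bound (fun t => T y t - T z t)) => //.
  - by rewrite !Ts subrr.
  - by move=> u; apply: cvgB; apply: Tc.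
  - move=> u; eexists; first exact: rderB (Tr y u cy) (Tr z u cz).
    apply: le_trans (Flip _ _ _) _.
    have := ler_wpM2l (ltW L0) (yz u); rewrite /E; lra.
pose yn n := iter n T (fun=> x0).
have cyn n : continuous (yn n).
  by elim: n => [|n ih] /=; [move=> t; exact: cvg_cst|exact: Tc].
have [M M0 hM] := reg_bound (Freg (cyn 0%N)).
pose k n := M / (2 * L) / 2 ^+ n.
have k00 : 0 < M / (2 * L) by apply: divr_gt0; lra.
have k0 n : 0 < k n by rewrite divr_gt0// exprn_gt0.
have kS n : k n = 2 * k n.+1.
  by rewrite /k exprS; field; rewrite ?expf_neq0 ?gt_eqF//.
have dn n t : `|yn n.+1 t - yn n t| <= k n * E t.
  elim: n t => [|n ih] t.
    apply: (@weighted_bound (fun t => yn 1%N t - yn 0%N t)) => //.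
    - exact: ltW.
    - by rewrite /yn /= Ts subrr.
    - by move=> u; apply: cvgB; apply: cyn.
    - move=> u; eexists; first exact: rderB (Tr _ u (cyn 0%N)) (rder_cst _ _).
      rewrite subr0; apply: le_trans (hM u) _.
      have -> : 2 * L * k 0%N = M.
        by rewrite /k expr0 divr1 mulrC divfK// gt_eqF// mulr_gt0.
      apply: ler_peMr; first exact: ltW.
      by rewrite -[leLHS]expR0 ler_expR; apply: mulr_ge0 => //; lra.
  apply: (TL (yn n.+1) (yn n)) => [| | |u]; [exact: cyn|exact: cyn|exact: ltW|].
  by rewrite -kS.
have dnm n m t : `|yn (n + m)%N t - yn n t| <= 2 * k n * E t.
  suff h : `|yn (n + m)%N t - yn n t| <= 2 * (k n - k (n + m)%N) * E t.
    apply: le_trans h _; rewrite ler_pM2r// ler_pM2l//.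
    by have := k0 (n + m)%N; lra.
  elim: m => [|m ih]; first by rewrite addn0 !subrr normr0 mulr0 mul0r.
  rewrite addnS -(subrKA (yn (n + m)%N t)); apply: le_trans (ler_normD _ _) _.
  have := dn (n + m)%N t; rewrite {1}(kS (n + m)%N); move: ih; rewrite (kS (n + m)%N).
  lra.
have dd n m t : yn n t - 2 * k n * E t <= yn m t + 2 * k m * E t.
  have h1 i : 0 <= 2 * k i * E t by apply: mulr_ge0; [apply: mulr_ge0 => //|]; exact: ltW.
  have [nm|/ltnW mn] := leqP n m.
    have := dnm n (m - n)%N t; rewrite subnKC// ler_norml => /andP[h _].
    by have := h1 m; lra.
  have := dnm m (n - m)%N t; rewrite subnKC// ler_norml => /andP[_ h].
  by have := h1 n; lra.
(* The segments of radius [2 k_n E t] around the iterates are nested, and the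
   limit is the supremum of their lower ends. *)
pose y t := sup [set yn n t - 2 * k n * E t | n in [set: nat]].
have hy n t : `|y t - yn n t| <= 2 * k n * E t.
  have ne : [set yn n t - 2 * k n * E t | n in [set: nat]] !=set0.
    by exists (yn 0%N t - 2 * k 0%N * E t), 0%N.
  have h1 : y t <= yn n t + 2 * k n * E t by apply: ge_sup => // _ [m _ <-].
  have h2 : yn n t - 2 * k n * E t <= y t.
    apply: ub_le_sup; last by exists n.
    by exists (yn 0%N t + 2 * k 0%N * E t) => _ [m _ <-].
  by rewrite ler_norml; lra.
have ksmall e : 0 < e -> exists n, k n < e.
  move=> e0; have [n hn] : exists n : nat, M / (2 * L) / e < n%:R.
    by exists (Num.bound (M / (2 * L) / e)); apply: archi_boundP; rewrite divr_ge0// ltW.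
  exists n; rewrite /k ltr_pdivrMr ?exprn_gt0// [e * _]mulrC -ltr_pdivrMr//.
  by apply: (lt_le_trans hn); rewrite -natrX ler_nat ltnW// ltn_expl.
have cy : continuous y.
  move=> t; apply/cvgrPdist_le => e e0.
  pose B := expR (2 * L * (`|t - s| + 1)).
  have B0 : 0 < B by exact: expR_gt0.
  have [n hn] := ksmall (e / (6 * B)) ltac:(by apply: divr_gt0; lra).
  have hB u : `|t - u| < 1 -> 2 * k n * E u <= e / 3.
    move=> tu; have EB : E u <= B.
      rewrite /E /B ler_expR ler_pM2l; last by lra.
      have := ler_distD t u s; rewrite (distrC u t); lra.
    have h1 : k n * E u <= k n * B by rewrite ler_pM2l.
    by move: hn; rewrite ltr_pdivlMr; lra.
  have /cvgrPdist_le/(_ (e / 3)) cn := cyn n t.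
  have e3 : 0 < e / 3 by lra.
  near=> u.
  have tu : `|t - u| < 1 by near: u; exact: (nbhsx_ballx t _ ltr01).
  have h1 : `|yn n t - yn n u| <= e / 3 by near: u; exact: cn.
  have h2 := le_trans (hy n t) (hB t ltac:(by rewrite subrr normr0)).
  have h3 := le_trans (hy n u) (hB u tu).
  move: h1 h2 h3; rewrite !ler_norml; lra.
have Ty t : T y t = y t.
  apply/eqP; rewrite -subr_eq0 -normr_le0; apply/ler_addgt0Pr => e e0; rewrite add0r.
  have [n hn] := ksmall (e / (2 * E t)) ltac:(by apply: divr_gt0; rewrite // mulr_gt0).
  have h1 : `|T y t - yn n.+1 t| <= k n * E t.
    by apply: (TL y (yn n)); [exact: cy|exact: cyn|exact: ltW|move=> u; exact: hy].
  have := hy n.+1 t; rewrite -kS distrC => h2.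
  rewrite -(subrKA (yn n.+1 t)); apply: le_trans (ler_normD _ _) _.
  move: hn; rewrite ltr_pdivlMr ?mulr_gt0//; lra.
exists y; split=> //; first by rewrite -Ty Ts.
have eT : T y = y by exact/funext.
by move=> t; rewrite -{1}eT; exact: Tr.
Unshelve. all: by end_near. Qed.

End Picard.

(** * Strict lower solutions and bounded solutions *)

Section ShiftedRiccati.
Context {R : realType}.
Implicit Types (G p a r al b y : R -> R) (s t u c d e m M N Mp : R).

Definition field G p t (y : R) := - (y - G t) ^+ 2 + p t.

(** Truncating the unknown makes the quadratic field globally Lipschitz, and
    changes nothing for solutions with values in [- N, N]. *)
Definition clip N (y : R) := Num.max (- N) (Num.min N y).

Lemma clip_id N (y : R) : `|y| <= N -> clip N y = y.
Proof.
rewrite ler_norml => /andP[h1 h2].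
by rewrite /clip (min_idPr h2) (max_idPr h1).
Qed.

Lemma clip_bound N (y : R) : 0 <= N -> `|clip N y| <= N.
Proof.
move=> N0; rewrite ler_norml /clip le_max lexx/= ge_max ge_min lexx/=.
by rewrite andbT; lra.
Qed.

Lemma clip_ge N (y : R) : 0 <= N -> N <= y -> clip N y = N.
Proof. by move=> N0 h; rewrite /clip (min_idPl h) (max_idPr _)//; lra. Qed.

Lemma clip_le N (y : R) : 0 <= N -> y <= - N -> clip N y = - N.
Proof.
move=> N0 h; rewrite /clip (min_idPr _) ?(max_idPl _)//; lra.
Qed.

Lemma clip_lip N (y z : R) : 0 <= N -> `|clip N y - clip N z| <= `|y - z|.
Proof.
move=> N0; wlog yz : y z / y <= z => [hw|].
  by have [/hw//|/ltW/hw] := leP y z; rewrite distrC (distrC y).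
have minmono : 0 <= Num.min N z - Num.min N y <= z - y.
  by case: (leP N y) => h1; case: (leP N z) => h2; lra.
have maxmono (v w : R) : v <= w -> 0 <= Num.max (- N) w - Num.max (- N) v <= w - v.
  by move=> vw; case: (leP (- N) v) => h1; case: (leP (- N) w) => h2; lra.
have := maxmono (Num.min N y) (Num.min N z); rewrite -/(clip N y) -/(clip N z).
move: (clip N y) (clip N z) => cy cz h.
rewrite ler_norml distrC (ger0_norm (_ : 0 <= z - y)); lra.
Qed.


Definition gsol G p y := forall t, leftc y t /\ rder y t (field G p t (y t)).

(** Downward jumps are allowed, because solutions above [al] remain above it
    there; this makes it possible to glue lower solutions. *)
Definition strict_lower G p m al := [/\ exists B, forall t, `|al t| <= B,
  forall t, lusc (fun u => - al u) t &
  forall t, exists2 l, rder al t l & l <= field G p t (al t) - m].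

Definition tsol N G p y :=
  forall t, leftc y t /\ rder y t (field G p t (clip N (y t))).

Lemma field_lip G p M N t (y z : R) : (forall t, `|G t| <= M) ->
  `|y| <= N -> `|z| <= N ->
  `|field G p t y - field G p t z| <= 2 * (N + M) * `|y - z|.
Proof.
move=> hG hy hz.
have -> : field G p t y - field G p t z = - (y + z - 2 * G t) * (y - z).
  by rewrite /field; ring.
rewrite normrM normrN ler_wpM2r//.
have := hG t; move: hy hz; rewrite !ler_norml; lra.
Qed.

Lemma tfield_lip G p M N t (y z : R) : 0 <= N -> (forall t, `|G t| <= M) ->
  `|field G p t (clip N y) - field G p t (clip N z)| <= 2 * (N + M) * `|y - z|.
Proof.
move=> N0 hG; apply: le_trans (field_lip p t hG (clip_bound _ N0) (clip_bound _ N0)) _.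
rewrite ler_wpM2l ?clip_lip//.
by have := le_trans (normr_ge0 _) (hG 0); lra.
Qed.

Lemma continuous_clip N : 0 <= N -> continuous (clip N).
Proof.
by move=> N0; apply: (@lipschitz_continuous _ _ 1) => u v; rewrite mul1r clip_lip.
Qed.

Lemma tsol_exists N G p s (x0 : R) : reg G -> reg p -> 0 <= N ->
  exists2 y, tsol N G p y & y s = x0.
Proof.
move=> rG rp N0; have [M M0 hM] := reg_bound rG.
have L0 : 0 < 2 * (N + M) by lra.
have [|t y z|y [cy ys ry]] :=
    @picard R (fun t z => field G p t (clip N z)) _ L0 _ _ s x0.
- move=> y cy; apply: regD => //; apply: regN; apply: reg_sqr; apply: regB => //.
  apply: (@reg_cont _ _ N) => [t|t]; last exact: clip_bound.
  by apply: continuous_comp; [exact: cy|exact: continuous_clip].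
- exact: tfield_lip.
- by exists y => // t; split; [by apply: leftc_cont; exact: cy|exact: ry].
Qed.

Section Truncated.
Variables (G p : R -> R) (M Mp N : R).
Hypotheses (hG : forall t, `|G t| <= M) (hp : forall t, `|p t| <= Mp).
Hypotheses (MN : M < N) (barN : Mp < (N - M) ^+ 2).

Let M0 : 0 <= M. Proof. by apply: le_trans (hG 0). Qed.
Let N0 : 0 < N. Proof. exact: (le_lt_trans M0 MN). Qed.
Let L0 : 0 < 2 * (N + M).
Proof. by apply: mulr_gt0 => //; apply: ltr_wpDr; [exact: M0|exact: N0]. Qed.

Lemma tsol_le y1 y2 s t : tsol N G p y1 -> tsol N G p y2 -> s <= t ->
  y1 s <= y2 s -> y1 t <= y2 t.
Proof.
move=> h1 h2 st hs; rewrite -subr_ge0.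
apply: (@nonneg_of_rder _ (fun u => y2 u - y1 u) (2 * (N + M)) s t) => //.
- exact: ltW L0.
- by rewrite subr_ge0.
- by move=> u _; apply: leftc_lusc; apply: leftcB; [exact: (h2 u).1|exact: (h1 u).1].
- move=> u _; eexists; first exact: rderB (h2 u).2 (h1 u).2.
  have := tfield_lip p u (y2 u) (y1 u) (ltW N0) hG.
  by rewrite ler_norml => /andP[]; lra.
Qed.

(** The squared distance satisfies a linear differential inequality in both time
    directions, so uniqueness holds backwards too. *)
Lemma tsol_uniq y1 y2 s t : tsol N G p y1 -> tsol N G p y2 ->
  y1 s = y2 s -> y1 t = y2 t.
Proof.
move=> h1 h2 hs; apply/eqP; rewrite -subr_eq0 -sqrf_eq0; apply/eqP/le_anti.
rewrite sqr_ge0 andbT.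
have := @gronwall _ (fun u => y1 u - y2 u) (2 * (N + M)) 0 s t (ltW L0).
rewrite hs subrr expr0n/= !addr0 mul0r; apply.
- by move=> u; apply: leftcB; [exact: (h1 u).1|exact: (h2 u).1].
- move=> u; eexists; first exact: rderB (h1 u).2 (h2 u).2.
  by rewrite addr0; exact: (tfield_lip p u (y1 u) (y2 u) (ltW N0) hG).
Qed.

(** Backwards in time, the strict order follows by contraposition. *)
Lemma tsol_lt y1 y2 s t : tsol N G p y1 -> tsol N G p y2 ->
  y1 s < y2 s -> y1 t < y2 t.
Proof.
move=> h1 h2 hs; have [st|ts] := leP s t.
  rewrite lt_neqAle (tsol_le h1 h2 st (ltW hs)) andbT.
  by apply/eqP => /(tsol_uniq s h1 h2) e; move: hs; rewrite e ltxx.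
rewrite ltNge; apply/negP => h.
by have := tsol_le h2 h1 (ltW ts) h; lra.
Qed.

(** Beyond [N] in absolute value the truncated field is negative. *)
Lemma tsol_le_cst y c s t : tsol N G p y -> N <= `|c| -> s <= t -> y s <= c ->
  y t <= c.
Proof.
move=> hy Nc st hs; rewrite -subr_ge0.
have N0' := N0; have MN' := MN; have barN' := barN.
have neg u : field G p u (clip N c) < 0.
  have e : clip N c = N \/ clip N c = - N.
    move: Nc; have [c0|c0] := leP 0 c.
      by rewrite ger0_norm// => h; left; apply: clip_ge => //; exact: ltW.
    by rewrite ltr0_norm// => h; right; apply: clip_le; lra.
  have := hp u; have := hG u; rewrite /field !ler_norml => /andP[g1 g2] /andP[p1 p2].
  by case: e => ->; nra.
apply: (@barrier _ (fun u => c - y u) s t) => //; first by rewrite subr_ge0.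
- move=> u _; apply: leftc_lusc; apply: leftcB; first exact: leftc_cst.
  exact: (hy u).1.
- move=> u _; eexists; first exact: rderB (rder_cst c u) (hy u).2.
  by move=> h; rewrite (_ : y u = c); [have := neg u; lra|lra].
Qed.

Lemma tsol_ge_lower al m y s t : strict_lower G p m al -> 0 <= m ->
  (forall t, `|al t| <= N) -> tsol N G p y -> s <= t -> al s <= y s -> al t <= y t.
Proof.
move=> [_ al1 al2] m0 alN hy st hs; rewrite -subr_ge0.
apply: (@nonneg_of_rder _ (fun u => y u + - al u) (2 * (N + M)) s t) => //.
- exact: ltW L0.
- by rewrite subr_ge0.
- by move=> u _; apply: luscD => //; apply: leftc_lusc; exact: (hy u).1.
- move=> u _; have [l hl lm] := al2 u.
  eexists; first exact: rderB (hy u).2 hl.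
  have := tfield_lip p u (y u) (al u) (ltW N0) hG.
  by rewrite ler_norml (clip_id (alN u)) => /andP[]; lra.
Qed.

(** The margin opens a gap of fixed size between a lower solution and the
    solutions above it, after a fixed time. *)
Lemma tsol_gap_lower al m y s : strict_lower G p m al -> 0 < m ->
  (forall t, `|al t| <= N) -> tsol N G p y ->
  - (m / (2 * (2 * (N + M)))) <= y s - al s ->
  m / (2 * (2 * (N + M))) <= y (s + 3 / (2 * (N + M))) - al (s + 3 / (2 * (N + M))).
Proof.
move=> [_ al1 al2] m0 alN hy hs.
apply: (@gap_of_rder _ (fun u => y u + - al u)) => //.
- by move=> u _; apply: luscD => //; apply: leftc_lusc; exact: (hy u).1.
- move=> u _; have [l hl lm] := al2 u.
  eexists; first exact: rderB (hy u).2 hl.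
  have := tfield_lip p u (y u) (al u) (ltW N0) hG.
  by rewrite ler_norml (clip_id (alN u)) => /andP[]; lra.
Qed.

Lemma tsol_gsol y : tsol N G p y -> (forall t, `|y t| <= N) -> gsol G p y.
Proof. by move=> hy h t; have [h1 h2] := hy t; rewrite clip_id// in h2. Qed.

End Truncated.

Lemma bar_exists M Mp B : exists N, [/\ M < N, Mp < (N - M) ^+ 2 & B < N].
Proof.
exists (`|M| + `|Mp| + `|B| + 1).
have := ler_norm M; have := ler_norm Mp; have := ler_norm B.
have := normr_ge0 M; have := normr_ge0 Mp; have := normr_ge0 B.
by split; nra.
Qed.

(** The upper solution starts at the largest initial value whose solution stays
    below [N] in the past, the lower one at the smallest initial value whose
    solution stays above [- N] in the future. The gap to [al] is uniform: above,
    because [a] has been above [al] for a long time; below, because a solution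
    too close to [al] would soon cross it. *)
Lemma lower_pair G p m al : reg G -> reg p -> 0 < m -> strict_lower G p m al ->
  exists a r d, [/\ gsol G p a, gsol G p r,
    exists B, forall t, `|a t| <= B /\ `|r t| <= B, 0 < d &
    forall t, r t + d <= al t /\ al t <= a t - d].
Proof.
move=> rG rp m0 lal; have [M M0 hM] := reg_bound rG; have [Mp Mp0 hMp] := reg_bound rp.
have [[B hB] al1 al2] := lal; have [N [MN barN BN]] := bar_exists M Mp B.
have alN t : `|al t| < N by apply: le_lt_trans BN.
have alN' t : `|al t| <= N by exact: ltW.
have N0 : 0 <= N by lra.
have N1 : N <= `|N| by rewrite ger0_norm.
have nN1 : N <= `|- N| by rewrite normrN ger0_norm.
have alN1 t : al t < N by have := alN t; rewrite ltr_norml => /andP[].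
have alN2 t : - N < al t by have := alN t; rewrite ltr_norml => /andP[].
have ex s x0 : exists2 y, tsol N G p y & y s = x0 by exact: tsol_exists.
pose K := 2 * (N + M); pose d := m / (2 * K).
have K0 : 0 < K by rewrite /K; lra.
have d0 : 0 < d by apply: divr_gt0; rewrite // mulr_gt0.
have ge_al y s t := @tsol_ge_lower G p M N hM MN al m y s t lal (ltW m0) alN'.
have gap_al y s := @tsol_gap_lower G p M N hM MN al m y s lal m0 alN'.
have le_cst y c s t := @tsol_le_cst G p M Mp N hM hMp MN barN y c s t.
have lt_tsol y1 y2 s t := @tsol_lt G p M N hM MN y1 y2 s t.
have uniq y1 y2 s t := @tsol_uniq G p M N hM MN y1 y2 s t.
(* The solution through [al t] stays below [al] before [t] and below [N] after
   [t], so that its initial value belongs to [S] for every [t]. *)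
pose S := [set z | exists y, [/\ tsol N G p y, y 0 = z & forall t, t <= 0 -> y t <= N]].
have Sal t z : (exists2 y, tsol N G p y & y t = al t /\ y 0 = z) -> S z.
  move=> [y hy [yt y0]]; exists y; split=> // u u0; have [tu|ut] := leP t u.
    by apply: (le_cst y N t u) => //; rewrite yt ltW.
  apply: le_trans (ltW (alN1 u)); rewrite leNgt; apply/negP => h.
  have [w hw wu] := ex u (al u).
  have := lt_tsol w y u t hw hy; rewrite wu yt => /(_ h).
  by have := ge_al w u t hw (ltW ut); rewrite wu => /(_ (lexx _)); lra.
have supS : has_sup S.
  split; last by exists N => z [y [_ <- h]]; exact: h.
  by have [y hy y0] := ex 0 (al 0); exists (al 0); apply: (Sal 0); exists y.
have [a ha a0] := ex 0 (sup S).
have aN t : a t <= N.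
  have aN0 u : u <= 0 -> a u <= N.
    move=> u0; rewrite leNgt; apply/negP => h; have [w hw wu] := ex u N.
    have := lt_tsol w a u 0 hw ha; rewrite wu a0 => /(_ h) /(sup_gt supS.1).
    move=> [z [y [hy <- yN]]] /(lt_tsol _ _ _ u hw hy).
    by rewrite wu; have := yN u u0; lra.
  have [/aN0//|/ltW t0] := leP t 0.
  exact: (le_cst a N 0 t ha N1 t0 (aN0 0 (lexx _))).
have al_a t : al t <= a t.
  rewrite leNgt; apply/negP => h; have [w hw wt] := ex t (al t).
  have Sw : S (w 0) by apply: (Sal t); exists w.
  have := lt_tsol a w t 0 ha hw; rewrite wt a0 => /(_ h).
  by have := ub_le_sup supS.2 Sw; lra.
(* Symmetrically, the solution through [al t] stays above [al] after [t] and above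
   [- N] before [t]. *)
pose S' := [set z | exists y, [/\ tsol N G p y, y 0 = z & forall t, 0 <= t -> - N <= y t]].
have Sal' t z : (exists2 y, tsol N G p y & y t = al t /\ y 0 = z) -> S' z.
  move=> [y hy [yt y0]]; exists y; split=> // u u0; have [tu|ut] := leP t u.
    by apply: le_trans (ltW (alN2 u)) _; apply: (ge_al y t u) => //; rewrite yt.
  rewrite leNgt; apply/negP => h; have := le_cst y (- N) u t hy nN1 (ltW ut) (ltW h).
  by rewrite yt; have := alN2 t; lra.
have infS : has_inf S'.
  split; last by exists (- N) => z [y [_ <- h]]; exact: h.
  by have [y hy y0] := ex 0 (al 0); exists (al 0); apply: (Sal' 0); exists y.
have [r hr r0] := ex 0 (inf S').
have rNl t : t <= 0 -> - N <= r t.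
  move=> t0; rewrite leNgt; apply/negP => h.
  have nc : N <= `|r t| by rewrite ltr0_norm; lra.
  have := le_cst r (r t) t 0 hr nc t0 (lexx _); rewrite r0.
  have : - N <= inf S' by apply: lb_le_inf infS.1 _ => z [y [_ <-]]; apply.
  by lra.
have rN t : - N <= r t.
  have [/rNl//|/ltW t0] := leP t 0.
  rewrite leNgt; apply/negP => h; have [w hw wt] := ex t (- N).
  have := lt_tsol r w t 0 hr hw; rewrite wt r0 => /(_ h) /(inf_lt infS.1).
  move=> [z [y [hy <- yN]]] /(lt_tsol _ _ _ t hy hw).
  by rewrite wt; have := yN t t0; lra.
have r_al t : r t <= al t.
  rewrite leNgt; apply/negP => h; have [w hw wt] := ex t (al t).
  have Sw : S' (w 0) by apply: (Sal' t); exists w.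
  have := lt_tsol w r t 0 hw hr; rewrite wt r0 => /(_ h).
  by have := ge_inf infS.2 Sw; lra.
have aN' t : `|a t| <= N.
  by rewrite ler_norml aN andbT; have := al_a t; have := alN2 t; lra.
have rN' t : `|r t| <= N.
  by rewrite ler_norml rN /=; have := r_al t; have := alN1 t; lra.
exists a, r, d; split=> //.
- exact: tsol_gsol ha aN'.
- exact: tsol_gsol hr rN'.
- by exists N.
move=> t; split.
  rewrite leNgt; apply/negP => h.
  have := gap_al r t hr; rewrite -/K -/d => /(_ ltac:(lra)).
  have := r_al (t + 3 / K); lra.
have := gap_al a (t - 3 / K) ha; rewrite -/K -/d subrK => /(_ _) h.
have := al_a (t - 3 / K); have := h ltac:(have := al_a (t - 3 / K); lra); lra.
Qed.

End ShiftedRiccati.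

(** * Separation and hyperbolicity *)

Section AttractorRepeller.
Context {R : realType}.
Implicit Types (G p a r b y D : R -> R) (s t u c d e m M N K T : R).

Definition psol G p s t y := (forall u, s < u <= t -> leftc y u) /\
  (forall u, s <= u < t -> rder y u (field G p u (y u))).

Lemma gsol_psol G p s t y : gsol G p y -> psol G p s t y.
Proof. by move=> h; split=> u _; have [] := h u. Qed.

Lemma psol_sub G p s t s' t' y : s <= s' -> t' <= t -> psol G p s t y ->
  psol G p s' t' y.
Proof. by move=> ss tt [h1 h2]; split=> u su; [apply: h1|apply: h2]; lra. Qed.

Lemma psol_bounded G p s t y : s <= t -> psol G p s t y ->
  exists2 B, 0 < B & forall u, s <= u <= t -> `|y u| <= B.
Proof.
move=> st [h1 h2]; apply: bounded_segment => // u /h2; exact: rder_rightc.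
Qed.

Lemma field_diff G p t (y z : R) :
  field G p t y - field G p t z = - (y + z - 2 * G t) * (y - z).
Proof. by rewrite /field; ring. Qed.

Lemma psol_diff G p s t y1 y2 : reg G -> s <= t -> psol G p s t y1 ->
  psol G p s t y2 -> exists2 K, 0 < K & forall u, s <= u < t -> exists2 l,
    rder (fun v => y2 v - y1 v) u l & `|l| <= K * `|y2 u - y1 u|.
Proof.
move=> rG st h1 h2; have [M M0 hM] := reg_bound rG.
have [B1 B10 hB1] := psol_bounded st h1; have [B2 B20 hB2] := psol_bounded st h2.
exists (B1 + B2 + 2 * M) => [|u sut]; first lra.
eexists; first exact: rderB (h2.2 _ sut) (h1.2 _ sut).
rewrite field_diff normrM ler_wpM2r// normrN.
have sut' : s <= u <= t by lra.
have := hB1 u sut'; have := hB2 u sut'; have := hM u; rewrite !ler_norml; lra.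
Qed.

Lemma psol_le G p s t y1 y2 : reg G -> s <= t -> psol G p s t y1 ->
  psol G p s t y2 -> y1 s <= y2 s -> y1 t <= y2 t.
Proof.
move=> rG st h1 h2 hs; have [K K0 hK] := psol_diff rG st h1 h2.
rewrite -subr_ge0.
apply: (@nonneg_of_rder _ (fun u => y2 u - y1 u) K s t) => //; first exact: ltW.
- by rewrite subr_ge0.
- by move=> u sut; apply: leftc_lusc; apply: leftcB; [exact: h2.1|exact: h1.1].
- move=> u sut; have [l hl lK] := hK u sut; exists l => //.
  by move: lK; rewrite ler_norml => /andP[]; lra.
Qed.

Lemma psol_lt G p s t y1 y2 : reg G -> s <= t -> psol G p s t y1 ->
  psol G p s t y2 -> y1 s < y2 s -> y1 t < y2 t.
Proof.
move=> rG st h1 h2 hs; have [K K0 hK] := psol_diff rG st h1 h2.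
have W0 u : s <= u <= t -> 0 <= y2 u - y1 u.
  move=> sut; rewrite subr_ge0; apply: (psol_le (s := s) rG); first lra.
  - by apply: psol_sub h1; lra.
  - by apply: psol_sub h2; lra.
  - exact: ltW.
have : (y2 s - y1 s) * expR (K * (s - s)) <= (y2 t - y1 t) * expR (K * (t - s)).
  apply: (@ler_rder _ (fun u => (y2 u - y1 u) * expR (K * (u - s)))) => // u sut.
    apply: leftc_lusc; apply: leftcM; last exact: leftc_expZ.
    by apply: leftcB; [exact: h2.1|exact: h1.1].
  have [l hl lK] := hK u sut; eexists.
    by apply: rderM; [exact: hl|exact: rder_expZ].
  set E := expR _; have E0 : 0 < E by exact: expR_gt0.
  have -> : l * E + (y2 u - y1 u) * (E * K) = E * (l + K * (y2 u - y1 u)) by ring.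
  rewrite pmulr_rge0//; have sut' : s <= u <= t by lra.
  move: lK; rewrite (ger0_norm (W0 u sut')).
  by rewrite ler_norml => /andP[]; lra.
rewrite subrr mulr0 expR0 mulr1 -subr_gt0 => h.
rewrite -(pmulr_lgt0 _ (expR_gt0 (K * (t - s)))); apply: lt_le_trans h.
by rewrite subr_gt0.
Qed.

(** Exponential decay of a quotient, from the difference of the logarithmic
    derivatives [kA] and [kB]. *)
Lemma ratio_decay (A B kA kB : R -> R) s t d : s <= t ->
  (forall u, s < u <= t -> leftc A u) -> (forall u, s < u <= t -> leftc B u) ->
  (forall u, s <= u < t -> rder A u (kA u * A u)) ->
  (forall u, s <= u < t -> rder B u (kB u * B u)) ->
  (forall u, s <= u <= t -> 0 < A u) -> (forall u, s <= u <= t -> 0 < B u) ->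
  (forall u, s <= u < t -> kA u - kB u <= - d) ->
  A t / B t <= A s / B s * expR (- d * (t - s)).
Proof.
move=> st lA lB rA rB A0 B0 hk.
have : A t / B t * expR (d * (t - s)) <= A s / B s * expR (d * (s - s)).
  apply: (@ger_rder _ (fun u => A u / B u * expR (d * (u - s)))) => // u sut.
    apply: leftcM; last exact: leftc_expZ.
    apply: leftcM; first exact: lA.
    by apply: leftc_inv; [rewrite gt_eqF// B0//; lra|exact: lB].
  have Bu : 0 < B u by apply: B0; lra.
  have Au : 0 < A u by apply: A0; lra.
  eexists.
    apply: rderM; last exact: rder_expZ.
    by apply: rderM; [exact: rA|apply: rder_inv; [rewrite gt_eqF|exact: rB]].
  set E := expR _; have E0 : 0 < E by exact: expR_gt0.
  rewrite -/E (_ : _ + _ = E * (A u / B u) * (kA u - kB u + d)); last first.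
    by field; rewrite gt_eqF.
  apply: mulr_ge0_le0; last by have := hk u sut; lra.
  by apply: mulr_ge0; [exact: ltW|apply: divr_ge0; exact: ltW].
rewrite subrr mulr0 expR0 mulr1 mulNr expRN => h.
by rewrite ler_pdivlMr ?expR_gt0.
Qed.

Lemma exp_small d (v : R) : 0 < d -> 0 < v -> exists2 x, 0 <= x & expR (- d * x) < v.
Proof.
move=> d0 v0; exists (v^-1 / d); first by rewrite divr_ge0 ?invr_ge0// ltW.
rewrite mulNr expRN mulrC divfK ?gt_eqF// invf_plt ?posrE ?expR_gt0//.
by apply: lt_le_trans (expR_ge1Dx _); lra.
Qed.

Section SeparatedPair.
Variables (G p a r : R -> R) (d : R).
Hypotheses (rG : reg G) (sa : gsol G p a) (sr : gsol G p r).
Hypotheses (d0 : 0 < d) (hd : forall t, r t + d <= a t).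

(** Of three ordered solutions, the ratio of the distances of the two lower
    ones to the upper one evolves with the logarithmic derivative [r - a].
    Hence a solution above [a] cannot exist arbitrarily far in the past. *)
Lemma past_solution_le (u : R -> R) T : (forall s, s <= T -> psol G p s T u) -> u T <= a T.
Proof.
move=> hu; rewrite leNgt; apply/negP => auT; have d0' := d0.
have gt_a t : t <= T -> a t < u t.
  move=> tT; rewrite ltNge; apply/negP => h.
  have := psol_le rG tT (hu t tT) (gsol_psol _ _ sa) h; lra.
have gt_r t : t <= T -> r t < u t.
  by move=> /gt_a; have := hd t; lra.
pose v := (u T - a T) / (u T - r T).
have v0 : 0 < v by rewrite divr_gt0// subr_gt0// gt_r.
have [x x0 hx] := exp_small d0 v0.
have sT : T - x <= T by lra.
have [lu ru] := hu _ sT.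
have : v <= (u (T - x) - a (T - x)) / (u (T - x) - r (T - x)) *
    expR (- d * (T - (T - x))).
  apply: (@ratio_decay (fun t => u t - a t) (fun t => u t - r t)
    (fun t => - (u t + a t - 2 * G t)) (fun t => - (u t + r t - 2 * G t))) => //.
  - by move=> w hw; apply: leftcB; [exact: lu|exact: (sa w).1].
  - by move=> w hw; apply: leftcB; [exact: lu|exact: (sr w).1].
  - by move=> w hw; rewrite -(field_diff G p); apply: rderB; [exact: ru|exact: (sa w).2].
  - by move=> w hw; rewrite -(field_diff G p); apply: rderB; [exact: ru|exact: (sr w).2].
  - by move=> w hw; rewrite subr_gt0 gt_a//; lra.
  - by move=> w hw; rewrite subr_gt0 gt_r//; lra.
  - by move=> w hw; have := hd w; lra.
rewrite (_ : T - (T - x) = x); last by ring.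
have h1 : (u (T - x) - a (T - x)) / (u (T - x) - r (T - x)) <= 1.
  rewrite ler_pdivrMr ?subr_gt0 ?gt_r// mul1r.
  by have := hd (T - x); lra.
have := ler_wpM2r (ltW (expR_gt0 (- d * x))) h1; lra.
Qed.

(** The same argument with the time reversed: below [r], the ratio of the
    distances to [a] and to [r] would decay to zero, although it exceeds one. *)
Lemma future_solution_ge (u : R -> R) T : (forall t, T <= t -> psol G p T t u) -> r T <= u T.
Proof.
move=> hu; rewrite leNgt; apply/negP => urT; have d0' := d0.
have lt_r t : T <= t -> u t < r t.
  move=> tT; exact: psol_lt rG tT (hu t tT) (gsol_psol _ _ sr) urT.
have lt_a t : T <= t -> u t < a t.
  by move=> /lt_r; have := hd t; lra.
pose v := (a T - u T) / (r T - u T).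
have v0 : 0 < v by rewrite divr_gt0// subr_gt0// ?lt_r// lt_a.
have vV : 0 < v^-1 by rewrite invr_gt0.
have [x x0 hx] := exp_small d0 vV.
have Tx : T <= T + x by lra.
have [lu ru] := hu _ Tx.
have : (a (T + x) - u (T + x)) / (r (T + x) - u (T + x)) <=
    v * expR (- d * (T + x - T)).
  apply: (@ratio_decay (fun t => a t - u t) (fun t => r t - u t)
    (fun t => - (a t + u t - 2 * G t)) (fun t => - (r t + u t - 2 * G t))) => //.
  - by move=> w hw; apply: leftcB; [exact: (sa w).1|exact: lu].
  - by move=> w hw; apply: leftcB; [exact: (sr w).1|exact: lu].
  - by move=> w hw; rewrite -(field_diff G p); apply: rderB; [exact: (sa w).2|exact: ru].
  - by move=> w hw; rewrite -(field_diff G p); apply: rderB; [exact: (sr w).2|exact: ru].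
  - by move=> w hw; rewrite subr_gt0 lt_a//; lra.
  - by move=> w hw; rewrite subr_gt0 lt_r//; lra.
  - by move=> w hw; have := hd w; lra.
rewrite (_ : T + x - T = x); last by ring.
have h1 : 1 < (a (T + x) - u (T + x)) / (r (T + x) - u (T + x)).
  rewrite ltr_pdivlMr ?subr_gt0 ?lt_r// mul1r.
  by have := hd (T + x); have := d0; lra.
have : v * expR (- d * x) < v * v^-1 by rewrite ltr_pM2l.
rewrite divff ?gt_eqF//; lra.
Qed.

End SeparatedPair.

Lemma gsol_continuous G p y : gsol G p y -> continuous y.
Proof.
by move=> h t; have [h1 h2] := h t; apply: leftc_rightc_continuous => //; exact: rder_rightc h2.
Qed.

Lemma gsol_reg G p y B : gsol G p y -> (forall t, `|y t| <= B) -> reg y.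
Proof. by move=> h hB; apply: reg_cont hB; exact: gsol_continuous h. Qed.

Lemma bounded_funP (f : R -> R) : bounded_fun f <-> exists B, forall t, `|f t| <= B.
Proof.
split=> [[M [_ hM]]|[B hB]]; first by exists (M + 1) => t; apply: (hM (M + 1)) => //; lra.
exists B; split; first exact: num_real.
by move=> M BM t _ /=; exact: le_trans (hB t) (ltW BM).
Qed.

(** The coefficients of [- (y - G) ^+ 2 + p] as a quadratic polynomial in [y]. *)
Definition coefQ G := fun t => 2 * G t.
Definition coefP G p := fun t => p t - G t ^+ 2.

Lemma reg_coefQ G : reg G -> reg (coefQ G).
Proof. by move=> h; apply: regM => //; exact: reg_cst. Qed.

Lemma reg_coefP G p : reg G -> reg p -> reg (coefP G p).
Proof. by move=> h1 h2; apply: regB => //; exact: reg_sqr. Qed.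

Lemma rhs_field G p t (y : R) : rhs (coefQ G) (coefP G p) t y = field G p t y.
Proof. by rewrite /rhs /field /coefQ /coefP; ring. Qed.

Lemma bounded_solutionP G p b : reg G -> reg p ->
  bounded_solution (coefQ G) (coefP G p) b <->
  gsol G p b /\ exists B, forall t, `|b t| <= B.
Proof.
move=> rG rp; rewrite /bounded_solution.
have rQ := reg_coefQ rG; have rP := reg_coefP rG rp.
have iT : is_interval [set: R] by [].
split=> [[sb /bounded_funP]|[sb /bounded_funP]]; split=> //.
  move=> t; have := solution_isol rQ rP iT sb => /(_ t Logic.I)[h1 h2].
  split; first by apply: (h2 (t - 1)) => //; lra.
  by rewrite -rhs_field; apply: (h1 (t + 1)) => //; lra.
apply: isol_solution => // t _; have [h1 h2] := sb t.
by split=> // v _ _; rewrite rhs_field.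
Qed.

(** The distance [D = a - r] satisfies [D' = (- 2 a + 2 G + D) D], and also
    [D' = (- 2 r + 2 G - D) D]. As [D] lies between two positive constants, the
    exponentials of the integrals of [- 2 a + 2 G] and of [- 2 r + 2 G] are, up to
    bounded factors, those of the integrals of [- D] and of [D]. *)
Lemma pair_of_separated G p a r B d : reg G -> reg p -> gsol G p a -> gsol G p r ->
  (forall t, `|a t| <= B) -> (forall t, `|r t| <= B) -> 0 < d ->
  (forall t, r t + d <= a t) ->
  attractor_repeller_pair (coefQ G) (coefP G p) a r.
Proof.
move=> rG rp sa sr ha hr d0 hd.
have dB t : d <= a t - r t <= 2 * B.
  by have := ha t; have := hr t; rewrite !ler_norml; have := hd t; lra.
have dt0 t : 0 < a t - r t by have := dB t; lra.
have B0 : 0 < 2 * B by have := dB 0; lra.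
have rQa : reg (fun l => - 2 * a l + coefQ G l).
  apply: regD; last exact: reg_coefQ.
  by apply: regM; [exact: reg_cst|exact: gsol_reg ha].
have rQr : reg (fun l => - 2 * r l + coefQ G l).
  apply: regD; last exact: reg_coefQ.
  by apply: regM; [exact: reg_cst|exact: gsol_reg hr].
have ratio s t : (a t - r t) / (a s - r s) <= 2 * B / d.
  rewrite ler_pdivrMr// mulrAC ler_pdivlMr//.
  by apply: ler_pM; have := dB t; have := dB s; lra.
have k1 : 1 <= 2 * B / d by rewrite ler_pdivlMr// mul1r; have := dB 0; lra.
have rD u := rderB (sa u).2 (sr u).2.
have lD u : leftc (fun v => a v - r v) u by apply: leftcB; [exact: (sa u).1|exact: (sr u).1].
split.
- by split; apply/bounded_solutionP => //; split=> //; exists B.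
- move=> b /bounded_solutionP-/(_ rG rp)[sb _] t; split.
    by apply: (future_solution_ge rG sa sr d0 hd) => u _; exact: gsol_psol.
  by apply: (past_solution_le rG sa sr d0 hd) => u _; exact: gsol_psol.
- exists (2 * B / d), d; split=> // s t st.
  rewrite prim_int//; set F := prim _.
  have : (a s - r s) * expR (- F s - d * s) <= (a t - r t) * expR (- F t - d * t).
    apply: (@ler_rder _ (fun u => (a u - r u) * expR (- F u - d * u))) => // u _.
      apply: leftc_lusc; apply: leftcM => //; apply: leftc_exp; apply: leftcB.
        by apply: leftcN; apply: leftc_cont; exact: prim_continuous.
      by apply: leftcM; [exact: leftc_cst|exact: leftc_id].
    eexists.
      apply: rderM; first exact: rD.
      apply: rder_exp; apply: rderB; first by apply: rderN; exact: rder_prim.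
      by apply: rderZ; exact: rder_id.
    rewrite field_diff; set E := expR _; have E0 : 0 < E by exact: expR_gt0.
    rewrite (_ : _ + _ = E * (a u - r u) * (a u - r u - d)); last first.
      by rewrite /coefQ; ring.
    apply: mulr_ge0; last by have := hd u; lra.
    by apply: mulr_ge0; exact: ltW.
  have -> : - F t - d * t = (- F s - d * s) + - ((F t - F s) + d * (t - s)) by ring.
  rewrite (expRD (_ - _)) mulrCA [X in X <= _]mulrC ler_pM2l ?expR_gt0// expRN.
  rewrite ler_pdivlMr ?expR_gt0// expRD => h.
  have {}h : expR (F t - F s) * expR (d * (t - s)) <= (a t - r t) / (a s - r s).
    by rewrite ler_pdivlMr// mulrC.
  rewrite mulNr expRN ler_pdivlMr ?expR_gt0//.
  exact: le_trans h (ratio _ _).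
- exists (2 * B / d), d; split=> // s t ts.
  rewrite prim_int//; set F := prim _.
  have : (a s - r s) * expR (- F s + d * s) <= (a t - r t) * expR (- F t + d * t).
    apply: (@ger_rder _ (fun u => (a u - r u) * expR (- F u + d * u))) => // u _.
      apply: leftcM => //; apply: leftc_exp; apply: leftcD.
        by apply: leftcN; apply: leftc_cont; exact: prim_continuous.
      by apply: leftcM; [exact: leftc_cst|exact: leftc_id].
    eexists.
      apply: rderM; first exact: rD.
      apply: rder_exp; apply: rderD; first by apply: rderN; exact: rder_prim.
      by apply: rderZ; exact: rder_id.
    rewrite field_diff; set E := expR _; have E0 : 0 < E by exact: expR_gt0.
    rewrite (_ : _ + _ = E * (a u - r u) * (- (a u - r u - d))); last first.
      by rewrite /coefQ; ring.
    apply: mulr_ge0_le0; last by have := hd u; lra.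
    by apply: mulr_ge0; exact: ltW.
  have -> : - F t + d * t = - F s + d * s + ((F s - F t) + d * (t - s)) by ring.
  rewrite (expRD (_ + _)) mulrCA [X in X <= _]mulrC ler_pM2l ?expR_gt0// expRD => h.
  rewrite expRN; set X := expR (F s - F t) in h *; set E := expR (d * _) in h *.
  have X0 : 0 < X by exact: expR_gt0.
  apply: (@le_trans _ _ ((a t - r t) / (a s - r s) * E)); last first.
    by rewrite ler_pM2r ?expR_gt0.
  rewrite -(ler_pM2l X0) divff ?gt_eqF//.
  rewrite (_ : X * _ = (a t - r t) * (X * E) / (a s - r s)); last by ring.
  by rewrite ler_pdivlMr// mul1r.
Qed.

End AttractorRepeller.

(** * Persistence of strict lower solutions *)

Section Persistence.
Context {R : realType}.
Implicit Types (G p a r b y al : R -> R) (s t u c d e m M N K T B : R).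

(** The two exponential estimates on the interval from [0] to [x] multiply to
    [1 <= k1 k2 expR (- (b1 + b2) x)]. *)
Lemma attractive_repulsive_absurd Q b : reg (fun l => - 2 * b l + Q l) ->
  attractive Q b -> repulsive Q b -> False.
Proof.
move=> rg [k1 [b1 [k11 b10 h1]]] [k2 [b2 [k21 b20 h2]]].
have kk : 0 < k1 * k2 by apply: mulr_gt0; lra.
have [x x0 hx] : exists2 x, 0 <= x & expR (- (b1 + b2) * x) < (k1 * k2)^-1.
  by apply: exp_small; [lra|rewrite invr_gt0].
have := h1 0 x x0; have := h2 x 0 x0; set I := Rintegral _ _ _ => {}h2 {}h1.
have : expR (- I) * expR I <=
    (k2 * expR (b2 * (0 - x))) * (k1 * expR (- b1 * (x - 0))).
  by apply: ler_pM => //; exact: expR_ge0.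
rewrite -expRD addNr expR0 mulrACA -expRD.
have -> : b2 * (0 - x) + - b1 * (x - 0) = - (b1 + b2) * x by ring.
move=> h; have : (k1 * k2) * expR (- (b1 + b2) * x) < (k1 * k2) * (k1 * k2)^-1.
  by rewrite ltr_pM2l.
rewrite divff ?gt_eqF// [k1 * k2]mulrC; lra.
Qed.

(** The reciprocal [1 / (a - r)] of the distance satisfies a linear equation
    whose homogeneous part is controlled in the past by the attractivity of
    [a] and in the future by the repulsivity of [r]. *)
Lemma pair_separated G p a r : reg G -> reg p ->
  attractor_repeller_pair (coefQ G) (coefP G p) a r ->
  [/\ gsol G p a, gsol G p r, exists B, forall t, `|a t| <= B /\ `|r t| <= B &
    exists2 d, 0 < d & forall t, r t + d <= a t].
Proof.
move=> rG rp [[/bounded_solutionP-/(_ rG rp)[sa [Ba hBa]]]].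
move=> /bounded_solutionP-/(_ rG rp)[sr [Br hBr]] extr att rep.
have rQ := reg_coefQ rG.
have rQa : reg (fun l => - 2 * a l + coefQ G l).
  by apply: regD => //; apply: regM; [exact: reg_cst|exact: gsol_reg sa hBa].
have rQr : reg (fun l => - 2 * r l + coefQ G l).
  by apply: regD => //; apply: regM; [exact: reg_cst|exact: gsol_reg sr hBr].
have ra t : r t <= a t.
  by apply: (extr a _ t).1; apply/bounded_solutionP => //; split=> //; exists Ba.
have uniq s t : r s = a s -> r t = a t.
  move=> e; have [M M0 hM] := reg_bound rG.
  apply/eqP; rewrite -subr_eq0 -sqrf_eq0; apply/eqP/le_anti; rewrite sqr_ge0 andbT.
  have := @gronwall _ (fun u => r u - a u) (Ba + Br + 2 * M) 0 s t.
  rewrite e subrr expr0n/= !addr0 mul0r; apply.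
  - have := le_trans (normr_ge0 _) (hBa 0); have := le_trans (normr_ge0 _) (hBr 0); lra.
  - by move=> u; apply: leftcB; [exact: (sr u).1|exact: (sa u).1].
  - move=> u; eexists; first exact: rderB (sr u).2 (sa u).2.
    rewrite addr0 field_diff normrM ler_wpM2r// normrN.
    by have := hBa u; have := hBr u; have := hM u; rewrite !ler_norml; lra.
have rlta t : r t < a t.
  rewrite lt_neqAle ra andbT; apply/eqP => e.
  have ear : a = r by apply/funext => u; rewrite (uniq t u e).
  by move: rep; rewrite -ear => rep; exact: (attractive_repulsive_absurd rQa att rep).
split=> //.
  exists (Num.max Ba Br) => t; rewrite !le_max hBa hBr orbT; by [].
pose D t := a t - r t; have D0 t : 0 < D t by rewrite subr_gt0.
have rD u := rderB (sa u).2 (sr u).2.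
have lD u : leftc D u by apply: leftcB; [exact: (sa u).1|exact: (sr u).1].
have [k1 [b1 [k11 b10 h1]]] := att; have [k2 [b2 [k21 b20 h2]]] := rep.
have past t : t <= 0 -> (D t)^-1 <= k1 / b1 + k1 * (D 0)^-1.
  move=> t0; pose F := prim (fun l => - 2 * a l + coefQ G l).
  have h1' l : t <= l -> expR (F l - F t) <= k1 * expR (- b1 * (l - t)).
    by move=> tl; rewrite -prim_int//; exact: h1.
  have : (D t)^-1 * expR (F t - F t) - k1 / b1 * expR (- b1 * (t - t)) <=
         (D 0)^-1 * expR (F 0 - F t) - k1 / b1 * expR (- b1 * (0 - t)).
    apply: (@ler_rder _ (fun l => (D l)^-1 * expR (F l - F t) -
        k1 / b1 * expR (- b1 * (l - t)))) => // l tl.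
      apply: leftc_lusc; apply: leftcB; last first.
        by apply: leftcM; [exact: leftc_cst|exact: leftc_expZ].
      apply: leftcM; first by apply: leftc_inv; rewrite ?gt_eqF.
      apply: leftc_exp; apply: leftcB; last exact: leftc_cst.
      by apply: leftc_cont; exact: prim_continuous.
    eexists.
      apply: rderB; last by apply: rderZ; exact: rder_expZ.
      apply: rderM; first by apply: rder_inv; [rewrite gt_eqF|exact: rD].
      by apply: rder_exp; apply: rderB; [exact: rder_prim|exact: rder_cst].
    have := h1' l ltac:(lra); set E1 := expR _; set E2 := expR _ => hE.
    rewrite field_diff -/(D l).
    rewrite (_ : _ - _ = k1 * E2 - E1); first lra.
    by rewrite /coefQ /D; field; rewrite gt_eqF// subr_eq0 gt_eqF.
  rewrite !subrr mulr0 expR0 !mulr1.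
  have : (D 0)^-1 * expR (F 0 - F t) <= (D 0)^-1 * k1.
    apply: ler_wpM2l; first by rewrite invr_ge0 ltW.
    apply: le_trans (h1' 0 t0) _.
    rewrite ler_piMr//; first lra.
    by rewrite -[leRHS]expR0 ler_expR mulNr oppr_le0 mulr_ge0//; lra.
  have : 0 <= k1 / b1 * expR (- b1 * (0 - t)).
    by rewrite mulr_ge0 ?expR_ge0// divr_ge0; lra.
  rewrite [_ * k1]mulrC; lra.
have future t : 0 <= t -> (D t)^-1 <= k2 / b2 + k2 * (D 0)^-1.
  move=> t0; pose F := prim (fun l => - 2 * r l + coefQ G l).
  have h2' l : l <= t -> expR (F l - F t) <= k2 * expR (b2 * (l - t)).
    by move=> tl; rewrite -opprB -prim_int//; exact: h2.
  have : (D t)^-1 * expR (F t - F t) - k2 / b2 * expR (b2 * (t - t)) <=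
         (D 0)^-1 * expR (F 0 - F t) - k2 / b2 * expR (b2 * (0 - t)).
    apply: (@ger_rder _ (fun l => (D l)^-1 * expR (F l - F t) -
        k2 / b2 * expR (b2 * (l - t)))) => // l tl.
      apply: leftcB; last by apply: leftcM; [exact: leftc_cst|exact: leftc_expZ].
      apply: leftcM; first by apply: leftc_inv; rewrite ?gt_eqF.
      apply: leftc_exp; apply: leftcB; last exact: leftc_cst.
      by apply: leftc_cont; exact: prim_continuous.
    eexists.
      apply: rderB; last by apply: rderZ; exact: rder_expZ.
      apply: rderM; first by apply: rder_inv; [rewrite gt_eqF|exact: rD].
      by apply: rder_exp; apply: rderB; [exact: rder_prim|exact: rder_cst].
    have := h2' l ltac:(lra); set E1 := expR _; set E2 := expR _ => hE.
    rewrite field_diff -/(D l).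
    rewrite (_ : _ - _ = E1 - k2 * E2); first lra.
    by rewrite /coefQ /D; field; rewrite gt_eqF// subr_eq0 gt_eqF.
  rewrite !subrr mulr0 expR0 !mulr1.
  have : (D 0)^-1 * expR (F 0 - F t) <= (D 0)^-1 * k2.
    apply: ler_wpM2l; first by rewrite invr_ge0 ltW.
    apply: le_trans (h2' 0 t0) _.
    rewrite ler_piMr//; first lra.
    by rewrite -[leRHS]expR0 ler_expR mulr_ge0_le0//; lra.
  have : 0 <= k2 / b2 * expR (b2 * (0 - t)).
    by rewrite mulr_ge0 ?expR_ge0// divr_ge0; lra.
  rewrite [_ * k2]mulrC; lra.
pose W := (k1 / b1 + k1 * (D 0)^-1) + (k2 / b2 + k2 * (D 0)^-1).
have p1 : 0 < k1 / b1 by apply: divr_gt0; lra.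
have p2 : 0 < k2 / b2 by apply: divr_gt0; lra.
have p3 : 0 < k1 * (D 0)^-1 by apply: divr_gt0 => //; lra.
have p4 : 0 < k2 * (D 0)^-1 by apply: divr_gt0 => //; lra.
have W0 : 0 < W by rewrite /W; lra.
exists W^-1; first by rewrite invr_gt0.
move=> t; suff : W^-1 <= D t by rewrite /D; lra.
rewrite -[D t]invrK lef_pV2 ?posrE ?invr_gt0//.
by rewrite /W; have [/past|/ltW/future] := leP t 0; lra.
Qed.

Lemma lower_AR G p m al : reg G -> reg p -> 0 < m -> strict_lower G p m al ->
  exists a r, attractor_repeller_pair (coefQ G) (coefP G p) a r /\
    forall t, r t < al t < a t.
Proof.
move=> rG rp m0 lal; have [a [r [d [sa sr [B hB] d0 hd]]]] := lower_pair rG rp m0 lal.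
exists a, r; split; last by move=> t; have := hd t; lra.
apply: (@pair_of_separated _ G p a r B d) => // t; [exact: (hB t).1|exact: (hB t).2|].
by have := hd t; lra.
Qed.

(** By concavity of the field, a convex combination of two solutions is a
    lower solution, strict where the solutions are separated. *)
Lemma rder_convex G p a r c t : rder a t (field G p t (a t)) ->
  rder r t (field G p t (r t)) ->
  rder (fun u => r u + c * (a u - r u)) t
    (field G p t (r t + c * (a t - r t)) - c * (1 - c) * (a t - r t) ^+ 2).
Proof.
move=> ha hr; have := rderD hr (@rderZ _ c _ _ _ (rderB ha hr)); congr rder.
by rewrite /field; ring.
Qed.

(** By concavity the mean of the two solutions is a lower solution, with a margin
    given by their separation. *)
Lemma pair_strict_lower G p a r : reg G -> reg p ->
  attractor_repeller_pair (coefQ G) (coefP G p) a r ->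
  exists m al, 0 < m /\ strict_lower G p m al.
Proof.
move=> rG rp /(pair_separated rG rp)[sa sr [B hB] [d d0 hd]].
have d2 : 0 < 1 / 2 * (1 - 1 / 2) * d ^+ 2 by apply: mulr_gt0; [lra|exact: exprn_gt0].
exists (1 / 2 * (1 - 1 / 2) * d ^+ 2), (fun u => r u + 1 / 2 * (a u - r u)); split=> //.
split.
- exists B => t; have [] := hB t; rewrite !ler_norml; lra.
- move=> t; apply: leftc_lusc; apply: leftcN; apply: leftcD; first exact: (sr t).1.
  apply: leftcM; first exact: leftc_cst.
  by apply: leftcB; [exact: (sa t).1|exact: (sr t).1].
- move=> t; eexists; first exact: rder_convex (sa t).2 (sr t).2.
  rewrite lerD2l lerN2 ler_wpM2l//; first lra.
  by rewrite ler_pXn2r// ?nnegrE; have := hd t; lra.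
Qed.

Lemma rder_clip c t : 0 < c ->
  rder (clip c) t (if (- c <= t) && (t < c) then 1 else 0).
Proof.
move=> c0; have [tc|ct] := leP (- c) t; last first.
  apply: (@rder_near _ (fun=> - c)); last exact: rder_cst.
    near=> u; rewrite clip_le//; [exact: ltW|]; near: u.
    exact: nbhs_right_le.
  by rewrite clip_le// ltW.
have [tc'|ct] := ltP t c; last first.
  apply: (@rder_near _ (fun=> c)); last exact: rder_cst.
    near=> u; rewrite clip_ge//; [exact: ltW|].
    apply: le_trans ct _; near: u; exact: nbhs_right_ge.
  by rewrite clip_ge// ltW.
apply: (@rder_near _ id); last exact: rder_id.
  near=> u; rewrite clip_id// ler_norml; apply/andP; split.
    apply: le_trans tc _; near: u; exact: nbhs_right_ge.
  by near: u; exact: nbhs_right_le.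
by rewrite clip_id// ler_norml tc ltW.
Unshelve. all: by end_near. Qed.

(** A strict lower solution survives a perturbation of the shift which is
    small outside a short interval around zero: a steep ramp of small height
    absorbs what happens on that interval. *)
Lemma strict_lower_persist M B m : 0 <= M -> 0 <= B -> 0 < m ->
  exists eps eta, [/\ 0 < eps, 0 < eta & forall G G' p al,
    (forall t, `|G t| <= M) -> (forall t, `|G' t| <= M) -> (forall t, `|al t| <= B) ->
    (forall t, t < - eta \/ eta <= t -> `|G t - G' t| <= eps) ->
    strict_lower G p m al -> exists al', strict_lower G' p (m / 2) al'].
Proof.
move=> M0 B0 m0; pose H := 2 * B + 2 * M + 1; have H0 : 0 < H by rewrite /H; lra.
(* The slope [ka] of the ramp exceeds any change of the field caused by the
   perturbation; the height [q] of the ramp is small since [eta] is. *)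
pose ka := (1 + 2 * M) * H; have ka0 : 0 < ka by apply: mulr_gt0; lra.
pose eps := m / (4 * H); have eps0 : 0 < eps by apply: divr_gt0; lra.
pose q := Num.min 1 eps; have q0 : 0 < q by rewrite lt_min eps0 ltr01.
have q1 : q <= 1 by rewrite ge_min lexx.
have qe : q <= eps by rewrite ge_min lexx orbT.
pose eta := q / (2 * ka); have eta0 : 0 < eta by apply: divr_gt0; lra.
have kq : 2 * ka * eta = q by rewrite mulrC divfK// gt_eqF//; lra.
exists eps, eta; split=> // G G' p al hG hG' hal hclose [_ al1 al2].
pose sh t := ka * (clip eta t + eta).
have sh0 t : 0 <= sh t <= q.
  have := clip_bound t (ltW eta0); rewrite ler_norml => /andP[h1 h2].
  rewrite mulr_ge0//=; [|lra|lra].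
  have : ka * (clip eta t + eta) <= ka * (eta + eta) by rewrite ler_pM2l; lra.
  by rewrite -kq /sh; lra.
have csh t : leftc sh t.
  apply: leftcM; first exact: leftc_cst; apply: leftcD; last exact: leftc_cst.
  by apply: leftc_cont; exact: continuous_clip (ltW eta0) t.
have rsh t : rder sh t (ka * (if (- eta <= t) && (t < eta) then 1 else 0)).
  apply: rderZ; rewrite -[X in rder _ _ X]addr0.
  by apply: rderD; [exact: rder_clip|exact: rder_cst].
have eps4 : eps * H = m / 4 by rewrite /eps; field; rewrite gt_eqF.
have diff t w : `|sh t + (G' t - G t)| <= w ->
    field G p t (al t) - w * H <= field G' p t (al t - sh t).
  move=> hw; have -> : field G p t (al t) = field G' p t (al t - sh t) -
      (sh t + (G' t - G t)) * (2 * al t - sh t - G t - G' t).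
    by rewrite /field; ring.
  have h2 : `|2 * al t - sh t - G t - G' t| <= H.
    have := hG t; have := hG' t; have := hal t; have := sh0 t.
    by rewrite !ler_norml /H; lra.
  have : `|(sh t + (G' t - G t)) * (2 * al t - sh t - G t - G' t)| <= w * H.
    by rewrite normrM; apply: ler_pM.
  by rewrite ler_norml; lra.
exists (fun t => al t - sh t); split.
- exists (B + 1) => t; have := hal t; have := sh0 t; rewrite !ler_norml; lra.
- move=> t; have -> : (fun u => - (al u - sh u)) = (fun u => - al u + sh u).
    by apply/funext => u; ring.
  by apply: luscD => //; exact: leftc_lusc.
- move=> t; have [l hl lm] := al2 t; eexists; first exact: rderB hl (rsh t).
  have [/andP[h1 h2]|h] := boolP ((- eta <= t) && (t < eta)).
    have := diff t (1 + 2 * M) ltac:(have := hG t; have := hG' t; have := sh0 t;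
      rewrite !ler_norml; lra).
    rewrite -/ka; lra.
  have hc : t < - eta \/ eta <= t.
    by move: h; rewrite negb_and -ltNge -leNgt => /orP.
  have := diff t (eps + eps) ltac:(have := hclose t hc; have := sh0 t;
      rewrite !ler_norml; lra).
  by rewrite mulrDl eps4; lra.
Qed.

Lemma field_neg G p M Mp N c t : (forall t, `|G t| <= M) -> (forall t, `|p t| <= Mp) ->
  M < N -> N <= `|c| -> field G p t c <= Mp - (N - M) ^+ 2.
Proof.
move=> hG hp MN Nc; have := hp t; have := hG t; have M0 := le_trans (normr_ge0 _) (hG 0).
rewrite /field !ler_norml => /andP[g1 g2] /andP[p1 p2].
suff : (N - M) ^+ 2 <= (c - G t) ^+ 2 by lra.
by move: Nc; have [c0|c0] := leP 0 c; [rewrite ger0_norm|rewrite ltr0_norm] => // Nc; nra.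
Qed.

(** Outside [- N, N] the field is at most a negative constant: a solution above
    [N] at some time was above [N] and unbounded in the past, one below [- N]
    stays below and is unbounded in the future. *)
Lemma gsol_a_priori G p M Mp N b B : (forall t, `|G t| <= M) -> (forall t, `|p t| <= Mp) ->
  M < N -> Mp < (N - M) ^+ 2 -> gsol G p b -> (forall t, `|b t| <= B) ->
  forall t, `|b t| <= N.
Proof.
move=> hG hp MN bar sb hB.
have M0 := le_trans (normr_ge0 _) (hG 0).
pose c0 := (N - M) ^+ 2 - Mp; have c00 : 0 < c0 by rewrite /c0; lra.
have neg c t : N <= `|c| -> field G p t c <= - c0.
  by move=> Nc; apply: le_trans (field_neg t hG hp MN Nc) _; rewrite /c0; lra.
have le_cst c s t : N <= `|c| -> s <= t -> b s <= c -> b t <= c.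
  move=> Nc st hs; rewrite -subr_ge0.
  apply: (@barrier _ (fun u => c - b u) s t) => //; first by rewrite subr_ge0.
  - move=> u _; apply: leftc_lusc; apply: leftcB; first exact: leftc_cst.
    exact: (sb u).1.
  - move=> u _; eexists; first exact: rderB (rder_cst c u) (sb u).2.
    by move=> h; rewrite (_ : b u = c); [have := neg c u Nc; lra|lra].
have drop s t : s <= t -> (forall u, s <= u <= t -> N <= `|b u|) ->
    b t + c0 * t <= b s + c0 * s.
  move=> st hu; apply: (@ger_rder _ (fun u => b u + c0 * u)) => // u sut.
    apply: leftcD; first exact: (sb u).1.
    by apply: leftcM; [exact: leftc_cst|exact: leftc_id].
  eexists.
    by apply: rderD; [exact: (sb u).2|apply: rderZ; exact: rder_id].
  by have := neg (b u) u (hu u ltac:(lra)); lra.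
pose x := (2 * B + 1) / c0.
have B0 : 0 <= B := le_trans (normr_ge0 _) (hB 0).
have x0 : 0 <= x by apply: divr_ge0; lra.
have cx : c0 * x = 2 * B + 1 by rewrite mulrC divfK// gt_eqF.
move=> t; rewrite ler_norml; apply/andP; split; rewrite leNgt; apply/negP => h.
  have hu u : t <= u -> b u <= b t.
    by move=> tu; apply: (le_cst (b t) t u) => //; rewrite ltr0_norm; lra.
  have hN u : t <= u <= t + x -> N <= `|b u|.
    by move=> /andP[/hu bu _]; rewrite ltr0_norm; lra.
  have tx : t <= t + x by lra.
  have := drop t (t + x) tx hN; rewrite mulrDr cx.
  by have := hB t; have := hB (t + x); rewrite !ler_norml; lra.
have hu u : u <= t -> N < b u.
  move=> ut; rewrite ltNge; apply/negP => hu.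
  have NN : N <= `|N| by exact: ler_norm.
  by have := le_cst N u t NN ut hu; lra.
have hN u : t - x <= u <= t -> N <= `|b u|.
  by move=> /andP[_ /hu bu]; rewrite ger0_norm; lra.
have tx : t - x <= t by lra.
have := drop (t - x) t tx hN; rewrite mulrBr cx.
by have := hB t; have := hB (t - x); rewrite !ler_norml; lra.
Qed.

End Persistence.

(** * Existence of the bifurcation value *)

Section Bifurcation.
Context {R : realType}.
Implicit Types (G p a r b y al : R -> R) (s t u c d e m M N K T B l : R).

Definition has_bounded G p :=
  exists b, gsol G p b /\ exists B, forall t, `|b t| <= B.

Lemma has_boundedP G p : reg G -> reg p ->
  has_bounded G p <-> exists b, bounded_solution (coefQ G) (coefP G p) b.
Proof.
by move=> rG rp; split=> -[b hb]; exists b; apply/bounded_solutionP.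
Qed.

Lemma coefP_shift G p l : (fun t => coefP G p t + l) = coefP G (fun t => p t + l).
Proof. by apply/funext => t; rewrite /coefP; ring. Qed.

Lemma reg_shift p l : reg p -> reg (fun t => p t + l).
Proof. by move=> h; apply: regD => //; exact: reg_cst. Qed.

(** The margin is the difference of the parameters. *)
Lemma gsol_strict_lower G p b B l l' : l < l' -> gsol G (fun t => p t + l) b ->
  (forall t, `|b t| <= B) -> strict_lower G (fun t => p t + l') (l' - l) b.
Proof.
move=> ll sb hB; split; first by exists B.
  by move=> t; apply: leftc_lusc; apply: leftcN; exact: (sb t).1.
by move=> t; eexists; [exact: (sb t).2|rewrite /field; lra].
Qed.

Lemma AR_has_bounded G p a r : reg G -> reg p ->
  attractor_repeller_pair (coefQ G) (coefP G p) a r -> has_bounded G p.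
Proof. by move=> rG rp [[h _] _ _ _]; apply/has_boundedP => //; exists a. Qed.

Lemma lower_has_bounded G p m al : reg G -> reg p -> 0 < m ->
  strict_lower G p m al -> has_bounded G p.
Proof.
by move=> rG rp m0 /(lower_AR rG rp m0)[a [r [h _]]]; exact: AR_has_bounded h.
Qed.

Lemma increasing_seq_ge (f : nat -> nat) : increasing_seq f -> forall n, (n <= f n)%N.
Proof.
move=> hf; elim=> // n ih; apply: leq_ltn_trans ih _.
have e : (f n.+1 <= f n)%N = (n.+1 <= n)%N := hf n.+1 n.
by rewrite ltnNge e ltnn.
Qed.

(** The initial values at time zero of the bounded solutions for the parameters
    [1 / (n + 1)] accumulate at the initial value of a bounded solution. *)
Lemma has_bounded_closed G p : reg G -> reg p ->
  (forall l, 0 < l -> has_bounded G (fun t => p t + l)) -> has_bounded G p.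
Proof.
move=> rG rp hb; have [M M0 hM] := reg_bound rG; have [Mp Mp0 hMp] := reg_bound rp.
have [N [MN bar _]] := bar_exists M (Mp + 1) 0.
have N0 : 0 <= N by lra.
pose la (n : nat) : R := n.+1%:R^-1.
have la0 n : 0 < la n by rewrite invr_gt0.
have la1 n : la n <= 1 by rewrite invf_le1// ler1n.
have [b hbn] : {b : nat -> R -> R & forall n, gsol G (fun t => p t + la n) (b n) /\
    forall t, `|b n t| <= N}.
  apply: (@choice _ _ (fun n b => gsol G (fun t => p t + la n) b /\
    forall t, `|b t| <= N)) => n.
  have [b [sb [B hB]]] := hb _ (la0 n); exists b; split=> //.
  apply: (@gsol_a_priori _ G (fun t => p t + la n) M (Mp + 1) N b B) => // t.
  by have := hMp t; have := la1 n; have := la0 n; rewrite !ler_norml; lra.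
have bnd : bounded_fun (fun n => b n 0).
  exists N; split; first exact: num_real.
  by move=> N' NN n _ /=; exact: le_trans ((hbn n).2 0) (ltW NN).
have [f fi /cvg_ex[z hz]] := bolzano_weierstrass bnd.
have [y hy y0] := tsol_exists 0 z rG rp N0.
have L0 : 0 < 2 * (N + M) by lra.
have key t n : (y t - b n t) ^+ 2 + la n ^+ 2 <= ((z - b n 0) ^+ 2 + la n ^+ 2) *
    expR ((2 * (2 * (N + M)) + 1) * `|t - 0|).
  have [sb hB] := hbn n; rewrite -y0.
  apply: (@gronwall _ (fun u => y u - b n u)); first exact: ltW.
  - by move=> u; apply: leftcB; [exact: (hy u).1|exact: (sb u).1].
  - move=> u; eexists; first exact: rderB (hy u).2 (sb u).2.
    have := tfield_lip p u (y u) (b n u) N0 hM; rewrite (clip_id (hB u)).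
    rewrite (_ : field G p u (clip N (y u)) - field G (fun t => p t + la n) u (b n u) =
      (field G p u (clip N (y u)) - field G p u (b n u)) - la n); last first.
      by rewrite /field; ring.
    have := la0 n; move=> h1 h2; apply: le_trans (ler_normB _ _) _.
    by rewrite (gtr0_norm h1) lerD2r.
have yN t : `|y t| <= N.
  rewrite leNgt; apply/negP => h; have {}key := key t.
  set C := expR _ in key; have C0 : 0 < C by exact: expR_gt0.
  pose g := `|y t| - N; have g0 : 0 < g by rewrite subr_gt0.
  have gC : 0 < g ^+ 2 / (4 * C) by apply: divr_gt0; [exact: exprn_gt0|lra].
  pose eta := Num.min 1 (g ^+ 2 / (4 * C)).
  have eta0 : 0 < eta by rewrite lt_min gC ltr01.
  have eta1 : eta <= 1 by rewrite ge_min lexx.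
  have etaC : eta * (4 * C) <= g ^+ 2.
    by rewrite -ler_pdivlMr; [rewrite ge_min lexx orbT|lra].
  have [n [n1 n2]] : exists n, `|z - b n 0| <= eta /\ la n <= eta.
    have [k hk] : exists k : nat, forall n, (k <= n)%N -> `|z - b (f n) 0| <= eta.
      move/cvgrPdist_le : hz => /(_ _ eta0)[k _ hk]; exists k => n kn; exact: hk.
    have [k' hk'] : exists k' : nat, eta^-1 < k'%:R.
      by exists (Num.bound eta^-1); apply: archi_boundP; rewrite invr_ge0 ltW.
    exists (f (maxn k k')); split; first by apply: hk; exact: leq_maxl.
    rewrite /la invf_ple ?posrE// (le_trans (ltW hk'))// ler_nat.
    apply: leq_trans (leq_maxr k k') _.
    by apply: leq_trans (increasing_seq_ge fi _) _; exact: leqnSn.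
  have gle : g <= `|y t - b n t|.
    by have := ler_normD (y t - b n t) (b n t); rewrite subrK; have := (hbn n).2 t; rewrite /g; lra.
  have g2 : g ^+ 2 <= (y t - b n t) ^+ 2.
    by rewrite -[leRHS]real_normK ?num_real// ler_pXn2r// nnegrE ltW.
  have z2 : (z - b n 0) ^+ 2 <= eta.
    rewrite -[leLHS]real_normK ?num_real// expr2.
    by apply: le_trans (_ : eta * 1 <= _); [apply: ler_pM => //; lra|rewrite mulr1].
  have l2 : la n ^+ 2 <= eta.
    rewrite expr2; have := la0 n => ?.
    by apply: le_trans (_ : eta * 1 <= _); [apply: ler_pM => //; lra|rewrite mulr1].
  have h3 : ((z - b n 0) ^+ 2 + la n ^+ 2) * C <= (eta + eta) * C.
    by rewrite ler_pM2r//; exact: lerD.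
  have := key n; have := sqr_ge0 (la n); have : 0 < g ^+ 2 by exact: exprn_gt0.
  lra.
by exists y; split; [exact: tsol_gsol hy yN|exists N].
Qed.

Lemma has_bounded_mono G p l l' : reg G -> reg p -> l < l' ->
  has_bounded G (fun t => p t + l) -> has_bounded G (fun t => p t + l').
Proof.
move=> rG rp ll [b [sb [B hB]]].
apply: (@lower_has_bounded G (fun t => p t + l') (l' - l) b) => //.
- exact: reg_shift.
- by rewrite subr_gt0.
- exact: gsol_strict_lower hB.
Qed.

(** The parameters with a bounded solution form a closed up-set. It is not empty,
    since [0] is a strict lower solution for large parameters, and it is bounded
    below, since for very negative parameters all solutions decrease at a fixed
    rate. *)
Lemma bifurcation_exists G p : reg G -> reg p ->
  exists l0, is_bifurcation_value (coefQ G) (coefP G p) l0.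
Proof.
move=> rG rp; have [M M0 hM] := reg_bound rG; have [Mp Mp0 hMp] := reg_bound rp.
pose A := [set l | has_bounded G (fun t => p t + l)].
have ne : A !=set0.
  exists (M ^+ 2 + Mp + 1); apply: (@lower_has_bounded _ _ 1 (fun=> 0)) => //.
    exact: reg_shift.
  split; first by exists 0 => t; rewrite normr0.
    by move=> t; apply: leftc_lusc; exact: leftc_cst.
  move=> t; exists 0; first exact: rder_cst.
  have G2 : G t ^+ 2 <= M ^+ 2.
    by rewrite -[leLHS]real_normK ?num_real// ler_pXn2r// nnegrE ltW.
  by have := hMp t; rewrite /field sub0r sqrrN ler_norml; lra.
have lb : lbound A (- Mp).
  move=> l [b [sb [B hB]]]; rewrite leNgt; apply/negP => lM.
  pose e := - Mp - l; have e0 : 0 < e by rewrite /e; lra.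
  have B0 : 0 <= B := le_trans (normr_ge0 _) (hB 0).
  pose x := (2 * B + 1) / e.
  have x0 : 0 <= x by apply: divr_ge0; lra.
  have ex : e * x = 2 * B + 1 by rewrite mulrC divfK// gt_eqF.
  have : b x + e * x <= b 0 + e * 0.
    apply: (@ger_rder _ (fun u => b u + e * u)) => // u _.
      apply: leftcD; first exact: (sb u).1.
      by apply: leftcM; [exact: leftc_cst|exact: leftc_id].
    eexists.
      by apply: rderD; [exact: (sb u).2|apply: rderZ; exact: rder_id].
    have := hMp u; rewrite /field /e ler_norml; have := sqr_ge0 (b u - G u); lra.
  by have := hB x; have := hB 0; rewrite !ler_norml; lra.
have hl : has_lbound A by exists (- Mp).
exists (inf A) => l; rewrite coefP_shift.
have rl := reg_shift l rp.
split=> [/(has_boundedP rG rl) h|h]; first exact: ge_inf.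
apply/(has_boundedP rG rl); apply: has_bounded_closed => // e e0.
have [l' Al' ll'] : exists2 l', A l' & l' < l + e by apply: inf_lt => //; lra.
have -> : (fun t => p t + l + e) = (fun t => p t + (l + e)).
  by apply/funext => t; rewrite addrA.
exact: has_bounded_mono ll' Al'.
Qed.

(** The strict lower solution of the pair is transferred to the nearby equation. *)
Lemma persist_AR G p M a r : reg G -> reg p -> 0 <= M -> (forall t, `|G t| <= M) ->
  attractor_repeller_pair (coefQ G) (coefP G p) a r ->
  exists eps eta, [/\ 0 < eps, 0 < eta & forall G', reg G' -> (forall t, `|G' t| <= M) ->
    (forall t, t < - eta \/ eta <= t -> `|G t - G' t| <= eps) ->
    exists a' r', attractor_repeller_pair (coefQ G') (coefP G' p) a' r'].
Proof.
move=> rG rp M0 hG /(pair_strict_lower rG rp)[m [al [m0 lal]]].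
have [[B hB] _ _] := lal; have B0 : 0 <= B := le_trans (normr_ge0 _) (hB 0).
have [eps [eta [e0 eta0 H]]] := strict_lower_persist M0 B0 m0.
exists eps, eta; split=> // G' rG' hG' close.
have [al' lal'] := H G G' p al hG hG' hB close lal.
have m2 : 0 < m / 2 by lra.
by have [a' [r' [h _]]] := lower_AR rG' rp m2 lal'; exists a', r'.
Qed.

(** By closedness, bounded solutions are still absent for some parameter [l > 0].
    A bounded solution of a nearby equation, which obeys an a priori bound, would
    be a strict lower solution for the parameter [l], and could be transferred
    back. *)
Lemma persist_no_bounded G p M : reg G -> reg p -> 0 <= M -> (forall t, `|G t| <= M) ->
  ~ has_bounded G p ->
  exists eps eta, [/\ 0 < eps, 0 < eta & forall G', reg G' -> (forall t, `|G' t| <= M) ->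
    (forall t, t < - eta \/ eta <= t -> `|G t - G' t| <= eps) -> ~ has_bounded G' p].
Proof.
move=> rG rp M0 hG nb; have [Mp Mp0 hMp] := reg_bound rp.
have [l l0 nl] : exists2 l, 0 < l & ~ has_bounded G (fun t => p t + l).
  apply: contrapT => h; apply: nb; apply: has_bounded_closed => // l l0.
  by apply: contrapT => nl; apply: h; exists l.
have [N [MN bar N0]] := bar_exists M Mp 0.
have [eps [eta [e0 eta0 H]]] := strict_lower_persist M0 (ltW N0) l0.
exists eps, eta; split=> // G' rG' hG' close [b [sb [B hB]]].
have bN := gsol_a_priori hG' hMp MN bar sb hB.
have lb : strict_lower G' (fun t => p t + l) l b.
  rewrite -[X in strict_lower _ _ X](subr0 l); apply: gsol_strict_lower bN => //.
  by have -> : (fun t => p t + 0) = p by apply/funext => t; rewrite addr0.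
have close' t : t < - eta \/ eta <= t -> `|G' t - G t| <= eps.
  by move=> h; rewrite distrC; exact: close.
have [al' lal'] := H G' G (fun t => p t + l) b hG' hG bN close' lb.
apply: nl; apply: lower_has_bounded lal' => //; [exact: reg_shift|lra].
Qed.

End Bifurcation.

(** * Coefficients and transition functions *)

Section Coefficients.
Context {R : realType}.
Implicit Types (q p Gam g : R -> R) (d : int -> R) (s t u c e m M gm gp h : R).

Lemma disperse_gap d : disperse d -> exists2 g, 0 < g & forall j, d j + g <= d (j + 1).
Proof.
rewrite /disperse => dd.
have hi : has_inf (range (fun j : int => d (j + 1) - d j)).
  by apply: contrapT => /inf_out e; move: dd; rewrite e ltxx.
exists (inf (range (fun j : int => d (j + 1) - d j))) => // j.
by rewrite -lerBrDl; apply: (ge_inf hi.2); exists j.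
Qed.

(** The gaps are bounded below, so the enumeration is unbounded in both
    directions. *)
Lemma disperse_cover d t : disperse d ->
  (exists j, t = d j) \/ exists j, d j < t < d (j + 1).
Proof.
move=> /disperse_gap[g g0 hg].
have up (n : nat) j : d j + g * n%:R <= d (j + n%:Z).
  elim: n => [|n ih]; first by rewrite mulr0 !addr0.
  by have := hg (j + n%:Z); rewrite -addrA -PoszD addn1 -natr1 mulrDr; lra.
have [n hn] : exists n : nat, (`|t| + `|d 0|) / g < n%:R.
  by exists (Num.bound ((`|t| + `|d 0|) / g)); apply: archi_boundP; rewrite divr_ge0// ltW.
rewrite ltr_pdivrMr// in hn.
pose P := [pred k : nat | t < d (- n%:Z + k%:Z)].
have exP : exists k, P k.
  exists (n + n)%N; rewrite /= PoszD addrA addNr add0r.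
  by have := up n 0; rewrite add0r; have := ler_norm t; have := ler_norm (- d 0); rewrite normrN; lra.
case: (ex_minnP exP) => -[|k] /= hk kmin.
  have := up n (- n%:Z); rewrite addNr; move: hk; rewrite addr0.
  have := ler_norm (- t); have := ler_norm (d 0); rewrite normrN; lra.
have dk : d (- n%:Z + k%:Z) <= t.
  by rewrite leNgt; apply/negP => /kmin; rewrite ltnn.
have [->|ne] := eqVneq t (d (- n%:Z + k%:Z)); first by left; exists (- n%:Z + k%:Z).
right; exists (- n%:Z + k%:Z); rewrite lt_neqAle eq_sym ne dk /=.
by rewrite -addrA -PoszD addn1.
Qed.

(** Off the disperse set, uniform continuity on the complementary intervals gives
    continuity. *)
Lemma BPUC_on_reg d q : disperse d -> BPUC_on d q -> reg q.
Proof.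
move=> dd [/bounded_funP bq rq uq]; split=> //.
exists (range d); split; first exact: sub_countable (card_image_le _ _) _.
move=> t nt; have [[j tj]|[j /andP[jt tj]]] := disperse_cover t dd.
  by case: nt; exists j.
apply/cvgrPdist_le => e e0; have [dl dl0 hdl] := uq e e0.
pose r := Num.min dl (Num.min (t - d j) (d (j + 1) - t)).
have r0 : 0 < r by rewrite !lt_min dl0; lra.
exists r => // u /=; rewrite /r !lt_min => /andP[h1]; rewrite !ltr_norml => h2.
by rewrite ltW//; apply: (hdl j); lra.
Qed.

Lemma BPUC_reg p : BPUC p -> reg p.
Proof.
move=> [n [qs [hq hp]]].
have -> : p = fun t => \sum_(i < n) qs i t by exact/funext.
have hr i : reg (qs i) by have [d dd hd] := hq i; exact: BPUC_on_reg hd.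
elim: (index_enum _) => [|i s ih].
  by under eq_fun do rewrite big_nil; exact: reg_cst.
by under eq_fun do rewrite big_cons; exact: regD.
Qed.

Lemma reg_step g M (D : set R) : (forall t, `|g t| <= M) -> countable D ->
  (forall t, \forall u \near t^'+, g u = g t) ->
  (forall t, ~ D t -> \forall u \near t^'-, g u = g t) -> reg g.
Proof.
move=> hM cD hr hl; split; first by exists M.
  move=> t; have h : (fun=> g t) u @[u --> t^'+] --> g t by exact: cvg_cst.
  by apply: cvg_trans h; apply: near_eq_cvg; apply: filterS (hr t).
exists D; split=> // t nt; apply: leftc_rightc_continuous.
  have h : (fun=> g t) u @[u --> t^'-] --> g t by exact: cvg_cst.
  by apply: cvg_trans h; apply: near_eq_cvg; apply: filterS (hl t nt).
have h : (fun=> g t) u @[u --> t^'+] --> g t by exact: cvg_cst.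
by apply: cvg_trans h; apply: near_eq_cvg; apply: filterS (hr t).
Qed.

Lemma limits_tail Gam gm gp e : Gam t @[t --> -oo] --> gm -> Gam t @[t --> +oo] --> gp ->
  0 < e -> exists2 A, 0 < A & forall t, (t <= - A -> `|Gam t - gm| <= e) /\
    (A <= t -> `|Gam t - gp| <= e).
Proof.
move=> /cvgrPdist_le hm /cvgrPdist_le hp e0.
have [A1 [_ h1]] := hm _ e0; have [A2 [_ h2]] := hp _ e0.
exists (`|A1| + `|A2| + 1); first by have := normr_ge0 A1; have := normr_ge0 A2; lra.
move=> t; split=> ht; rewrite distrC.
  apply: h1; have := ler_norm (- A1); rewrite normrN; have := normr_ge0 A2; lra.
by apply: h2; have := ler_norm A2; have := normr_ge0 A1; lra.
Qed.

Lemma limits_bounded Gam gm gp : continuous Gam -> Gam t @[t --> -oo] --> gm ->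
  Gam t @[t --> +oo] --> gp ->
  exists M, [/\ 0 <= M, forall t, `|Gam t| <= M, `|gm| <= M & `|gp| <= M].
Proof.
move=> cG hm hp; have [A A0 hA] := limits_tail hm hp ltr01.
have [|||B B0 hB] := @bounded_segment _ Gam (- A) A; first lra.
- by move=> u _; apply: leftc_cont; exact: cG.
- by move=> u _; apply: cvg_at_right_filter; exact: cG.
exists (B + `|gm| + `|gp| + 1); have g1 := normr_ge0 gm; have g2 := normr_ge0 gp.
split=> [|t| |]; [lra| |lra|lra].
have [tA|At] := leP t (- A).
  by have := ler_normD (Gam t - gm) gm; rewrite subrK; have := (hA t).1 tA; lra.
have [tA|tA] := leP A t.
  by have := ler_normD (Gam t - gp) gp; rewrite subrK; have := (hA t).2 tA; lra.
by have := hB t; rewrite ltW// ltW// => /(_ isT); lra.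
Qed.

Lemma unif_cont_segment Gam (a b : R) e : a <= b -> continuous Gam -> 0 < e ->
  exists2 dl, 0 < dl & forall s t, a <= s <= b -> a <= t <= b -> `|s - t| <= dl ->
    `|Gam s - Gam t| <= e.
Proof.
move=> ab cG e0.
pose P v := exists2 dl, 0 < dl & forall s t, a <= s <= v -> a <= t <= v ->
  `|s - t| <= dl -> `|Gam s - Gam t| <= e.
have step u (d : R) z v : (forall w, `|u - w| < d -> `|Gam u - Gam w| <= e / 2) -> 0 < d ->
    u - d / 2 <= z -> v < u + d -> P z -> P v.
  move=> hd d0 uz vd [dl dl0 hdl]; exists (Num.min dl (d / 4)).
    by rewrite lt_min dl0; lra.
  move=> s t sv tv; rewrite le_min => /andP[st]; rewrite ler_norml => st'.
  have near : z < s \/ z < t -> `|Gam s - Gam t| <= e.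
    move=> zst; have hs := hd s; have ht := hd t; move: hs ht; rewrite !ltr_norml.
    have -> : - d < u - s < d by case: zst => ?; lra.
    have -> : - d < u - t < d by case: zst => ?; lra.
    by move=> /(_ isT) + /(_ isT); rewrite !ler_norml; lra.
  have [sz|zs] := leP s z; last by apply: near; left.
  have [tz|zt] := leP t z; last by apply: near; right.
  by apply: hdl => //; lra.
have e2 : 0 < e / 2 by lra.
have h := @real_induction _ P a b ab; apply: (h _ _ _ b); last by lra.
- exists 1 => // s t; rewrite -!eq_le => /eqP <- /eqP <- _.
  by rewrite subrr normr0 ltW.
- move=> u sut Pu; have /cvgrPdist_le/(_ _ e2)[d /= d0 hd] := cG u.
  apply/near_rightP; exists d => // v uv; apply: (step u d u v) => //; lra.
- move=> u sut Pu; have /cvgrPdist_le/(_ _ e2)[d /= d0 hd] := cG u.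
  pose z := Num.max a (u - d / 2).
  have zu : z < u by rewrite gt_max; lra.
  have uz : u - d / 2 <= z by rewrite le_max lexx orbT.
  by apply: (step u d z u) => //; [lra|apply: Pu; rewrite zu le_max lexx].
Qed.

Lemma limits_unif_cont Gam gm gp e : continuous Gam -> Gam t @[t --> -oo] --> gm ->
  Gam t @[t --> +oo] --> gp -> 0 < e ->
  exists2 dl, 0 < dl & forall s t, `|s - t| <= dl -> `|Gam s - Gam t| <= e.
Proof.
move=> cG hm hp e0; have e2 : 0 < e / 2 by lra.
have [A A0 hA] := limits_tail hm hp e2.
have [|dl dl0 hdl] := @unif_cont_segment Gam (- A - 1) (A + 1) e _ cG e0; first lra.
exists (Num.min dl 1); first by rewrite lt_min dl0 ltr01.
move=> s t; rewrite le_min => /andP[st]; rewrite ler_norml => st1.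
have [sA|As] := leP s (- A - 1).
  have h1 := (hA s).1 ltac:(lra); have h2 := (hA t).1 ltac:(lra).
  by move: h1 h2; rewrite !ler_norml; lra.
have [tA|At] := leP t (- A - 1).
  have h1 := (hA s).1 ltac:(lra); have h2 := (hA t).1 ltac:(lra).
  by move: h1 h2; rewrite !ler_norml; lra.
have [sA|sA] := leP (A + 1) s.
  have h1 := (hA s).2 ltac:(lra); have h2 := (hA t).2 ltac:(lra).
  by move: h1 h2; rewrite !ler_norml; lra.
have [tA|tA] := leP (A + 1) t.
  have h1 := (hA s).2 ltac:(lra); have h2 := (hA t).2 ltac:(lra).
  by move: h1 h2; rewrite !ler_norml; lra.
by apply: hdl => //; lra.
Qed.

Definition sampled h t := if h == 0 then t else (Num.floor (t / h))%:~R * h.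

Lemma transition_fin Gam gm gp c h t :
  transition Gam gm gp c%:E h t = Gam (c * sampled h t).
Proof. by rewrite /transition /sampled; case: eqP => // _; rewrite mulrA. Qed.

Lemma sampled_bounds h t : 0 <= h -> sampled h t <= t <= sampled h t + h.
Proof.
move=> h0; rewrite /sampled; have [->|hn] := eqVneq h 0; first by rewrite addr0 lexx.
have hp : 0 < h by rewrite lt_neqAle eq_sym hn.
have := floor_itv (t / h); rewrite ler_pdivlMr// intrD => /andP[-> h2] /=.
by move: h2; rewrite ltr_pdivrMr// => /ltW; lra.
Qed.

Lemma sampled_nat h t : 0 < h -> sampled h t = (Num.floor (t / h))%:~R * h.
Proof. by move=> h0; rewrite /sampled gt_eqF. Qed.

Lemma sampled_neg h t : 0 < h -> t < 0 -> sampled h t <= - h.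
Proof.
move=> h0 t0; rewrite sampled_nat// -mulN1r ler_pM2r//.
have := floor_itv (t / h); move=> /andP[h1 _].
have : (Num.floor (t / h))%:~R < (0 : R) by apply: le_lt_trans h1 _; rewrite pmulr_llt0// invr_gt0.
by rewrite ltrz0 => h2; rewrite -[-1]/((-1)%:~R) ler_int -ltzD1 addNr.
Qed.

Lemma sampled_zero h t : 0 < h -> 0 <= t -> t < h -> sampled h t = 0.
Proof.
move=> h0 t0 th; rewrite sampled_nat// (_ : Num.floor (t / h) = 0) ?mul0r//.
by apply: floor_def; rewrite add0r divr_ge0 ?(ltW h0)//= ltr_pdivrMr// mul1r.
Qed.

Lemma sampled_pos h t : 0 < h -> h <= t -> h <= sampled h t.
Proof.
move=> h0 ht; rewrite sampled_nat// -[leLHS]mul1r ler_pM2r//.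
have := floor_itv (t / h); move=> /andP[_ h2].
rewrite -[1]/(1%:~R) ler_int -ltzD1 -(ltr_int R); apply: le_lt_trans h2.
by rewrite ler_pdivlMr// mul1r.
Qed.

Lemma transition_reg Gam gm gp M (c : \bar R) h : continuous Gam ->
  (forall t, `|Gam t| <= M) -> `|gm| <= M -> `|gp| <= M -> 0 <= h ->
  reg (transition Gam gm gp c h) /\ forall t, `|transition Gam gm gp c h t| <= M.
Proof.
move=> cG hG hm hp h0.
have bnd t : `|transition Gam gm gp c h t| <= M.
  by rewrite /transition; case: c => [c||]; repeat case: ifP => _.
split=> //; have inf (g1 g2 : R) : (`|g1| <= M) -> `|g2| <= M ->
    reg (fun t => if t < 0 then g1 else if t < h then Gam 0 else g2).
  move=> b1 b2; apply: (@reg_step _ M (([set 0] : set R) `|` [set h])).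
  - by move=> t; repeat case: ifP => _.
  - by apply: countable_setU; exact: countable1.
  - move=> t; have [t0|t0] := ltP t 0.
      near=> u; have -> // : u < 0 by near: u; exact: nbhs_right_lt.
    have [th|ht] := ltP t h.
      near=> u; have tu : t < u by near: u; exact: nbhs_right_gt.
      by rewrite ltNge (le_trans t0 (ltW tu))/= ifT//; near: u; exact: nbhs_right_lt.
    near=> u; have tu : t < u by near: u; exact: nbhs_right_gt.
    by rewrite !ltNge (le_trans t0 (ltW tu))/= (le_trans ht (ltW tu)).
  - move=> t /not_orP[/= /eqP t0 /eqP th].
    have [t0'|t0'] := ltP t 0.
      near=> u; have ut : u < t by near: u; exact: nbhs_left_lt.
      by rewrite (lt_trans ut t0').
    have {t0'} t0' : 0 < t by rewrite lt_neqAle eq_sym t0.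
    have [th'|th'] := ltP t h.
      near=> u; have ut : u < t by near: u; exact: nbhs_left_lt.
      by rewrite (lt_trans ut th') ifN// -leNgt; near: u; exact: nbhs_left_ge.
    have {th'} th' : h < t by rewrite lt_neqAle eq_sym th.
    near=> u; rewrite !ifN// -leNgt; near: u; exact: nbhs_left_ge.
case: c bnd => [c||] bnd; [|exact: inf|exact: inf].
have [eh|hn] := eqVneq h 0.
  apply: (@reg_cont _ _ M) => //.
  have -> : transition Gam gm gp c%:E h = fun t => Gam (c * t).
    by apply/funext => t; rewrite transition_fin /sampled eh eqxx.
  move=> t.
  apply: (@continuous_comp _ _ _ (fun u => c * u) Gam); last exact: cG.
  by apply: cvgM; [exact: cvg_cst|exact: cvg_id].
have hp0 : 0 < h by rewrite lt_neqAle eq_sym hn.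
have same t u : (Num.floor (t / h))%:~R * h <= u -> u < ((Num.floor (t / h) + 1)%:~R) * h ->
    transition Gam gm gp c%:E h u = transition Gam gm gp c%:E h t.
  move=> h1 h2; rewrite !transition_fin !sampled_nat// (_ : Num.floor (u / h) = Num.floor (t / h))//.
  by apply: floor_def; rewrite ler_pdivlMr// h1 ltr_pdivrMr.
apply: (@reg_step _ M (range (fun j : int => j%:~R * h))) => //.
- exact: sub_countable (card_image_le _ _) _.
- move=> t; have := floor_itv (t / h); rewrite ler_pdivlMr// ltr_pdivrMr// => /andP[h1 h2].
  near=> u; apply: same.
    by apply: le_trans h1 _; near: u; exact: nbhs_right_ge.
  by near: u; exact: nbhs_right_lt.
- move=> t nt; have := floor_itv (t / h); rewrite ler_pdivlMr// ltr_pdivrMr// => /andP[h1 h2].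
  have {}h1 : (Num.floor (t / h))%:~R * h < t.
    rewrite lt_neqAle h1 andbT; apply/eqP => e; apply: nt.
    by exists (Num.floor (t / h)).
  near=> u; apply: same; first by near: u; exact: nbhs_left_ge.
  by apply: lt_trans h2; near: u; exact: nbhs_left_lt.
Unshelve. all: by end_near. Qed.

(** For large [c] the argument [c * sampled h t] is far out as soon as [t] leaves
    the interval from [- eta] to [eta]; when [h > 0] the two functions agree on
    [0, h). *)
Lemma transition_close_infty Gam gm gp h e eta : Gam t @[t --> -oo] --> gm ->
  Gam t @[t --> +oo] --> gp -> 0 <= h -> 0 < e -> 0 < eta ->
  exists2 C, 0 <= C & forall c, C < c -> forall t, t < - eta \/ eta <= t ->
    `|transition Gam gm gp +oo%E h t - transition Gam gm gp c%:E h t| <= e.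
Proof.
move=> hm hp h0 e0 eta0; have [A A0 hA] := limits_tail hm hp e0.
have [eh|hn] := eqVneq h 0.
  exists (A / eta) => [|c Cc t]; first by rewrite divr_ge0// ltW.
  have Ac : A < c * eta by rewrite -ltr_pdivrMr.
  have c0 : 0 < c by apply: le_lt_trans Cc; rewrite divr_ge0// ltW.
  rewrite transition_fin /transition /sampled eh eqxx distrC => -[tn|tp].
    have t0 : t < 0 by lra.
    rewrite t0; apply: (hA _).1; have : c * t <= c * - eta by rewrite ler_pM2l// ltW.
    by rewrite mulrN; lra.
  have t0 : (t < 0) = false by apply/negbTE; rewrite -leNgt; lra.
  rewrite t0; apply: (hA _).2; have : c * eta <= c * t by rewrite ler_pM2l.
  by lra.
have hp0 : 0 < h by rewrite lt_neqAle eq_sym hn.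
exists (A / h) => [|c Cc t _]; first by rewrite divr_ge0// ltW.
have Ac : A < c * h by rewrite -ltr_pdivrMr.
have c0 : 0 < c by apply: le_lt_trans Cc; rewrite divr_ge0// ltW.
rewrite transition_fin /transition distrC; case: (ltP t 0) => t0.
  apply: (hA _).1; have : c * sampled h t <= c * - h by rewrite ler_pM2l// sampled_neg.
  by rewrite mulrN; lra.
case: (ltP t h) => th.
  by rewrite sampled_zero// mulr0 subrr normr0 ltW.
apply: (hA _).2; have : c * h <= c * sampled h t by rewrite ler_pM2l// sampled_pos.
by lra.
Qed.

Lemma transition_slow Gam gm gp h e : continuous Gam -> Gam t @[t --> -oo] --> gm ->
  Gam t @[t --> +oo] --> gp -> 0 <= h -> 0 < e ->
  exists2 c0, 0 < c0 & forall c, - c0 < c < c0 -> forall s t, s <= t <= s + 1 ->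
    `|transition Gam gm gp c%:E h t - transition Gam gm gp c%:E h s| <= e.
Proof.
move=> cG hm hp h0 e0; have [dl dl0 hdl] := limits_unif_cont cG hm hp e0.
have h1 : 0 < 1 + h by lra.
exists (dl / (1 + h)); first exact: divr_gt0.
move=> c hc s t st; rewrite !transition_fin; apply: hdl.
rewrite -mulrBr normrM.
have hs : `|sampled h t - sampled h s| <= 1 + h.
  by have := sampled_bounds s h0; have := sampled_bounds t h0; rewrite ler_norml; lra.
have c1 : `|c| <= dl / (1 + h) by rewrite ler_norml; lra.
by rewrite -[dl](@divfK _ (1 + h)) ?gt_eqF//; apply: ler_pM.
Qed.

End Coefficients.

(** * Slow transitions and jumps *)

Section Transitions.
Context {R : realType}.
Implicit Types (G p a r b y x al Gam : R -> R) (s t u c d e m M N K T B l h : R).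

Lemma coefQ0 : coefQ (cst (0 : R)) = cst 0.
Proof. by apply/funext => t; rewrite /coefQ /= mulr0. Qed.

Lemma coefP0 p : coefP (cst (0 : R)) p = p.
Proof. by apply/funext => t; rewrite /coefP /= expr0n/= subr0. Qed.

Lemma reg0 : reg (cst (0 : R)). Proof. exact: reg_cst. Qed.

Lemma field0 p t (y : R) : field (cst 0) p t y = - y ^+ 2 + p t.
Proof. by rewrite /field /= subr0. Qed.

Lemma rhs0 p t (y : R) : rhs (cst 0) p t y = field (cst 0) p t y.
Proof. by rewrite field0 /rhs /= mul0r addr0. Qed.

Lemma rder_shift x c t l : rder x (t + c) l -> rder (fun u => x (u + c)) t l.
Proof.
move=> /rder_expand h; apply/rder_expand => e /h /near_rightP[d d0 hd].
apply/near_rightP; exists d => // u tu.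
by have := hd (u + c); rewrite (_ : u + c - (t + c) = u - t); [apply; lra|ring].
Qed.

(** A slowly varying shift can be replaced by its moving average, whose
    derivative is small; added to the middle of the pair it gives a strict
    lower solution. *)
Lemma slow_shift_AR p a r : reg p -> attractor_repeller_pair (cst 0) p a r ->
  exists2 e, 0 < e & forall G, reg G ->
    (forall s t, s <= t <= s + 1 -> `|G t - G s| <= e) ->
    exists a' r', attractor_repeller_pair (coefQ G) (coefP G p) a' r'.
Proof.
move=> rp; rewrite -{1}coefQ0 -{1}(coefP0 p).
move=> /(pair_separated reg0 rp)[sa sr [B hB] [d d0 hd]].
pose k : R := 1 / 2 * (1 - 1 / 2).
have k0 : 0 < k by rewrite /k; lra.
have d2 : 0 < k * d ^+ 2 by apply: mulr_gt0 => //; exact: exprn_gt0.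
have B0 : 0 <= B := le_trans (normr_ge0 _) (hB 0).1.
pose e := Num.min 1 (k * d ^+ 2 / (4 * (B + 1))).
have e0 : 0 < e by rewrite lt_min ltr01 divr_gt0//; lra.
have e1 : e <= 1 by rewrite ge_min lexx.
have eB : e * (4 * (B + 1)) <= k * d ^+ 2.
  by rewrite -ler_pdivlMr; [rewrite ge_min lexx orbT|lra].
exists e => // G rG hG.
pose mid t := r t + 1 / 2 * (a t - r t).
pose avg t := prim G (t + 1) - prim G t.
have midB t : `|mid t| <= B by have [] := hB t; rewrite /mid !ler_norml; lra.
have avgG t : `|avg t - G t| <= e.
  have := @Rintegral_near _ G t (t + 1) (G t) e rG; rewrite [t + 1 - t]addrC addKr !mulr1.
  by apply; [lra|move=> u tu; exact: hG].
have [M M0 hM] := reg_bound rG.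
have lal : strict_lower G p (k * d ^+ 2 / 2) (fun t => avg t + mid t).
  split.
  - exists (M + e + B) => t; have := midB t; have := avgG t; have := hM t.
    by rewrite !ler_norml; lra.
  - move=> t; apply: leftc_lusc; apply: leftcN; apply: leftcD.
      apply: leftcB.
        apply: (leftc_comp (phi := prim G) (x := fun u => u + 1)).
          exact: prim_continuous.
        by apply: leftcD; [exact: leftc_id|exact: leftc_cst].
      by apply: leftc_cont; exact: prim_continuous.
    apply: leftcD; first exact: (sr t).1.
    apply: leftcM; first exact: leftc_cst.
    by apply: leftcB; [exact: (sa t).1|exact: (sr t).1].
  - move=> t; eexists.
      apply: rderD; last exact: rder_convex (sa t).2 (sr t).2.
      by apply: rderB; [apply: rder_shift; exact: rder_prim|exact: rder_prim].
    rewrite field0 /field -/k -/(mid t).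
    have h1 := hG t (t + 1) ltac:(lra).
    have h2 : k * d ^+ 2 <= k * (a t - r t) ^+ 2.
      by rewrite ler_pM2l// ler_pXn2r// ?nnegrE; have := hd t; lra.
    have h3 : (avg t + mid t - G t) ^+ 2 <= mid t ^+ 2 + e * (2 * B + 1).
      have h4 : `|(avg t - G t) * (avg t - G t + 2 * mid t)| <= e * (2 * B + 1).
        rewrite normrM; apply: ler_pM => //.
        by have := avgG t; have := midB t; rewrite !ler_norml; lra.
      have -> : (avg t + mid t - G t) ^+ 2 =
        mid t ^+ 2 + (avg t - G t) * (avg t - G t + 2 * mid t) by ring.
      by rewrite lerD2l; exact: le_trans (ler_norm _) h4.
    by move: h1 eB; rewrite ler_norml => /andP[_ h1]; lra.
have m2 : 0 < k * d ^+ 2 / 2 by lra.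
by have [a' [r' [h _]]] := lower_AR rG rp m2 lal; exists a', r'.
Qed.

Lemma AR_case_A G p a r : reg G -> reg p ->
  attractor_repeller_pair (coefQ G) (coefP G p) a r ->
  case_A (coefQ G) (coefP G p).
Proof.
move=> rG rp h; have [_ _ _ [d d0 hd]] := pair_separated rG rp h.
have [[ba br] _ att rep] := h; exists a, r; split.
- by split=> //; left.
- by split=> //; right.
- by move=> e; have := hd 0; rewrite e; lra.
Qed.

Lemma AR_not_case_C G p a r : attractor_repeller_pair (coefQ G) (coefP G p) a r ->
  ~ case_C (coefQ G) (coefP G p).
Proof. by move=> [[ba _] _ _ _]; apply; exists a. Qed.

Lemma isol_psol p (I : set R) x s t : is_interval I -> I s -> I t ->
  isol (cst 0) p I x -> psol (cst 0) p s t x.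
Proof.
move=> iI Is It sx.
have Iw w : s <= w <= t -> I w by exact: iI.
split=> w hw.
  by apply: (sx w _).2 Is _; [apply: Iw; lra|lra].
by rewrite -rhs0; apply: (sx w _).1 It _; [apply: Iw; lra|lra].
Qed.

Lemma isol_uniq p (I J : set R) x y s t : is_interval I -> is_interval J ->
  isol (cst 0) p I x -> isol (cst 0) p J y -> I s -> J s -> x s = y s ->
  I t -> J t -> x t = y t.
Proof.
move=> iI iJ sx sy Is Js e It Jt; have [st|/ltW ts] := leP s t.
  have px := isol_psol iI Is It sx; have py := isol_psol iJ Js Jt sy.
  by apply/le_anti/andP; split; apply: (psol_le (p := p) reg0 st) => //; rewrite e.
have px := isol_psol iI It Is sx; have py := isol_psol iJ Jt Js sy.
apply/le_anti; rewrite !leNgt; apply/andP; split; apply/negP => h.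
  by have := psol_lt reg0 ts py px h; rewrite e ltxx.
by have := psol_lt reg0 ts px py h; rewrite e ltxx.
Qed.

(** The maximal solution is the union of all solutions on intervals. *)
Lemma flow_value_of_isol p (J : set R) y s t : reg p -> is_interval J -> J s -> J t ->
  isol (cst 0) p J y -> flow_value (cst 0) p s (y s) t (y t).
Proof.
move=> rp iJ Js Jt sy.
pose part (u z : R) := exists (K : set R) (w : R -> R), [/\ is_interval K, K s, K u, isol (cst 0) p K w &
  w s = y s /\ w u = z].
pose I := [set u | exists z, part u z].
pose X u := xget 0 (part u).
have XE (K : set R) (w : R -> R) u : is_interval K -> K s -> K u -> isol (cst 0) p K w -> w s = y s ->
    X u = w u.
  move=> iK Ks Ku sw e; have : part u (X u).
    by apply: xgetPex; exists (w u), K, w.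
  move=> [K' [w' [iK' Ks' Ku' sw' [e' <-]]]].
  by apply: (isol_uniq iK' iK sw' sw Ks' Ks) => //; rewrite e' e.
have IE (K : set R) (w : R -> R) u : is_interval K -> K s -> K u -> isol (cst 0) p K w -> w s = y s -> I u.
  by move=> iK Ks Ku sw e; exists (w u), K, w.
have iI : is_interval I.
  move=> u v [zu [Ku [wu [iKu Kus Kuu swu [eu _]]]]] [zv [Kv [wv [iKv Kvs Kvv swv [ev _]]]]].
  move=> w uwv; have [ws|sw] := leP w s.
    by apply: (IE Ku wu w) => //; apply: (iKu u s) => //; lra.
  by apply: (IE Kv wv w) => //; apply: (iKv s v) => //; lra.
have Is : I s by apply: (IE J y).
have It : I t by apply: (IE J y).
have Xs : X s = y s by apply: (XE J y).
have sX : isol (cst 0) p I X.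
  move=> u [_ [K [w [iK Ks Ku sw [e _]]]]]; split.
    move=> v [_ [K' [w' [iK' Ks' Kv' sw' [e' _]]]]] uv.
    have main (H : set R) (f : R -> R) v' : is_interval H -> H s -> H u -> H v' -> u < v' ->
        isol (cst 0) p H f -> f s = y s -> rder X u (rhs (cst 0) p u (X u)).
      move=> iH Hs Hu Hv uv' sf ef; rewrite (XE H f u)//.
      apply: (@rder_near _ f); last exact: (sf u Hu).1 Hv uv'.
        near=> z; rewrite (XE H f z)//; apply: (iH u v') => //; apply/andP; split.
          by near: z; exact: nbhs_right_ge.
        by near: z; exact: nbhs_right_le.
      by rewrite (XE H f u).
    have [us|su] := ltP u s; first exact: (main K w s).
    apply: (main K' w' v) => //; apply: (iK' s v) => //; lra.
  move=> v [_ [K' [w' [iK' Ks' Kv' sw' [e' _]]]]] vu.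
  have main (H : set R) (f : R -> R) v' : is_interval H -> H s -> H u -> H v' -> v' < u ->
      isol (cst 0) p H f -> f s = y s -> leftc X u.
    move=> iH Hs Hu Hv vu' sf ef.
    apply: (@leftc_eq _ f); last exact: (sf u Hu).2 Hv vu'.
      near=> z; rewrite (XE H f z)//; apply: (iH v' u) => //; apply/andP; split.
        by near: z; exact: nbhs_left_ge.
      by near: z; exact: nbhs_left_le.
    by rewrite (XE H f u).
  have [us|su] := leP u s; last exact: (main K w s).
  apply: (main K' w' v) => //; apply: (iK' v s) => //; lra.
exists I, X; split=> //; last exact: (XE J y).
split=> //; first exact: (isol_solution reg0 rp iI sX).
move=> H f iH IH sf fX u Hu.
have sf' : isol (cst 0) p H f by exact: (solution_isol reg0 rp iH sf).
by apply: (IE H f) => //; [exact: IH|rewrite fX].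
Unshelve. all: by end_near. Qed.

Lemma flow_value_psol p s (x0 : R) t (z : R) : reg p -> flow_value (cst 0) p s x0 t z ->
  exists x, [/\ psol (cst 0) p s t x, x s = x0 & x t = z].
Proof.
move=> rp [I [x [[iI Is xs sx _] It xt]]]; exists x; split=> //.
exact: (isol_psol iI Is It (solution_isol reg0 rp iI sx)).
Qed.

Lemma flow_value_uniq p s (x0 : R) t (z1 z2 : R) : reg p -> s <= t ->
  flow_value (cst 0) p s x0 t z1 -> flow_value (cst 0) p s x0 t z2 -> z1 = z2.
Proof.
move=> rp st /(flow_value_psol rp)[x1 [h1 e1 <-]] /(flow_value_psol rp)[x2 [h2 e2 <-]].
by apply/le_anti/andP; split; apply: (psol_le (p := p) reg0 st) => //; rewrite e1 e2.
Qed.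

(** A solution can only blow up to minus infinity in the future, so the
    solution starting above [v] lives as long as [v]. *)
Lemma flow_exists_above p (v : R -> R) (x0 : R) t : reg p -> 0 <= t ->
  psol (cst 0) p 0 t v -> v 0 <= x0 ->
  exists2 z, flow_value (cst 0) p 0 x0 t z & v t <= z.
Proof.
move=> rp t0 hv vx; have [Mp Mp0 hMp] := reg_bound rp.
have [Bv Bv0 hBv] := psol_bounded t0 hv.
have [N [MN bar BN]] := bar_exists (0 : R) Mp (Bv + `|x0|).
have h0 u : `|(cst 0 : R -> R) u| <= 0 by rewrite normr0.
have nx := normr_ge0 x0; have N0 : 0 <= N by lra.
have [y hy y0] := tsol_exists 0 x0 reg0 rp N0.
have NN : N <= `|N| by exact: ler_norm.
have vN u : 0 <= u <= t -> `|v u| <= N by move=> /hBv; lra.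
have yv u : 0 <= u <= t -> v u <= y u.
  move=> /andP[u0 ut]; rewrite -subr_ge0.
  apply: (@nonneg_of_rder _ (fun w => y w - v w) (2 * (N + 0)) 0 u) => //.
  - lra.
  - by rewrite y0 subr_ge0.
  - move=> w wu; apply: leftc_lusc; apply: leftcB; [exact: (hy w).1|].
    by apply: hv.1; lra.
  - move=> w wu; eexists; first by apply: rderB (hy w).2 (hv.2 w _); lra.
    have vw : `|v w| <= N by apply: vN; lra.
    have := tfield_lip p w (y w) (v w) N0 h0; rewrite (clip_id vw).
    by rewrite ler_norml => /andP[]; lra.
have yN u : 0 <= u <= t -> `|y u| <= N.
  move=> hu; have := yv u hu; have := vN u hu; rewrite !ler_norml => h1 h2.
  have x0N : y 0 <= N by rewrite y0; have := ler_norm x0; lra.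
  have u0 : 0 <= u by lra.
  by have := tsol_le_cst h0 hMp MN bar hy NN u0 x0N; lra.
exists (y t); last by apply: yv; lra.
rewrite -{1}y0; apply: (@flow_value_of_isol p [set u | 0 <= u <= t]) => //=; try lra.
  by move=> u w /= hu hw z; lra.
move=> u /= hu; split=> w /= hw uw; last exact: (hy u).1.
by rewrite rhs0 -(clip_id (yN u hu)); exact: (hy u).2.
Qed.

(** The transition function at infinite rate depends on three values only. *)
Definition jump gm (g0 : R) gp h : R -> R :=
  fun t => if t < 0 then gm else if t < h then g0 else gp.

Lemma jump_neg gm g0 gp h t : t < 0 -> jump gm g0 gp h t = gm.
Proof. by rewrite /jump => ->. Qed.

Lemma jump_mid gm g0 gp h t : 0 <= t -> t < h -> jump gm g0 gp h t = g0.
Proof. by move=> t0 th; rewrite /jump ltNge t0/= th. Qed.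

Lemma jump_pos gm g0 gp h t : 0 <= h -> h <= t -> jump gm g0 gp h t = gp.
Proof. by move=> h0 ht; rewrite /jump !ltNge (le_trans h0 ht)/= ht. Qed.

Section Jump.
Variables (p a r : R -> R) (gm g0 gp h : R).
Hypotheses (rp : reg p) (ar : attractor_repeller_pair (cst 0) p a r) (h0 : 0 <= h).
Let G := jump gm g0 gp h.
Hypothesis rG : reg G.

Let base : [/\ gsol (cst 0) p a, gsol (cst 0) p r,
  exists B, forall t, `|a t| <= B /\ `|r t| <= B &
  exists2 d, 0 < d & forall t, r t + d <= a t].
Proof. by apply: pair_separated reg0 rp _; rewrite coefQ0 coefP0. Qed.

Lemma field_jump g t (y : R) : G t = g -> field G p t y = field (cst 0) p t (y - g).
Proof. by move=> e; rewrite field0 /field e. Qed.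

(** Translated by the current level of the shift, a bounded solution is in turn
    below the attractor, a solution on [0, h], and above the repeller. *)
Lemma jump_bounded b : gsol G p b -> [/\ b 0 - gm <= a 0,
  psol (cst 0) p 0 h (fun t => b t - g0) & r h <= b h - gp].
Proof.
move=> sb; have [sa sr _ [d d0 hd]] := base; have h0' := h0.
have lb g t : leftc (fun t => b t - g) t.
  by apply: leftcB; [exact: (sb t).1|exact: leftc_cst].
have rb g t : G t = g -> rder (fun t => b t - g) t (field (cst 0) p t (b t - g)).
  move=> e; rewrite -(field_jump _ e) -[X in rder _ _ X]subr0.
  by apply: rderB; [exact: (sb t).2|exact: rder_cst].
split.
- apply: (@past_solution_le _ (cst 0) p a r d reg0 sa sr d0 hd (fun t => b t - gm)).
  move=> s s0; split=> w hw //; apply: rb; apply: jump_neg; lra.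
- by split=> w hw //; apply: rb; apply: jump_mid; lra.
- apply: (@future_solution_ge _ (cst 0) p a r d reg0 sa sr d0 hd (fun t => b t - gp)).
  by move=> s s0; split=> w hw //; apply: rb; apply: jump_pos; lra.
Qed.

(** A bounded solution passes from below the attractor of the first piece to above
    the repeller of the third one. The solution that starts at the attractor is
    above it on [0, h], hence exists there and ends above the repeller. *)
Lemma jump_no_bounded :
  ~ (exists z, flow_value (cst 0) p 0 (a 0 + gm - g0) h z) \/
  (exists2 z, flow_value (cst 0) p 0 (a 0 + gm - g0) h z & z < r h + gp - g0) ->
  ~ has_bounded G p.
Proof.
move=> hyp [b [/jump_bounded[b1 b2 b3] _]].
have b0 : b 0 - g0 <= a 0 + gm - g0 by lra.
have [z hz bz] := flow_exists_above rp h0 b2 b0.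
case: hyp => [nz|[z' hz' z'r]]; first by apply: nz; exists z.
by have := flow_value_uniq rp h0 hz hz' => e; lra.
Qed.

Lemma lusc_opp_of_leftc (f al : R -> R) t : leftc f t -> al t <= f t ->
  (\forall u \near t^'-, al u = f u) -> lusc (fun u => - al u) t.
Proof.
move=> /leftcN/leftc_lusc lf aft hn e /lf; apply: filterS2 hn => u ->; lra.
Qed.

(** The strict lower solution follows a convex combination close to the
    attractor, then the given solution pushed down exponentially, then a convex
    combination close to the repeller; the strict inequality at [h] leaves room
    for its two downward jumps. *)
Lemma jump_AR x : psol (cst 0) p 0 h x -> x 0 = a 0 + gm - g0 ->
  r h + gp - g0 < x h ->
  exists a' r', attractor_repeller_pair (coefQ G) (coefP G p) a' r'.
Proof.
move=> hx x0 xh; have [sa sr [B hB] [d d0 hd]] := base; have h0' := h0.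
have [X X0 hX] := psol_bounded h0 hx.
(* The rate [K] outweighs the derivative of the field along [x], so that pushing
   [x] down by [e * eK t] creates a margin; [e] and [k] are small enough for the
   two jumps to fit into [gap]. *)
pose K := 2 * X + 2; pose gap := x h - (r h + gp - g0).
have gap0 : 0 < gap by rewrite /gap; lra.
pose eK t := expR (K * (t - 0)).
have eK0 t : 0 < eK t by exact: expR_gt0.
have eK1 t : 0 <= t -> 1 <= eK t.
  move=> t0; rewrite -[leLHS]expR0 ler_expR mulr_ge0//; [rewrite /K; lra|lra].
have eKh t : t <= h -> eK t <= eK h.
  by move=> th; rewrite ler_expR ler_pM2l; [lra|rewrite /K; lra].
pose e := Num.min 1 (gap / 2) / eK h.
have e0 : 0 < e by rewrite divr_gt0// lt_min ltr01; lra.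
have eh : e * eK h = Num.min 1 (gap / 2) by rewrite divfK// gt_eqF.
have eh1 : e * eK h <= 1 by rewrite eh ge_min lexx.
have eh2 : e * eK h <= gap / 2 by rewrite eh ge_min lexx orbT.
have e1 t : t <= h -> e * eK t <= 1.
  by move=> th; apply: le_trans eh1; rewrite ler_pM2l// eKh.
have B0 : 0 <= B := le_trans (normr_ge0 _) (hB 0).1.
pose k := Num.min (1 / 2) (Num.min e (gap / 2) / (2 * B + 1)).
have q0 : 0 < Num.min e (gap / 2) by rewrite lt_min e0; lra.
have k0 : 0 < k.
  by rewrite lt_min; apply/andP; split; [lra|apply: divr_gt0 => //; lra].
have k2 : k <= 1 / 2 by rewrite ge_min lexx.
have kB : k * (2 * B + 1) <= Num.min e (gap / 2).
  by rewrite -ler_pdivlMr; [rewrite ge_min lexx orbT|lra].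
have kB1 : k * (2 * B + 1) <= e by apply: le_trans kB _; rewrite ge_min lexx.
have kB2 : k * (2 * B + 1) <= gap / 2 by apply: le_trans kB _; rewrite ge_min lexx orbT.
have kar t : 0 <= k * (a t - r t) <= k * (2 * B + 1).
  have ar0 : 0 <= a t - r t by have := hd t; lra.
  rewrite (mulr_ge0 (ltW k0) ar0) ler_pM2l//.
  by have [] := hB t; rewrite !ler_norml; lra.
pose A1 t := (r t + (1 - k) * (a t - r t)) + gm.
pose A2 t := (x t + - (e * eK t)) + g0.
pose A3 t := (r t + k * (a t - r t)) + gp.
pose al t := if t < 0 then A1 t else if t < h then A2 t else A3 t.
pose dd := (1 - k) * k * d ^+ 2.
have dd0 : 0 < dd by rewrite !mulr_gt0// ?exprn_gt0//; lra.
pose m := Num.min e dd; have m0 : 0 < m by rewrite lt_min e0.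
have me : m <= e by rewrite ge_min lexx.
have md : m <= dd by rewrite ge_min lexx orbT.
have alE1 t : t < 0 -> al t = A1 t by rewrite /al => ->.
have alE2 t : 0 <= t -> t < h -> al t = A2 t.
  by move=> t0 th; rewrite /al ltNge t0/= th.
have alE3 t : h <= t -> al t = A3 t.
  by move=> ht; rewrite /al !ltNge (le_trans h0 ht)/= ht.
have lconv k' g t : leftc (fun u => (r u + k' * (a u - r u)) + g) t.
  apply: leftcD; last exact: leftc_cst.
  apply: leftcD; first exact: (sr t).1.
  apply: leftcM; first exact: leftc_cst.
  by apply: leftcB; [exact: (sa t).1|exact: (sr t).1].
have j32 : A3 h <= A2 h.
  by rewrite /A3 /A2; have := kar h; rewrite /gap in eh2 kB2; lra.
have j21 : A2 0 <= A1 0.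
  have := kar 0; rewrite /A2 /A1 x0 /eK subrr mulr0 expR0 mulr1 mulrBl mul1r; lra.
have lal : strict_lower G p m al.
  split.
  - exists (B + X + 1 + `|gm| + `|g0| + `|gp|) => t.
    have n1 := normr_ge0 gm; have n2 := normr_ge0 g0; have n3 := normr_ge0 gp.
    have m1 := ler_norm gm; have m2 := ler_norm g0; have m3 := ler_norm gp.
    have m4 := ler_norm (- gm); have m5 := ler_norm (- g0); have m6 := ler_norm (- gp).
    rewrite !normrN in m4 m5 m6.
    have [] := hB t; rewrite !ler_norml => ha hr; have hk := kar t; have hdt := hd t.
    have [t0|t0] := ltP t 0; first by rewrite alE1// /A1 mulrBl mul1r; nra.
    have [th|ht] := ltP t h; last by rewrite alE3// /A3; nra.
    have := hX t; rewrite t0 ltW// => /(_ isT); rewrite ler_norml => hxt.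
    have := e1 t (ltW th); have : 0 < e * eK t by exact: mulr_gt0.
    by rewrite alE2// /A2; lra.
  - move=> t; have [t0|t0] := leP t 0.
      apply: (@lusc_opp_of_leftc A1); first exact: lconv.
        move: t0; rewrite le_eqVlt => /predU1P[->|t0]; last by rewrite alE1.
        have [hh|hh] := ltP 0 h; first by rewrite alE2.
        have eh0 : h = 0 by apply/le_anti; rewrite hh h0.
        by rewrite alE3// (le_trans _ j21)// -{1 2}eh0.
      near=> u; apply: alE1; apply: lt_le_trans t0; near: u; exact: nbhs_left_lt.
    have [th|ht] := leP t h.
      apply: (@lusc_opp_of_leftc A2).
      + apply: leftcD; last exact: leftc_cst.
        apply: leftcD; first by apply: hx.1; rewrite t0.
        apply: leftcN; apply: leftcM; first exact: leftc_cst.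
        exact: leftc_expZ.
      + move: th; rewrite le_eqVlt => /predU1P[->|th]; first by rewrite alE3.
        by rewrite alE2// ltW.
      + near=> u; apply: alE2; first by near: u; exact: nbhs_left_ge.
        by apply: lt_le_trans th; near: u; exact: nbhs_left_lt.
    apply: (@lusc_opp_of_leftc A3); [exact: lconv|by rewrite alE3// ltW|].
    by near=> u; apply: alE3; near: u; exact: nbhs_left_ge.
  - have conv k' g t : (1 - k') * k' = (1 - k) * k -> exists2 l,
        rder (fun u => (r u + k' * (a u - r u)) + g) t l &
        l <= field (cst 0) p t ((r t + k' * (a t - r t)) + g - g) - m.
      move=> ek; eexists.
        by apply: rderD; [exact: rder_convex (sa t).2 (sr t).2|exact: rder_cst].
      rewrite addr0 addrK lerD2l lerN2 [k' * _]mulrC ek; apply: le_trans md _.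
      rewrite /dd ler_wpM2l//; first by rewrite mulr_ge0//; lra.
      by rewrite ler_pXn2r// ?nnegrE; have := hd t; lra.
    move=> t; have [t0|t0] := ltP t 0.
      have [l hl lm] := conv (1 - k) gm t ltac:(ring); exists l.
        apply: (@rder_near _ A1) => //; last by rewrite alE1.
        by near=> u; rewrite alE1//; near: u; exact: nbhs_right_lt.
      have eG : G t = gm by exact: jump_neg.
      by rewrite alE1// (field_jump _ eG).
    have [th|ht] := ltP t h; last first.
      have [l hl lm] := conv k gp t ltac:(ring); exists l.
        apply: (@rder_near _ A3) => //; last by rewrite alE3.
        near=> u; rewrite alE3//; apply: le_trans ht _; near: u; exact: nbhs_right_ge.
      have eG : G t = gp by exact: jump_pos.
      by rewrite alE3// (field_jump _ eG).
    exists (field (cst 0) p t (x t) - e * (eK t * K)).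
      apply: (@rder_near _ A2); [|by rewrite alE2|].
        near=> u; apply/esym/alE2.
          by apply: le_trans t0 _; near: u; exact: nbhs_right_ge.
        by near: u; exact: nbhs_right_lt.
      rewrite -[X in rder _ _ X]addr0; apply: rderD; last exact: rder_cst.
      apply: rderB; first by apply: hx.2; rewrite t0.
      by apply: rderZ; exact: rder_expZ.
    have eG : G t = g0 by exact: jump_mid.
    rewrite alE2// (field_jump _ eG) /A2 addrK !field0.
    have := e1 t (ltW th); have : 0 < e * eK t by exact: mulr_gt0.
    have : e <= e * eK t by apply: ler_peMr; [exact: ltW|exact: eK1].
    have := hX t; rewrite t0 ltW// => /(_ isT); rewrite ler_norml.
    rewrite [e * (eK t * K)]mulrA; move: (e * eK t) => w hxt h1 h2 h3.
    rewrite /K; nra.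
by have [a' [r' [H _]]] := lower_AR rG rp m0 lal; exists a', r'.
Unshelve. all: by end_near. Qed.

End Jump.

End Transitions.

(** * Fast transitions and the gap at the bifurcation value *)

Section Assembly.
Context {R : realType}.
Implicit Types (G p a r b y x al Gam : R -> R) (s t u c d e m M N K T B l h gm gp : R).

Lemma bifurcation_value_uniq (Q P : R -> R) l1 l2 :
  is_bifurcation_value Q P l1 -> is_bifurcation_value Q P l2 -> l1 = l2.
Proof.
move=> h1 h2; apply/le_anti/andP.
by split; [apply/(h1 l2)/(h2 l2)|apply/(h2 l1)/(h1 l1)].
Qed.

Lemma lambda_starP (Q P : R -> R) l : is_bifurcation_value Q P l ->
  is_bifurcation_value Q P (lambda_star Q P).
Proof. by move=> h; apply: getPex; exists l. Qed.

Lemma pair_uniq (Q P : R -> R) a r a' r' : attractor_repeller_pair Q P a r ->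
  attractor_repeller_pair Q P a' r' -> forall t, a t = a' t /\ r t = r' t.
Proof.
move=> [[ba br] h _ _] [[ba' br'] h' _ _] t.
have [h1 h2] := h _ ba' t; have [h3 h4] := h' _ ba t.
have [h5 h6] := h _ br' t; have [h7 h8] := h' _ br t.
by split; apply/le_anti/andP.
Qed.

(** Both solutions of the pair at [l] are strict lower solutions at [l'], hence
    lie strictly inside the pair at [l']. *)
Lemma pair_gap_mono p l l' a r a' r' : reg p -> l < l' ->
  attractor_repeller_pair (cst 0) (fun t => p t + l) a r ->
  attractor_repeller_pair (cst 0) (fun t => p t + l') a' r' ->
  forall t, a t < a' t /\ r' t < r t.
Proof.
move=> rp ll ar ar' t.
have rl := reg_shift l rp; have rl' := reg_shift l' rp.
move: (ar); rewrite -{1}coefQ0 -{1}(coefP0 (fun t => p t + l)).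
move=> /(pair_separated reg0 rl)[sa sr [B hB] _].
have lpos : 0 < l' - l by rewrite subr_gt0.
have la := gsol_strict_lower ll sa (fun t => (hB t).1).
have lr := gsol_strict_lower ll sr (fun t => (hB t).2).
have [a1 [r1 [ar1 h1]]] := lower_AR reg0 rl' lpos la.
have [a2 [r2 [ar2 h2]]] := lower_AR reg0 rl' lpos lr.
rewrite coefQ0 coefP0 in ar1 ar2.
have [<- _] := pair_uniq ar1 ar' t; have [_ <-] := pair_uniq ar2 ar' t.
by have := h1 t; have := h2 t; lra.
Qed.

(** At the bifurcation value of the equation with a jump, the attractor and the
    repeller of the two translated halves meet exactly: a smaller gap leaves no
    room for a bounded solution, a larger one a whole attractor-repeller pair,
    which persists for smaller parameters. *)
Lemma jump_gap p a r gm (g0 : R) gp : reg p -> attractor_repeller_pair (cst 0) p a r ->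
  reg (jump gm g0 gp 0) -> a 0 + gm < r 0 + gp ->
  exists2 linf : R, 0 < linf & gap_parameters p (gp - gm) = [set linf] /\
    lambda_star (coefQ (jump gm g0 gp 0)) (coefP (jump gm g0 gp 0) p) = linf.
Proof.
move=> rp ar rG gap; set G := jump gm g0 gp 0.
have [l0 bif] := bifurcation_exists rG rp.
have bifP l : has_bounded G (fun t => p t + l) <-> l0 <= l.
  apply: iff_trans (bif l); rewrite coefP_shift; apply: has_boundedP => //.
  exact: reg_shift.
have p0 : (fun t => p t + 0) = p by apply/funext => t; rewrite addr0.
have l00 : 0 < l0.
  rewrite ltNge; apply/negP => /bifP; rewrite p0 => -[b [sb _]].
  by have [b1 _ b2] := jump_bounded rp ar (lexx 0) sb; lra.
have rl := reg_shift l0 rp.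
have ar0 : attractor_repeller_pair (cst 0) (fun t => p t + 0) a r by rewrite p0.
have [a' [r' ar']] : exists a' r',
    attractor_repeller_pair (cst 0) (fun t => p t + l0) a' r'.
  move: (ar); rewrite -{1}coefQ0 -{1}(coefP0 p).
  move=> /(pair_separated reg0 rp)[sa _ [B hB] _].
  rewrite -p0 in sa.
  have la := gsol_strict_lower l00 sa (fun t => (hB t).1).
  have [|a1 [r1 [ar1 _]]] := lower_AR reg0 rl _ la; first by rewrite subr0.
  by exists a1, r1; rewrite -coefQ0 -(coefP0 (fun t => p t + l0)).
have gap_l0 : a' 0 - r' 0 = gp - gm.
  apply/le_anti/andP; split; last first.
    have [b [sb _]] : has_bounded G (fun t => p t + l0) by apply/bifP.
    by have [b1 _ b2] := jump_bounded rl ar' (lexx 0) sb; lra.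
  rewrite leNgt; apply/negP => gt.
  have [|||a1 [r1 ar1]] := @jump_AR _ _ a' r' gm g0 gp 0 rl ar' (lexx 0) rG
      (fun=> a' 0 + gm - g0).
  - by split=> u; lra.
  - by [].
  - lra.
  have [m [al [m0 [B al1 al2]]]] := pair_strict_lower rG rl ar1.
  have lal : strict_lower G (fun t => p t + (l0 - m / 2)) (m / 2) al.
    split=> // t; have [l hl lm] := al2 t; exists l => //.
    by move: lm; rewrite /field /=; move: (- _ ^+ 2) => f; lra.
  have m2 : 0 < m / 2 by lra.
  have : l0 <= l0 - m / 2.
    by apply/bifP; exact: lower_has_bounded rG (reg_shift _ rp) m2 lal.
  lra.
exists l0 => //; split; last exact: bifurcation_value_uniq (lambda_starP bif) bif.
have [ls bifs] := bifurcation_exists reg0 rp; rewrite coefQ0 coefP0 in bifs.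
apply/seteqP; split=> [l [_ [a2 [r2 [ar2 gap2]]]]|_ ->].
  have [ll|ll|//] := ltgtP l l0.
    by have := pair_gap_mono rp ll ar2 ar' 0; lra.
  by have := pair_gap_mono rp ll ar' ar2 0; lra.
split; last by exists a', r'.
have := lambda_starP bifs 0; rewrite p0 => hs.
by apply: le_lt_trans l00; apply/hs; exists a; have [[]] := ar.
Qed.

Lemma tail_minimum (S : R -> Prop) (L : R) :
  (exists2 C, L <= C & forall c, C < c -> S c) ->
  exists2 m, L <= m & is_minimum [set C : R | L <= C /\ forall c, C < c -> S c] m.
Proof.
move=> [C LC hC]; pose E := [set C : R | L <= C /\ forall c, C < c -> S c].
have ne : E !=set0 by exists C.
have lb : has_lbound E by exists L => x [].
exists (inf E); first by apply: lb_le_inf => // x [].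
split; last exact: ge_inf.
split; first by apply: lb_le_inf => // x [].
move=> c /(inf_lt ne)[x [_ hx] xc]; exact: hx.
Qed.

Lemma is_minimum_opp (E F : set R) m : (forall x : R, F x <-> E (- x)) ->
  is_minimum E m -> is_maximum F (- m).
Proof.
move=> FE [Em lm]; split; first by apply/FE; rewrite opprK.
by move=> x /FE/lm; rewrite lerNr.
Qed.

(** Reflecting [Gam] exchanges the two limits and reverses the rate, which reduces
    negative rates to positive ones. *)
Lemma transition_opp Gam gm gp (c : \bar R) h :
  transition (fun t => Gam (- t)) gp gm c h = transition Gam gm gp (- c)%E h.
Proof.
apply/funext => t; case: c => [c||] /=; rewrite ?oppr0//.
by case: eqP => _; rewrite ?mulNr.
Qed.

(** For small rates the transition function varies slowly. *)
Lemma transition_small Gam p gm gp a r h : continuous Gam ->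
  Gam t @[t --> -oo] --> gm -> Gam t @[t --> +oo] --> gp -> reg p ->
  attractor_repeller_pair (cst 0) p a r -> 0 <= h ->
  exists2 c0 : R, 0 < c0 & forall c, - c0 < c < c0 ->
    exists a' r', attractor_repeller_pair (transQ Gam gm gp c%:E h)
      (transP Gam gm gp p c%:E h) a' r'.
Proof.
move=> cG hm hp rp ar h0; have [M [M0 hG gmM gpM]] := limits_bounded cG hm hp.
have [e e0 He] := slow_shift_AR rp ar.
have [c0 c00 hc] := transition_slow cG hm hp h0 e0.
exists c0 => // c cc; have [rG _] := transition_reg c%:E cG hG gmM gpM h0.
exact: He rG (hc c cc).
Qed.

(** The equation at infinite rate is decided by the position of the solution at
    [h] relative to the repeller, and both alternatives persist for large finite
    rates. Slow transitions keep the rates without bounded solutions away from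
    zero. *)
Lemma transition_right Gam p gm gp a r h : continuous Gam ->
  Gam t @[t --> -oo] --> gm -> Gam t @[t --> +oo] --> gp -> reg p ->
  attractor_repeller_pair (cst 0) p a r -> 0 <= h ->
  let Q := fun (c : \bar R) k => transQ Gam gm gp c k in
  let P := fun (c : \bar R) k => transP Gam gm gp p c k in
  let x_at_h := fun x0 z : R => flow_value (cst 0) p 0 x0 h z in
  ((exists2 z : R, x_at_h (a 0 + gm - Gam 0) z & r h + gp - Gam 0 < z) ->
     (exists a1 r1 : R -> R,
        attractor_repeller_pair (Q +oo%E h) (P +oo%E h) a1 r1) /\
     (exists2 cM : R, 0 <= cM &
        is_minimum [set C : R | 0 <= C /\
          forall c : R, C < c -> case_A (Q c%:E h) (P c%:E h)] cM)) /\
  ((~ (exists z : R, x_at_h (a 0 + gm - Gam 0) z) \/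
    (exists2 z : R, x_at_h (a 0 + gm - Gam 0) z & z < r h + gp - Gam 0) ->
     case_C (Q +oo%E h) (P +oo%E h) /\
     (exists2 cM : R, 0 < cM &
        is_minimum [set C : R |
          forall c : R, C < c -> case_C (Q c%:E h) (P c%:E h)] cM)) /\
   (a 0 + gm < r 0 + gp ->
      exists2 linf : R, 0 < linf &
        gap_parameters p (gp - gm) = [set linf] /\
        lambda_star (Q +oo%E 0) (P +oo%E 0) = linf)).
Proof.
move=> cG hm hp rp ar h0 Q P x_at_h.
have [M [M0 hG gmM gpM]] := limits_bounded cG hm hp.
have tr (c : \bar R) (k : R) (k0 : 0 <= k) := transition_reg c cG hG gmM gpM k0.
have [rI bI] := tr +oo%E h h0.
split; [|split].
- move=> [z /(flow_value_psol rp)[x [hx x0 xz]] hz].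
  have [a1 [r1 ar1]] : exists a1 r1, attractor_repeller_pair (Q +oo%E h) (P +oo%E h) a1 r1.
    by apply: (@jump_AR _ p a r gm (Gam 0) gp h rp ar h0 rI x hx x0); rewrite xz.
  split; first by exists a1, r1.
  apply: tail_minimum.
  have [e [eta [e0 eta0 H]]] := persist_AR rI rp M0 bI ar1.
  have [C C0 hC] := transition_close_infty hm hp h0 e0 eta0.
  exists C => // c Cc; have [rc bc] := tr c%:E h h0.
  have [a2 [r2 ar2]] := H _ rc bc (hC c Cc).
  exact: AR_case_A rc rp ar2.
- move=> hyp; have nb : ~ has_bounded (transition Gam gm gp +oo%E h) p.
    exact: (@jump_no_bounded _ p a r gm (Gam 0) gp h rp ar h0 hyp).
  have caseC G : reg G -> ~ has_bounded G p -> case_C (coefQ G) (coefP G p).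
    by move=> rG nG /(has_boundedP rG rp).
  split; first exact: caseC.
  have [c0 c00 hc0] := transition_small cG hm hp rp ar h0.
  pose S c := case_C (Q c%:E h) (P c%:E h).
  have low C : (forall c, C < c -> S c) -> c0 <= C.
    move=> hC; rewrite leNgt; apply/negP => Cc0.
    pose c := (Num.max C 0 + c0) / 2.
    have mC : C <= Num.max C 0 by rewrite le_max lexx.
    have m0 : 0 <= Num.max C 0 by rewrite le_max lexx orbT.
    have mc : Num.max C 0 < c0 by rewrite gt_max Cc0.
    have [|a1 [r1 ar1]] := hc0 c; first by rewrite /c; lra.
    by apply: (AR_not_case_C ar1); apply: hC; rewrite /c; lra.
  have [e [eta [e0 eta0 H]]] := persist_no_bounded rI rp M0 bI nb.
  have [C C0 hC] := transition_close_infty hm hp h0 e0 eta0.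
  have hS c : C < c -> S c.
    by move=> Cc; have [rc bc] := tr c%:E h h0; apply: caseC => //; exact: H (hC c Cc).
  have [|m cm mm] := @tail_minimum S c0; first by exists C => //; exact: low.
  exists m; first exact: lt_le_trans cm.
  rewrite (_ : [set _ | _] = [set C : R | c0 <= C /\ forall c, C < c -> S c])//.
  by apply/seteqP; split=> [x hx|x []//]; split=> //; exact: low.
- have [r0 _] := tr +oo%E 0 (lexx 0).
  exact: (@jump_gap p a r gm (Gam 0) gp rp ar r0).
Qed.

End Assembly.

Theorem theorem5p5 (R : realType) (Gam p : R -> R) (gm gp : R)
    (Gam_cont : continuous Gam)
    (Gam_m : Gam t @[t --> -oo] --> gm)
    (Gam_p : Gam t @[t --> +oo] --> gp)
    (p_BPUC : BPUC p)
    (a r : R -> R)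
    (ar_pair : attractor_repeller_pair (cst 0) p a r)
    (h : R) (h_ge0 : 0 <= h) :
  let Q := fun (c : \bar R) (k : R) => transQ Gam gm gp c k in
  let P := fun (c : \bar R) (k : R) => transP Gam gm gp p c k in
  let x_at_h := fun x0 z : R => flow_value (cst 0) p 0 x0 h z in
  (* (i) *)
  (exists2 c0 : R, 0 < c0 &
     forall c : R, - c0 < c < c0 -> case_A (Q c%:E h) (P c%:E h)) /\
  (* (ii) *)
  ((exists2 z : R, x_at_h (a 0 + gm - Gam 0) z & r h + gp - Gam 0 < z) ->
     (exists a1 r1 : R -> R,
        attractor_repeller_pair (Q +oo%E h) (P +oo%E h) a1 r1) /\
     (exists2 cM : R, 0 <= cM &
        is_minimum [set C : R | 0 <= C /\
          forall c : R, C < c -> case_A (Q c%:E h) (P c%:E h)] cM)) /\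
  (* (iii) *)
  ((~ (exists z : R, x_at_h (a 0 + gm - Gam 0) z) \/
    (exists2 z : R, x_at_h (a 0 + gm - Gam 0) z & z < r h + gp - Gam 0) ->
     case_C (Q +oo%E h) (P +oo%E h) /\
     (exists2 cM : R, 0 < cM &
        is_minimum [set C : R |
          forall c : R, C < c -> case_C (Q c%:E h) (P c%:E h)] cM)) /\
   (a 0 + gm < r 0 + gp ->
      exists2 linf : R, 0 < linf &
        gap_parameters p (gp - gm) = [set linf] /\
        lambda_star (Q +oo%E 0) (P +oo%E 0) = linf)) /\
  (* (iv) *)
  ((exists2 z : R, x_at_h (a 0 + gp - Gam 0) z & r h + gm - Gam 0 < z) ->
     (exists a1 r1 : R -> R,
        attractor_repeller_pair (Q -oo%E h) (P -oo%E h) a1 r1) /\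
     (exists2 cm : R, cm <= 0 &
        is_maximum [set C : R | C <= 0 /\
          forall c : R, c < C -> case_A (Q c%:E h) (P c%:E h)] cm)) /\
  (* (v) *)
  ((~ (exists z : R, x_at_h (a 0 + gp - Gam 0) z) \/
    (exists2 z : R, x_at_h (a 0 + gp - Gam 0) z & z < r h + gm - Gam 0) ->
     case_C (Q -oo%E h) (P -oo%E h) /\
     (exists2 cm : R, cm < 0 &
        is_maximum [set C : R |
          forall c : R, c < C -> case_C (Q c%:E h) (P c%:E h)] cm)) /\
   (a 0 + gp < r 0 + gm ->
      exists2 linf : R, 0 < linf &
        gap_parameters p (gm - gp) = [set linf] /\
        lambda_star (Q -oo%E 0) (P -oo%E 0) = linf)).
Proof.
move=> Q P x_at_h; have rp := BPUC_reg p_BPUC.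
pose Gam' := fun t => Gam (- t).
have Gam'_cont : continuous Gam'.
  by move=> t; apply: continuous_comp; [exact: opp_continuous|exact: Gam_cont].
have Gam'_m : Gam' t @[t --> -oo] --> gp 
  by apply: cvg_comp Gam_p; rewrite ninftyN; exact: cvg_id.
have Gam'_p : Gam' t @[t --> +oo] --> gm 
  by apply: cvg_comp Gam_m; apply/cvgNrNy; exact: cvg_id.
have [c0 c00 hc0] := transition_small Gam_cont Gam_m Gam_p rp ar_pair h_ge0.
have [ii iii] := transition_right Gam_cont Gam_m Gam_p rp ar_pair h_ge0.
have QE (c : \bar R) (k : R) : transQ Gam' gp gm c k = Q (- c)%E k.
  by apply/funext => t; rewrite /Q /transQ transition_opp.
have PE (c : \bar R) (k : R) : transP Gam' gp gm p c k = P (- c)%E k.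
  by apply/funext => t; rewrite /P /transP transition_opp.
have G0 : Gam' 0 = Gam 0 by rewrite /Gam' oppr0.
have tailE (S : R -> Prop) (x : R) :
    (forall c : R, c < x -> S c) <-> (forall c : R, - x < c -> S (- c)).
  split=> hS c hc; first by apply: hS; rewrite ltrNl.
  by rewrite -[c]opprK; apply: hS; rewrite ltrN2.
have [iv [v vgap]] := transition_right Gam'_cont Gam'_m Gam'_p rp ar_pair h_ge0.
rewrite G0 !QE !PE /= in iv v vgap.
split.
  exists c0 => // c hc; have [a' [r' ar']] := hc0 c hc.
  have [M [M0 hG gmM gpM]] := limits_bounded Gam_cont Gam_m Gam_p.
  have [rG _] := transition_reg c%:E Gam_cont hG gmM gpM h_ge0.
  exact: (AR_case_A rG rp ar').
split=> //; split=> //; split; [|split=> //].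
- move=> /iv[ar [cM cM0 mM]]; split=> //; exists (- cM); first by rewrite oppr_le0.
  apply: is_minimum_opp mM => x /=; rewrite oppr_ge0.
  have := tailE (fun c => case_A (Q c%:E h) (P c%:E h)) x.
  move=> [t1 t2]; split=> -[x0 hx]; split=> // c hc.
    by rewrite QE PE; exact: t1 hx c hc.
  by apply: t2 hc => c' /hx; rewrite QE PE.
- move=> /v[nC [cM cM0 mM]]; split=> //; exists (- cM); first by rewrite oppr_lt0.
  apply: is_minimum_opp mM => x /=.
  have := tailE (fun c => case_C (Q c%:E h) (P c%:E h)) x.
  move=> [t1 t2]; split=> hx c hc; first by rewrite QE PE; exact: t1 hx c hc.
  by apply: t2 hc => c' /hx; rewrite QE PE.
Qed.
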